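(* Let $n\ge 2$, let $\Omega\subset\mathbb{R}^n$ be a domain, and let $F\in C^1(\Omega\times\mathbb{R}\times\mathbb{R}^n\times\mathcal{S}^{n\times n})$ be such that the matrix $\left(-\frac{\partial F}{\partial M_{ij}}(x,s,p,M)\right)$ is positive definite for all $(x,s,p,M)\in\Omega\times\mathbb{R}\times\mathbb{R}^n\times\mathcal{S}^{n\times n}$. Let $E\subset\Omega$ be a smooth closed submanifold of dimension $k$, $0\le k\le n-2$. Assume that $u\in C^2(\Omega\setminus E)$ and $v\in C^2(\Omega)$ satisfy $$\lambda_1(\nabla^2u)+\cdots+\lambda_{k+2}(\nabla^2u)\le 0\qquad\text{in }\Omega\setminus E,$$ $$u>v\qquad\text{in }\Omega\setminus E,$$ $$F(x,u,\nabla u,\nabla^2u)\ge F(x,v,\nabla v,\nabla^2v)\qquad\text{in }\Omega\setminus E.$$ Then $$\liminf_{x\in\Omega\setminus E,\ \mathrm{dist}(x,E)\to0}(u-v)(x)>0.$$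
   Context: A domain is a bounded connected open set. $\mathcal{S}^{n\times n}$ is the set of real symmetric $n\times n$ matrices. For a symmetric matrix $M$, its eigenvalues are ordered as $\lambda_1(M)\le\lambda_2(M)\le\cdots\le\lambda_n(M)$. A closed submanifold is a compact submanifold without boundary (for $k=0$: finitely many points). *)

(* Defs.v *)
From HB Require Import structures.
From mathcomp Require Import all_boot all_order all_algebra.
From mathcomp Require Import spectral complex.
From mathcomp Require Import all_classical all_reals all_analysis.

Set Implicit Arguments.
Unset Strict Implicit.
Unset Printing Implicit Defensive.

Import Order.TTheory GRing.Theory Num.Theory.
Import numFieldNormedType.Exports.

Local Open Scope classical_set_scope.
Local Open Scope ring_scope.

(* f is of class C^m on A, where A is a relatively open subset of (a translate
   of) the linear subspace D of the finite-dimensional space V: all iterated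
   directional derivatives along D up to order m exist and are continuous on A.
   Derivatives along D at points of A only involve the values of f on A, so f
   may be arbitrary elsewhere; D = setT is the case of an open set A of V. *)
Fixpoint Cm_along (R : realType) (V W : normedModType R) (D : set V) (m : nat)
    (A : set V) (f : V -> W) : Prop :=
  {within A, continuous f} /\
  if m is m'.+1 then
    forall d : V, D d ->
      (forall x, A x -> derivable f x d) /\ Cm_along D m' A ('D_d f)
  else True.

Definition Cm (R : realType) (V W : normedModType R) (m : nat) (A : set V)
    (f : V -> W) : Prop := Cm_along setT m A f.

Definition smooth (R : realType) (V W : normedModType R) (A : set V)
    (f : V -> W) : Prop := forall m, Cm m A f.

(* The points (x, s, p, M) at which the operator F is evaluated. *)
Notation jet R n := ('rV[R]_n * R * 'rV[R]_n * 'M[R]_n)%type.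

Section Euclidean.
Context {R : realType} {n : nat}.
Implicit Types (x y : 'rV[R]_n) (A E Omega : set 'rV[R]_n) (M : 'M[R]_n).

Definition domain Omega : Prop :=
  [/\ bounded_set Omega, connected Omega & open Omega].

Definition symmx : set 'M[R]_n := [set M | M^T = M].

Definition posdefmx M : Prop :=
  forall w : 'rV[R]_n, w != 0 -> 0 < (w *m M *m w^T) 0 0.

Definition grad (f : 'rV[R]_n -> R) x : 'rV[R]_n :=
  \row_i 'D_(delta_mx 0 i) f x.

Definition hess (f : 'rV[R]_n -> R) x : 'M[R]_n :=
  \matrix_(i, j) 'D_(delta_mx 0 i) ('D_(delta_mx 0 j) f) x.

(* The eigenvalues of M with algebraic multiplicity, in nondecreasing order;
   specified by eigenvaluesP below when M is symmetric (the default [::] is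
   used only when char_poly M does not split over R). *)
Definition eigenvalues M : seq R :=
  xget [::] [set s | sorted <=%R s /\ char_poly M = \prod_(a <- s) ('X - a%:P)].

Lemma eigenvaluesP M : M^T = M ->
  sorted <=%R (eigenvalues M) /\
  char_poly M = \prod_(a <- eigenvalues M) ('X - a%:P).
Proof.
move=> Msym; rewrite /eigenvalues; case: xgetP => [s _ //|none]; exfalso.
pose toC := real_complex R.
pose A := map_mx toC M; pose P := spectralmx A; pose d := spectral_diag A.
have Ar : A \is a realmx.
  by apply/mxOverP => i j; rewrite mxE /toC complex_real.
have As : A \is hermsymmx.
  apply: realsym_hermsym => //; apply/is_hermitianmxP.
  by rewrite expr0 scale1r map_mx_id // /A map_trmx Msym.
have /orthomx_spectralP AE := hermitian_normalmx As.
have /mxOverP dr := hermitian_spectral_diag_real As.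
have chA : char_poly A = \prod_i ('X - (d 0 i)%:P).
  have Pu : P \in unitmx by exact: spectral_unit.
  rewrite AE -/P -/d; transitivity (char_poly (diag_mx d)).
    rewrite /char_poly.
    have -> : char_poly_mx (invmx P *m diag_mx d *m P) =
       map_mx polyC (invmx P) *m char_poly_mx (diag_mx d) *m map_mx polyC P.
      rewrite /char_poly_mx mulmxBr mulmxBl -!map_mxM; congr (_ - _).
      by rewrite scalar_mxC -mulmxA -map_mxM mulVmx // map_mx1 mulmx1.
    rewrite !det_mulmx mulrC mulrA -det_mulmx -map_mxM mulmxV // map_mx1.
    by rewrite det1 mul1r.
  rewrite char_poly_trig; last first.
    by apply/is_trig_mxP => i j; rewrite mxE -val_eqE /=; case: ltngtP.
  by apply: eq_bigr => i _; rewrite mxE eqxx mulr1n.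
pose s := sort <=%R [seq complex.Re (d 0 i) | i <- enum 'I_n].
apply: (none s); split; first by apply: sort_sorted; exact: le_total.
apply: (map_poly_inj toC); rewrite map_char_poly -/A chA.
rewrite (perm_big [seq complex.Re (d 0 i) | i <- enum 'I_n]) /=; last first.
  by rewrite /s perm_sort.
rewrite big_map big_enum rmorph_prod /=; apply: eq_bigr => i _.
by rewrite rmorphB /= map_polyX map_polyC /= /toC RRe_real.
Qed.

(* lambda i M is the (i+1)-st smallest eigenvalue of M. *)
Definition lambda (i : nat) M : R := (eigenvalues M)`_i.

(* The distance is taken in \bar R, so that it is +oo to the empty set. *)
Definition eucl_dist x E : \bar R :=
  ereal_inf [set (Num.sqrt (\sum_i (x 0 i - y 0 i) ^+ 2))%:E | y in E].

(* The filter "x \in A, dist(x, E) -> 0". *)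
Definition dist_to0 A E : set_system 'rV[R]_n :=
  filter_from [set e : R | 0 < e]
    (fun e => [set x | A x /\ (eucl_dist x E < e%:E)%E]).

(* k-dimensional embedded smooth submanifold, via slice charts: near each of
   its points, E is carried by a smooth diffeomorphism phi : U -> W between
   open sets of R^n (with inverse psi) onto W `&` (R^k * {0}). *)
Definition smooth_submanifold (k : nat) E : Prop :=
  forall p, E p -> exists (U W : set 'rV[R]_n) (phi psi : 'rV[R]_n -> 'rV[R]_n),
    [/\ [/\ open U, open W & U p],
        smooth U phi /\ smooth W psi,
        (forall x, U x -> W (phi x) /\ psi (phi x) = x),
        (forall y, W y -> U (psi y) /\ phi (psi y) = y)
      & forall x, U x -> (E x <-> forall i : 'I_n, (k <= i)%N -> phi x 0 i = 0)].

Definition closed_submanifold (k : nat) E : Prop :=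
  compact E /\ smooth_submanifold k E.

Implicit Types (F : jet R n -> R) (z : jet R n).

(* F of class C^1 on Omega * R * R^n * S^{n*n}; only the values of F at
   symmetric M matter. *)
Definition C1_operator Omega F : Prop :=
  Cm_along [set d : jet R n | symmx d.2] 1
    [set z : jet R n | Omega z.1.1.1 /\ symmx z.2] F.

(* The symmetric matrix (dF/dM_ij) representing the differential of F in M, i.e.
   dF(N) = \sum_(i, j) (dF/dM_ij) N_ij for symmetric N.  Equivalently, dF/dM_ij
   is the partial derivative of the extension M |-> F(x, s, p, (M + M^T) / 2)
   to all matrices, hence the direction (E_ij + E_ji) / 2. *)
Definition dF_dM F z : 'M[R]_n :=
  \matrix_(i, j)
    'D_((0, 0, 0, 2^-1 *: (delta_mx i j + delta_mx j i)) : jet R n) F z.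

End Euclidean.

(* Main.v *)
Require Import Defs.
From mathcomp Require Import all_boot all_order all_algebra.
From mathcomp Require Import perm spectral complex ring lra.
From mathcomp Require Import all_classical all_reals all_analysis.

(** Suppose that w = u - v is not bounded below by a positive constant near E,
    and let d be the distance to E.  For small eps, the function
    w - eps (1 + A d^2) then has a negative infimum m0 on a thin tubular
    neighbourhood of E and is positive on the outer boundary.  At an interior
    minimum of it, or of a slight perturbation of it, grad u and a lower bound
    of hess u are prescribed, and ellipticity contradicts the inequality between
    F(x, u, ..) and F(x, v, ..), the choice of A making the Hessian of eps A d^2
    dominant.  A minimum is attained because the infimum is not approached at E:
    - w - eps (1 + A d^2) - m0 >= delta d near E, for otherwise subtracting a
      function that is nonpositive on E, nearly linear in the direction normal
      to E, produces an interior minimum;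
    - given that linear growth, comparison with the barrier
      (delta / 2) d + 2 gamma ln d, gamma -> 0, gives a positive lower bound near
      E: at a minimum the sum of the k + 2 lowest eigenvalues of hess u would be
      positive, since -ln d is harmonic on planes and E has codimension >= 2.
    Differentiability of d^2 is never needed: at each minimum, d^2 is replaced by
    a quadratic polynomial that touches it from below. *)

Set Implicit Arguments.
Unset Strict Implicit.
Unset Printing Implicit Defensive.

Import Order.TTheory GRing.Theory Num.Theory.
Import numFieldNormedType.Exports.

Local Open Scope classical_set_scope.
Local Open Scope ring_scope.

(** * Directional derivatives *)

(** No regularity of [u] across [E] is assumed, so a minimizing sequence may converge to [E], where
    the inequality for [F] says nothing; there only the eigenvalue hypothesis helps. The logarithm
    alone is no strict barrier: it is exactly balanced in two normal directions, while [hess v]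
    contributes an error O(1) and the curvature of [E] an error O(gamma/d). The linear term adds
    delta/(2d) to the sum of the k + 2 lowest eigenvalues and absorbs both once d and gamma/delta
    are small; it is affordable only because linear growth is known beforehand.

    The comparison function uses d^2 because its Hessian is about 2 in at least two normal
    directions while its gradient has size 2d: ellipticity gains a multiple of eps A, and up to a
    constant the values and the gradient cost about 2 eps and 2 n eps A d. So A depends on the
    ellipticity constant alone and eps remains free.

    All estimates on [F] are made at jets close to those of [v]: at a minimum, [u], its gradient and
    a lower bound for its Hessian are close to the corresponding data of [v]. *)

Lemma line_near (R : realType) (V : normedModType R) (x d : V) (P : V -> Prop) :
  (\forall y \near x, P y) -> \forall h \near (0 : R), P (x + h *: d).
Proof.
have : (fun h : R => x + h *: d) @ (0 : R) --> x + (0 : R) *: d.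
  by apply: cvgD; [exact: cvg_cst | apply: cvgZr_tmp; exact: cvg_id].
by rewrite scale0r addr0 => /(_ P).
Qed.

Section Directional.
Context {R : realType} {V : normedModType R}.
Implicit Types (f g : V -> R) (x y d e : V) (A : set V).

Lemma is_derive_line (W : normedModType R) (f : V -> W) x d (t : R) :
  derivable f (x + t *: d) d ->
  is_derive t 1 (fun s : R => f (x + s *: d)) ('D_d f (x + t *: d)).
Proof.
move=> fd.
have E : (fun h : R => h^-1 *: (((fun s : R => f (x + s *: d)) \o shift t)
    (h *: 1) - f (x + t *: d))) =
  (fun h : R => h^-1 *: ((f \o shift (x + t *: d)) (h *: d) - f (x + t *: d))).
  apply/funext => h /=; congr (_ *: (f _ - _)).
  by rewrite /shift /= [h *: 1]mulr1 scalerDl addrCA.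
by split; [rewrite /derivable E | rewrite /derive E].
Qed.

Lemma line_is_derive (W : normedModType R) (f : V -> W) x d l :
  is_derive (0 : R) 1 (fun s : R => f (x + s *: d)) l -> is_derive x d f l.
Proof.
move=> [fd <-].
have E : (fun h : R => h^-1 *: (((fun s : R => f (x + s *: d)) \o shift (0 : R))
    (h *: 1) - f (x + (0 : R) *: d))) =
  (fun h : R => h^-1 *: ((f \o shift x) (h *: d) - f x)).
  apply/funext => h /=; rewrite scale0r !addr0; congr (_ *: (f _ - _)).
  by rewrite [h *: 1]mulr1 addrC.
by split; [rewrite /derivable -E | rewrite /derive -E].
Qed.

Lemma mvt_line f x d :
  (forall t : R, 0 <= t <= 1 -> derivable f (x + t *: d) d) ->
  exists2 t : R, 0 <= t <= 1 & f (x + d) - f x = 'D_d f (x + t *: d).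
Proof.
move=> fd.
have [||c c01] := @MVT_segment R (fun s : R => f (x + s *: d))
   (fun s => 'D_d f (x + s *: d)) 0 1 ler01.
- move=> t; rewrite in_itv /= => /andP[t0 t1].
  by apply: is_derive_line; apply: fd; rewrite !ltW.
- apply: derivable_within_continuous => t; rewrite in_itv /= => t01.
  by have [] := is_derive_line (fd t t01).
rewrite scale1r scale0r addr0 subr0 mulr1 => ->.
by exists c => //; move: c01; rewrite in_itv.
Qed.

Lemma is_derive_scale f x d (a : R) :
  derivable f x d -> is_derive x (a *: d) f (a * 'D_d f x).
Proof.
move=> fd; apply: line_is_derive.
have -> : (fun s : R => f (x + s *: (a *: d))) =
    (fun s : R => f (x + s *: d)) \o (fun s : R => s * a).
  by apply/funext => s /=; rewrite scalerA.
rewrite mulrC; apply: is_derive1_comp.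
  have := @is_derive_line _ f x d (0 * a).
  by rewrite mul0r scale0r addr0; exact.
have -> : *%R^~ a = a \*: (id : R -> R) by apply/funext => s; rewrite /= mulrC.
by apply: (is_derive_eq (is_deriveZ _ _)); rewrite [_ *: _]mulr1.
Qed.

Section open_set.
Variable A : set V.
Hypothesis oA : open A.

Lemma within_openP (W : topologicalType) (f : V -> W) :
  {within A, continuous f} <-> (forall x, A x -> {for x, continuous f}).
Proof.
rewrite continuous_open_subspace //; split => fc x Ax; apply: fc.
  by rewrite inE.
by rewrite inE in Ax.
Qed.

Lemma Cm_continuous (W : normedModType R) m (f : V -> W) x :
  Cm m A f -> A x -> {for x, continuous f}.
Proof. by case: m => [|m] [fc _] Ax; apply: (within_openP f).1. Qed.

Lemma Cm_derivable (W : normedModType R) m (f : V -> W) x d :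
  Cm m.+1 A f -> A x -> derivable f x d.
Proof. by case=> _ /(_ d I)[fd _] Ax; exact: fd. Qed.

Lemma Cm_derive (W : normedModType R) m (f : V -> W) d :
  Cm m.+1 A f -> Cm m A ('D_d f).
Proof. by case=> _ /(_ d I)[]. Qed.

Lemma CmW (W : normedModType R) m (f : V -> W) : Cm m.+1 A f -> Cm m A f.
Proof.
elim: m f => [|m IH] f; first by case.
by case=> fc fd; split=> // d _; have [fd1 fd2] := fd d I; split=> //; exact: IH.
Qed.

Lemma open_near_eq (W : Type) (f g : V -> W) x :
  (forall y, A y -> f y = g y) -> A x -> \forall y \near x, f y = g y.
Proof.
move=> fg Ax; have := open_nbhs_nbhs (conj oA Ax).
by apply: filterS => y /fg.
Qed.

Lemma Cm_ext (W : normedModType R) m (f g : V -> W) :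
  (forall x, A x -> f x = g x) -> Cm m A f -> Cm m A g.
Proof.
elim: m f g => [|m IH] f g fg [fc fd].
  split=> //; apply/within_openP => x Ax.
  have fx := (within_openP f).1 fc x Ax.
  rewrite /prop_for /continuous_at -fg //; apply: cvg_trans fx.
  by apply: near_eq_cvg; exact: open_near_eq.
split.
  apply/within_openP => x Ax.
  have fx := (within_openP f).1 fc x Ax.
  rewrite /prop_for /continuous_at -fg //; apply: cvg_trans fx.
  by apply: near_eq_cvg; exact: open_near_eq.
move=> d _; have [fd1 fd2] := fd d I; split=> [x Ax|].
  by apply: near_eq_derivable (fd1 x Ax); exact: open_near_eq.
apply: IH fd2 => x Ax; apply: near_eq_derive; exact: open_near_eq.
Qed.

Lemma segment_near x d : A x -> \forall h \near (0 : R), A (x + h *: d).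
Proof. by move=> Ax; apply: line_near; exact: open_nbhs_nbhs. Qed.

(** [Cm] speaks of directional derivatives only, so linearity in the direction has to be derived.
    The increment along [d + e] is split at [x + h *: d]; the mean value theorem turns the second
    part into a derivative along [e] at a nearby point, and continuity of ['D_e f] gives the
    limit. *)
Lemma is_deriveD_dir f x d e : Cm 1 A f -> A x ->
  is_derive x (d + e) f ('D_d f x + 'D_e f x).
Proof.
move=> f1 Ax.
suff H : h^-1 *: ((f \o shift x) (h *: (d + e)) - f x) @[h --> 0^'] -->
    'D_d f x + 'D_e f x.
  by split; [apply/cvg_ex; exists ('D_d f x + 'D_e f x) | exact: cvg_lim H].
have -> : (fun h : R => h^-1 *: ((f \o shift x) (h *: (d + e)) - f x)) =
  (fun h : R => h^-1 *: ((f \o shift x) (h *: d) - f x)) \+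
  (fun h : R => h^-1 *: (f (x + h *: d + h *: e) - f (x + h *: d))).
  apply/funext => h /=; rewrite -scalerDr; congr (_ *: _).
  have -> : h *: (d + e) + x = x + h *: d + h *: e by rewrite scalerDr addrC addrA.
  by rewrite [h *: d + x]addrC; ring.
apply: cvgD; first exact: Cm_derivable f1 Ax.
have ec := Cm_continuous (Cm_derive e f1) Ax.
apply/cvgrPdist_lt => eps eps0.
have [r /= r0 rA] : \forall r \near (0:R)^'+, forall y, `|y - x| < r ->
    A y /\ `|'D_e f x - 'D_e f y| < eps.
  have /nbhs_ballP[r /= r0 rb] : \forall y \near x, A y /\ `|'D_e f x - 'D_e f y| < eps.
    near=> y; split; near: y; first exact: open_nbhs_nbhs.
    by move/cvgrPdist_lt : ec; apply.
  near=> s => y ys; apply: rb; rewrite -ball_normE /= distrC.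
  by apply: lt_trans ys _; near: s; exact: nbhs_right_lt.
have {rA}[{r0}r r0 rA] : exists2 r : R, 0 < r & forall y, `|y - x| < r ->
    A y /\ `|'D_e f x - 'D_e f y| < eps.
  exists (r / 2); first by rewrite divr_gt0.
  apply: rA => /=; last by rewrite divr_gt0.
  by rewrite sub0r normrN gtr0_norm ?divr_gt0 // ltr_pdivrMr // ltr_pMr // ltr1n.
pose K := `|d| + `|e| + 1.
have K0 : 0 < K by rewrite ltr_wpDl // addr_ge0.
rewrite near_withinE; near=> h => h0.
have hK : `|h| * K < r.
  rewrite -ltr_pdivlMr //; near: h; apply/nbhs_ballP; exists (r / K) => /=; first exact: divr_gt0.
  by move=> y; rewrite -ball_normE /= sub0r normrN.
have P (t : R) : 0 <= t <= 1 -> `|x + h *: d + t *: (h *: e) - x| < r.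
  move=> /andP[t0 t1]; apply: le_lt_trans hK.
  rewrite -[x + _ + _]addrA [x + _]addrC addrK; apply: le_trans (ler_normD _ _) _.
  rewrite !normrZ (ger0_norm t0) /K !mulrDr -addrA lerD2l -[leLHS]addr0.
  by rewrite lerD // ?mulr_ge0 // ler_piMl.
have [t t01 ->] := @mvt_line f (x + h *: d) (h *: e)
   (fun t t01 => Cm_derivable f1 (rA _ (P t t01)).1).
have [Ay lty] := rA _ (P t t01).
have [_ ->] := is_derive_scale h (Cm_derivable f1 Ay : derivable f _ e).
by rewrite [_ *: _]mulrA mulVf // mul1r.
Unshelve. all: by end_near. Qed.

Lemma deriveD_dir f x d e : Cm 1 A f -> A x ->
  'D_(d + e) f x = 'D_d f x + 'D_e f x.
Proof. by move=> f1 Ax; have [] := is_deriveD_dir d e f1 Ax. Qed.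

Lemma derive_scale m f x d (a : R) : Cm m.+1 A f -> A x ->
  'D_(a *: d) f x = a * 'D_d f x.
Proof. by move=> f1 Ax; have [_ ->] := is_derive_scale a (Cm_derivable f1 Ax : derivable f x d). Qed.

Lemma derive_sum_dir (I : Type) (r : seq I) (c : I -> R) (b : I -> V) f x :
  Cm 1 A f -> A x ->
  'D_(\sum_(i <- r) c i *: b i) f x = \sum_(i <- r) c i * 'D_(b i) f x.
Proof.
move=> f1 Ax; elim: r => [|i r IH]; first by rewrite !big_nil derive0.
by rewrite !big_cons deriveD_dir // IH (derive_scale _ _ f1).
Qed.

Lemma derive2_scale f x d e (a b : R) : Cm 2 A f -> A x ->
  'D_(a *: e) ('D_(b *: d) f) x = a * b * 'D_e ('D_d f) x.
Proof.
move=> f2 Ax; rewrite (derive_scale e a (Cm_derive (b *: d) f2) Ax) -mulrA; congr (_ * _).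
rewrite (@near_eq_derive _ _ _ _ (b *: ('D_d f))); last first.
  apply: open_near_eq => // y Ay; exact: (derive_scale _ _ f2) Ay.
by rewrite deriveZ //; exact: Cm_derivable (Cm_derive _ f2) Ax.
Qed.

Lemma second_difference f x d e : Cm 2 A f ->
  (forall s t : R, 0 <= s <= 1 -> 0 <= t <= 1 -> A (x + s *: d + t *: e)) ->
  exists s t : R, [/\ 0 <= s <= 1, 0 <= t <= 1 &
   f (x + d + e) - f (x + d) - f (x + e) + f x =
   'D_e ('D_d f) (x + s *: d + t *: e)].
Proof.
move=> f2 P.
have f1 := CmW f2.
have i0 : 0 <= (0:R) <= 1 by rewrite lexx ler01.
have i1 : 0 <= (1:R) <= 1 by rewrite lexx ler01.
pose Phi y := f (y + e) - f y.
have Phid (s : R) : 0 <= s <= 1 -> is_derive (x + s *: d) d Phi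
    ('D_d f (x + s *: d + e) - 'D_d f (x + s *: d)).
  move=> s01.
  have A1 : A (x + s *: d + e) by have := P s 1 s01 i1; rewrite scale1r.
  have A0 : A (x + s *: d) by have := P s 0 s01 i0; rewrite scale0r addr0.
  apply: is_deriveB; last exact: (derivableP (Cm_derivable f1 A0)).
  apply: line_is_derive.
  have -> : (fun s0 : R => f (x + s *: d + s0 *: d + e)) =
            (fun s0 : R => f (x + s *: d + e + s0 *: d)).
    by apply/funext => h; rewrite addrAC.
  have := @is_derive_line _ f (x + s *: d + e) d 0.
  rewrite scale0r addr0; apply; exact: Cm_derivable f1 A1.
have [s s01] := @mvt_line Phi x d (fun s s01 => ex_derive (is_derive := Phid s s01)).
have [_ ->] := Phid s s01.
have [t t01 ->] := @mvt_line ('D_d f) (x + s *: d) e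
  (fun t t01 => Cm_derivable (Cm_derive _ f2) (P s t s01 t01)).
move=> E; exists s, t; split => //; rewrite -E /Phi.
by rewrite opprB addrA [in RHS]addrAC.
Qed.

Lemma continuous_close_eq (p q : V -> R) x :
  {for x, continuous p} -> {for x, continuous q} ->
  (forall r : R, 0 < r -> exists y z, [/\ ball x r y, ball x r z & p y = q z]) ->
  p x = q x.
Proof.
move=> pc qc pq; apply/eqP; rewrite -subr_eq0 -normr_le0.
apply/ler_addgt0Pl => eps eps0; rewrite addr0.
have e0 : 0 < eps / 2 by rewrite divr_gt0.
have /nbhs_ballP[r /= r0 rb] : \forall y \near x,
    `|p x - p y| < eps / 2 /\ `|q x - q y| < eps / 2.
  near=> y; split; near: y.
    by move/cvgrPdist_lt : pc; apply.
  by move/cvgrPdist_lt : qc; apply.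
have [y [z [/rb[py _] /rb[_ qz] E]]] := pq r r0.
have -> : p x - q x = (p x - p y) - (q x - q z) by rewrite E; ring.
apply: le_trans (ler_normB _ _) _; rewrite (splitr eps); exact/ltW/ltrD.
Unshelve. all: by end_near. Qed.

(** Schwarz's theorem: the mixed second difference is symmetric in its two increments, and by
    [second_difference] it equals either mixed derivative, up to the factor [h * h], at points
    arbitrarily close to [x]. *)
Lemma derive2_sym f x d e : Cm 2 A f -> A x ->
  'D_d ('D_e f) x = 'D_e ('D_d f) x.
Proof.
move=> f2 Ax.
have cde := Cm_continuous (Cm_derive d (Cm_derive e f2)) Ax.
have ced := Cm_continuous (Cm_derive e (Cm_derive d f2)) Ax.
apply: (continuous_close_eq cde ced) => r0 r00.
have nA := open_nbhs_nbhs (conj oA Ax).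
have [r [rgt0 rr0 rb]] : exists r : R, [/\ 0 < r, r <= r0 & ball x r `<=` A].
  have /nbhs_ballP[r1 /= r10 rb1] := nA.
  exists (Num.min r0 r1); split; [by rewrite lt_min r00 | by rewrite ge_min lexx |].
  by apply: subset_trans rb1; apply: le_ball; rewrite ge_min lexx orbT.
pose K := `|d| + `|e| + 1.
have K0 : 0 < K by rewrite ltr_wpDl // addr_ge0.
have [h h0 hr] : exists2 h : R, 0 < h & h * (`|d| + `|e|) < r.
  exists (r / 2 / K); first by rewrite !divr_gt0.
  apply: (@lt_trans _ _ (r / 2 / K * K)).
    by rewrite ltr_pM2l ?ltrDl // !divr_gt0.
  by rewrite mulfVK ?gt_eqF // ltr_pdivrMr // ltr_pMr // ltr1n.
have bl (a b : V) (s t : R) : `|a| + `|b| = `|d| + `|e| ->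
    0 <= s <= 1 -> 0 <= t <= 1 -> ball x r (x + s *: (h *: a) + t *: (h *: b)).
  move=> ab /andP[s0 s1] /andP[t0 t1].
  rewrite -ball_normE /= distrC -[x + _ + _]addrA [x + _]addrC addrK.
  apply: le_lt_trans hr; apply: le_trans (ler_normD _ _) _.
  rewrite !normrZ (ger0_norm s0) (ger0_norm t0) (gtr0_norm h0) -ab mulrDr.
  by rewrite lerD // ler_piMl // mulr_ge0 // ltW.
have [|s [t [s01 t01 E1]]] := @second_difference f x (h *: d) (h *: e) f2.
  by move=> s t s01 t01; apply: rb; exact: bl.
have [|s' [t' [s01' t01' E2]]] := @second_difference f x (h *: e) (h *: d) f2.
  by move=> s' t' s01' t01'; apply: rb; apply: bl; rewrite // addrC.
have By := bl d e s t erefl s01 t01.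
have By' := bl e d s' t' (addrC _ _) s01' t01'.
have F1 := derive2_scale d e h h f2 (rb _ By).
have F2 := derive2_scale e d h h f2 (rb _ By').
have S : f (x + h *: e + h *: d) - f (x + h *: e) - f (x + h *: d) + f x =
  f (x + h *: d + h *: e) - f (x + h *: d) - f (x + h *: e) + f x.
  have -> : x + h *: e + h *: d = x + h *: d + h *: e by rewrite addrAC.
  by ring.
exists (x + s' *: (h *: e) + t' *: (h *: d)), (x + s *: (h *: d) + t *: (h *: e)).
split; [exact: le_ball By' | exact: le_ball By |].
apply: (mulfI (mulf_neq0 (lt0r_neq0 h0) (lt0r_neq0 h0))).
exact: etrans (esym F2) (etrans (esym E2) (etrans S (etrans E1 F1))).
Unshelve. all: by end_near. Qed.

(** Two mean value steps replace Taylor's formula; the factor 1/2 in front of [K] is lost. *)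
Lemma taylor2_bound f x d (K : R) : Cm 2 A f ->
  (forall t : R, 0 <= t <= 1 -> A (x + t *: d) /\
     `|'D_d ('D_d f) (x + t *: d)| <= K) ->
  `|f (x + d) - f x - 'D_d f x| <= K.
Proof.
move=> f2 P.
have [t t01 ->] := @mvt_line f x d
  (fun t t01 => Cm_derivable (CmW f2) (P t t01).1).
have sub (s : R) : 0 <= s <= 1 -> 0 <= s * t <= 1.
  case/andP: t01 => t0 t1 /andP[s0 s1].
  by rewrite mulr_ge0 //= mulr_ile1.
have Es s : x + s *: (t *: d) = x + (s * t) *: d by rewrite scalerA.
have [|s s01 ->] := @mvt_line ('D_d f) x (t *: d).
  move=> s s01; rewrite Es.
  exact: Cm_derivable (Cm_derive _ f2) (P _ (sub s s01)).1.
have [As Ks] := P _ (sub s s01).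
rewrite Es (derive_scale _ _ (Cm_derive _ f2)) //.
case/andP: t01 => t0 t1.
rewrite normrM (ger0_norm t0); apply: le_trans Ks.
by rewrite ler_piMl.
Qed.

End open_set.

(** If [g2 < 0], then [g1] is negative just to the right of 0, and the mean value theorem makes [g]
    drop below [g 0]. *)
Lemma second_order_min (g g1 : R -> R) (g2 : R) :
  (\forall t \near (0:R), is_derive (t : R) (1 : R) g (g1 t)) -> is_derive (0 : R) (1 : R) g1 g2 ->
  (\forall t \near (0:R), g 0 <= g t) -> g1 0 = 0 /\ 0 <= g2.
Proof.
move=> gd g1d gm.
have /nbhs_ballP[r /= r0 rb] : \forall t \near (0:R),
   is_derive (t : R) (1 : R) g (g1 t) /\ g 0 <= g t by near do split.
have inr t : t \in `]- r, r[%R -> is_derive (t : R) (1 : R) g (g1 t) /\ g 0 <= g t.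
  rewrite in_itv /= => tr; apply: rb; rewrite -ball_normE /= sub0r normrN.
  by rewrite ltr_norml.
have g10 : g1 0 = 0.
  have in0 : (0 : R) \in `]- r, r[%R by rewrite in_itv /= oppr_lt0 r0.
  have [d0 <-] := (inr 0 in0).1.
  have [|t /inr[[]]|t /inr[]|_] // := @derive1_at_min R g (- r) r 0 _ _ in0.
  by lra.
split=> //; rewrite leNgt; apply/negP => g2lt0.
have [/= g1d0 g1v] := g1d.
move: g1d0; rewrite /derivable; case/cvg_ex => l /= cl.
have lE : l = g2 by rewrite -g1v; apply/esym; exact: cvg_lim cl.
move/cvgrPdist_lt : cl => /(_ (- g2)); rewrite oppr_gt0 => /(_ g2lt0).
rewrite near_withinE => /nbhs_ballP[r' /= r'0 rb'].
pose h := Num.min r r' / 2.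
have h0 : 0 < h by rewrite divr_gt0 // lt_min r0.
have hm : h < Num.min r r' by rewrite /h ltr_pdivrMr // ltr_pMr ?ltr1n // lt_min r0.
have [hr hr'] : h < r /\ h < r' by move: hm; rewrite lt_min => /andP[].
have inr' t : 0 < t -> t <= h -> t \in `]- r, r[%R.
  move=> t0 th; rewrite in_itv /= (le_lt_trans th hr) andbT.
  by apply: lt_trans t0; rewrite oppr_lt0.
have g1neg t : 0 < t -> t <= h -> g1 t < 0.
  move=> t0 th; have := rb' t; rewrite -ball_normE /= sub0r normrN gtr0_norm //.
  move/(_ (le_lt_trans th hr') (lt0r_neq0 t0)).
  rewrite addr0 g10 subr0 lE [t *: 1]mulr1 distrC => /(le_lt_trans (ler_norm _)).
  rewrite ltrBlDl subrr [_ *: _]mulrC.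
  by rewrite ltr_pdivrMr // mul0r.
have [||c] := @MVT R g g1 0 h h0.
- move=> t; rewrite in_itv /= => /andP[t0 th].
  by have [] := inr t (inr' _ t0 (ltW th)).
- apply: derivable_within_continuous => t; rewrite in_itv /= => /andP[t0 th].
  have [|[] //] := inr t; rewrite in_itv /= (le_lt_trans th hr) andbT.
  by apply: lt_le_trans t0; rewrite oppr_lt0.
rewrite in_itv /= => /andP[c0 ch] E.
have := (inr h (inr' _ h0 (lexx _))).2.
rewrite -subr_ge0 E subr0 leNgt nmulr_rlt0 ?h0 //.
by apply: g1neg => //; exact: ltW.
Unshelve. all: by end_near. Qed.

End Directional.

(** * Quadratic forms and sums of lowest eigenvalues *)

Section Dot.
Context {R : realType} {n : nat}.
Implicit Types (x y z w : 'rV[R]_n) (M A N : 'M[R]_n).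

Definition dot x y : R := (x *m y^T) 0 0.

Definition enorm x : R := Num.sqrt (dot x x).

Definition qform M w : R := (w *m M *m w^T) 0 0.

Lemma dotE x y : dot x y = \sum_i x 0 i * y 0 i.
Proof. by rewrite /dot mxE; apply: eq_bigr => i _; rewrite mxE. Qed.

Lemma dotC x y : dot x y = dot y x.
Proof. by rewrite !dotE; apply: eq_bigr => i _; rewrite mulrC. Qed.

Lemma dotDl x y z : dot (x + y) z = dot x z + dot y z.
Proof. by rewrite /dot mulmxDl mxE. Qed.

Lemma dotZl a x y : dot (a *: x) y = a * dot x y.
Proof. by rewrite /dot -scalemxAl mxE. Qed.

Lemma dotNl x y : dot (- x) y = - dot x y.
Proof. by rewrite /dot mulNmx mxE. Qed.

Lemma dotDr x y z : dot z (x + y) = dot z x + dot z y.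
Proof. by rewrite dotC dotDl ![dot _ z]dotC. Qed.

Lemma dotZr a x y : dot y (a *: x) = a * dot y x.
Proof. by rewrite dotC dotZl dotC. Qed.

Lemma dotNr x y : dot y (- x) = - dot y x.
Proof. by rewrite dotC dotNl dotC. Qed.

Lemma dot0l x : dot 0 x = 0.
Proof. by rewrite /dot mul0mx mxE. Qed.

Lemma dot0r x : dot x 0 = 0.
Proof. by rewrite dotC dot0l. Qed.

Lemma dot_suml (I : Type) (r : seq I) (F : I -> 'rV[R]_n) x :
  dot (\sum_(i <- r) F i) x = \sum_(i <- r) dot (F i) x.
Proof. by apply: (big_morph (dot^~ x)) => [y z|]; rewrite ?dotDl ?dot0l. Qed.

Lemma dot_sumr (I : Type) (r : seq I) (F : I -> 'rV[R]_n) x :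
  dot x (\sum_(i <- r) F i) = \sum_(i <- r) dot x (F i).
Proof. by rewrite dotC dot_suml; apply: eq_bigr => i _; rewrite dotC. Qed.

Lemma dot_ge0 x : 0 <= dot x x.
Proof. by rewrite dotE sumr_ge0 // => i _; rewrite -expr2 sqr_ge0. Qed.
Hint Resolve dot_ge0 : core.

Lemma sqr_coord_le_dot x i : x 0 i ^+ 2 <= dot x x.
Proof.
rewrite dotE (bigD1 i) //= -expr2 lerDl sumr_ge0 // => j _.
by rewrite -expr2 sqr_ge0.
Qed.

Lemma dot_eq0 x : (dot x x == 0) = (x == 0).
Proof.
apply/eqP/eqP => [x0|->]; last exact: dot0l.
apply/rowP => i; rewrite mxE; apply/eqP; rewrite -sqrf_eq0 eq_le sqr_ge0 andbT.
by rewrite -x0 sqr_coord_le_dot.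
Qed.

Lemma dot_CS x y : dot x y ^+ 2 <= dot x x * dot y y.
Proof.
have [->|y0] := eqVneq y 0; first by rewrite !dot0r mulr0 expr0n.
have yy : 0 < dot y y by rewrite lt_def dot_eq0 y0 /=.
have := dot_ge0 (dot y y *: x - dot x y *: y).
rewrite !(dotDl, dotDr, dotNl, dotNr, dotZl, dotZr) [dot y x]dotC.
set a := dot x x; set b := dot y y; set c := dot x y => H.
have : 0 <= b * (a * b - c ^+ 2) by move: H; congr (_ <= _); ring.
by rewrite pmulr_rge0 // subr_ge0.
Qed.

Lemma enorm_ge0 x : 0 <= enorm x.
Proof. exact: sqrtr_ge0. Qed.

Lemma sqr_enorm x : enorm x ^+ 2 = dot x x.
Proof. exact: sqr_sqrtr. Qed.

Lemma enorm_eq0 x : (enorm x == 0) = (x == 0).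
Proof. by rewrite -dot_eq0 -sqr_enorm sqrf_eq0. Qed.

Lemma enorm0 : enorm 0 = 0.
Proof. by apply/eqP; rewrite enorm_eq0. Qed.

Lemma enormN x : enorm (- x) = enorm x.
Proof. by rewrite /enorm dotNl dotNr opprK. Qed.

Lemma enormB x y : enorm (x - y) = enorm (y - x).
Proof. by rewrite -enormN opprB. Qed.

Lemma dot_le_enorm x y : `|dot x y| <= enorm x * enorm y.
Proof.
rewrite -(@ler_pXn2r _ 2) ?nnegrE ?mulr_ge0 ?enorm_ge0 //.
by rewrite exprMn !sqr_enorm -normrX ger0_norm ?sqr_ge0 // dot_CS.
Qed.

Lemma enorm_triangle x y : enorm (x + y) <= enorm x + enorm y.
Proof.
rewrite -(@ler_pXn2r _ 2) ?nnegrE ?addr_ge0 ?enorm_ge0 //.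
rewrite sqr_enorm !(dotDl, dotDr) [dot y x]dotC sqrrD !sqr_enorm.
have := le_trans (ler_norm _) (dot_le_enorm x y); lra.
Qed.

Lemma coord_le_enorm x i : `|x 0 i| <= enorm x.
Proof.
rewrite -(@ler_pXn2r _ 2) ?nnegrE ?enorm_ge0 //.
by rewrite sqr_enorm -normrX ger0_norm ?sqr_ge0 // sqr_coord_le_dot.
Qed.

Lemma coord_le_norm x i : `|x 0 i| <= `|x|.
Proof. by rewrite [leRHS]/Num.Def.normr/= mx_normrE; exact: (le_bigmax _ (fun ij => `|x ij.1 ij.2|) (0, i)). Qed.

Lemma norm_le_enorm x : `|x| <= enorm x.
Proof.
rewrite [leLHS]/Num.Def.normr/= mx_normrE (bigmax_le _ (enorm_ge0 x)) //=.
by move=> [i j] _ /=; rewrite (ord1 i) coord_le_enorm.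
Qed.

Lemma enorm_le_norm x : enorm x <= n%:R * `|x|.
Proof.
have n0 : 0 <= n%:R * `|x| by rewrite mulr_ge0.
rewrite -(@ler_pXn2r _ 2) ?nnegrE ?enorm_ge0 // sqr_enorm dotE.
apply: (@le_trans _ _ (\sum_(i < n) `|x| ^+ 2)).
  apply: ler_sum => i _; rewrite -expr2 -real_normK ?num_real //.
  by rewrite ler_pXn2r ?nnegrE // coord_le_norm.
rewrite sumr_const card_ord -[(`|x| ^+ 2) *+ n]mulr_natl exprMn ler_wpM2r ?sqr_ge0 //.
by rewrite -natrX ler_nat; case: (n) => // m; rewrite leq_pmulr.
Qed.

Lemma qformE M w : qform M w = \sum_i \sum_j w 0 i * w 0 j * M i j.
Proof.
rewrite /qform mxE exchange_big; apply: eq_bigr => j _; rewrite !mxE mulr_suml.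
by apply: eq_bigr => i _; ring.
Qed.

Lemma qformD M N w : qform (M + N) w = qform M w + qform N w.
Proof. by rewrite /qform mulmxDr mulmxDl mxE. Qed.

Lemma qformZ a M w : qform (a *: M) w = a * qform M w.
Proof. by rewrite /qform -scalemxAr -scalemxAl mxE. Qed.

Lemma qformN M w : qform (- M) w = - qform M w.
Proof. by rewrite /qform mulmxN mulNmx mxE. Qed.

Lemma qform1 w : qform 1%:M w = dot w w.
Proof. by rewrite /qform mulmx1. Qed.

Lemma qform_le M w (L : R) : (forall i j, `|M i j| <= L) ->
  `|qform M w| <= n%:R * n%:R * L * dot w w.
Proof.
move=> ML; rewrite qformE; apply: le_trans (ler_norm_sum _ _ _) _.
apply: (@le_trans _ _ (\sum_(i < n) \sum_(j < n) L * dot w w)); last first.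
  rewrite !sumr_const !card_ord -[(_ *+ n) *+ n]mulr_natl -[(L * _) *+ n]mulr_natl.
  by rewrite !mulrA.
apply: ler_sum => i _; apply: le_trans (ler_norm_sum _ _ _) _.
apply: ler_sum => j _; rewrite normrM mulrC ler_pM //.
by rewrite normrM -sqr_enorm expr2 ler_pM // coord_le_enorm.
Qed.

End Dot.
#[global] Hint Resolve dot_ge0 enorm_ge0 : core.

Section Spectral.
Context {R : realType} {n : nat}.
Implicit Types (x y z w : 'rV[R]_n) (M A N : 'M[R]_n).

Lemma ReD (z w : R[i]) : complex.Re (z + w) = complex.Re z + complex.Re w.
Proof. by case: z; case: w. Qed.

Lemma Re_sum (I : Type) (r : seq I) (F : I -> R[i]) :
  complex.Re (\sum_(i <- r) F i) = \sum_(i <- r) complex.Re (F i).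
Proof. by apply: (big_morph (@complex.Re R)) => // z w; exact: ReD. Qed.

Lemma ReCM (a : R) (z : R[i]) : complex.Re (real_complex R a * z) = a * complex.Re z.
Proof. by case: z => x y /=; rewrite mul0r subr0. Qed.

Lemma Re_conjM (z w : R[i]) : complex.Re (Num.conj z * w) =
  complex.Re z * complex.Re w + complex.Im z * complex.Im w.
Proof. by case: z => a b; case: w => c d /=; rewrite mulNr opprK. Qed.

Lemma ReMC_conj (z w : R[i]) (m : R) :
  complex.Re (z * real_complex R m * Num.conj w) =
  m * (complex.Re z * complex.Re w + complex.Im z * complex.Im w).
Proof. by case: z => a b; case: w => c d /=; ring. Qed.

(* The rows of a and b are the real and imaginary parts of a unitary
   eigenbasis of the complexification of M. *)
Lemma spectral_sym M : M^T = M ->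
  exists (d : 'I_n -> R) (a b : 'M[R]_n),
  [/\ forall i : 'I_n, lambda i M = d i,
      forall i, d i = qform M (row i a) + qform M (row i b),
      forall i, dot (row i a) (row i a) + dot (row i b) (row i b) = 1,
      forall j k, \sum_i (a i j * a i k + b i j * b i k) = (j == k)%:R
    & forall j k, M j k = \sum_i d i * (a i j * a i k + b i j * b i k)].
Proof.
move=> Msym.
pose toC := real_complex R.
pose A := map_mx toC M; pose P := spectralmx A; pose D := spectral_diag A.
have Ar : A \is a mxOver Num.real.
  by apply/mxOverP => i j; rewrite mxE /toC complex_real.
have As : A \is hermsymmx.
  apply: realsym_hermsym => //; apply/is_hermitianmxP.
  by rewrite expr0 scale1r map_mx_id // /A map_trmx Msym.
have /orthomx_spectralP AE := hermitian_normalmx As.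
have /mxOverP Dr := hermitian_spectral_diag_real As.
have Pu : P \in unitmx by exact: spectral_unit.
have PU : P \is unitarymx by exact: spectral_unitarymx.
have PI : invmx P = map_mx Num.conj P^T by exact: invmx_unitary.
rewrite -/P -/D in AE.
pose r i := complex.Re (D 0 i).
have DE i : D 0 i = toC (r i) by rewrite /toC RRe_real.
have chA : char_poly A = \prod_i ('X - (D 0 i)%:P).
  rewrite AE; transitivity (char_poly (diag_mx D)).
    rewrite /char_poly.
    have -> : char_poly_mx (invmx P *m diag_mx D *m P) =
       map_mx polyC (invmx P) *m char_poly_mx (diag_mx D) *m map_mx polyC P.
      rewrite /char_poly_mx mulmxBr mulmxBl -!map_mxM; congr (_ - _).
      by rewrite scalar_mxC -mulmxA -map_mxM mulVmx // map_mx1 mulmx1.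
    rewrite !det_mulmx mulrC mulrA -det_mulmx -map_mxM mulmxV // map_mx1.
    by rewrite det1 mul1r.
  rewrite char_poly_trig; last first.
    by apply/is_trig_mxP => i j; rewrite mxE -val_eqE /=; case: ltngtP.
  by apply: eq_bigr => i _; rewrite mxE eqxx mulr1n.
have [_ evE] := eigenvaluesP Msym.
(* [eigenvalues M] is sorted, while the spectral theorem lists the eigenvalues in an unspecified
   order; equality of the characteristic polynomials yields a permutation [p] matching the two
   lists. *)
have : perm_eq (eigenvalues M) [tuple r i | i < n].
  apply/prod_XsubC_eq; rewrite -evE; apply: (map_poly_inj toC).
  rewrite map_char_poly -/A chA big_map /= rmorph_prod /= big_enum /=.
  by apply: eq_bigr => i _; rewrite rmorphB /= map_polyX map_polyC /= DE.
case/tuple_permP => p evp.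
have lam i : lambda (i : 'I_n) M = r (p i).
  by rewrite /lambda evp -tnth_nth tnth_mktuple tnth_mktuple.
have ent j k (e : 'I_n -> R[i]) : (invmx P *m diag_mx (\row_i e i) *m P) j k =
    \sum_i e i * (Num.conj (P i j) * P i k).
  rewrite PI mxE; apply: eq_bigr => i _.
  rewrite mul_mx_diag !mxE; ring.
exists (fun i => r (p i)), (row_perm p (map_mx (@complex.Re R) P)),
  (row_perm p (map_mx (@complex.Im R) P)).
have DD : P *m A *m invmx P = diag_mx D.
  by rewrite AE !mulmxA mulmxV // mul1mx mulmxK.
split=> //.
- move=> i; rewrite -[RHS](_ : complex.Re (diag_mx D (p i) (p i)) = _).
    by rewrite mxE eqxx mulr1n.
  rewrite -DD PI mxE Re_sum !qformE -big_split /=.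
  under eq_bigr => k _ do rewrite mxE mulr_suml Re_sum.
  rewrite exchange_big; apply: eq_bigr => j _; rewrite -big_split.
  apply: eq_bigr => k _; rewrite !mxE.
  rewrite /toC ReMC_conj /=; ring.
- move=> i; rewrite !dotE -big_split /=.
  have /unitarymxP/matrixP/(_ (p i) (p i)) := PU.
  rewrite !mxE eqxx => /(congr1 (@complex.Re R)); rewrite Re_sum /= => <-.
  by apply: eq_bigr => j _; rewrite !mxE [P _ _ * _]mulrC Re_conjM.
- move=> j k; have := ent j k (fun=> 1).
  have -> : \row_(_ < n) (1 : R[i]) = const_mx 1 by apply/rowP => i; rewrite !mxE.
  rewrite diag_const_mx mulmx1 mulVmx // mxE => /(congr1 (@complex.Re R)).
  rewrite Re_sum [in RHS](reindex_inj (@perm_inj _ p)) /= => E.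
  transitivity (complex.Re (j == k)%:R : R); last by case: (j == k).
  rewrite E; apply: eq_bigr => i _; rewrite !mxE mul1r Re_conjM; ring.
- move=> j k; have := ent j k (fun i => D 0 i).
  have -> : \row_(i < n) D 0 i = D by apply/rowP => i; rewrite !mxE.
  rewrite -AE mxE => /(congr1 (@complex.Re R)).
  rewrite Re_sum [in RHS](reindex_inj (@perm_inj _ p)) /= => ->.
  by apply: eq_bigr => i _; rewrite !mxE DE ReCM Re_conjM.
Qed.

(** Parseval's identity for the unitary basis with real parts [row i a] and imaginary parts
    [row i b], tested on a real vector. *)
Lemma bessel_sum (a b : 'M[R]_n) x :
  (forall j k, \sum_i (a i j * a i k + b i j * b i k) = (j == k)%:R) ->
  \sum_i (dot x (row i a) ^+ 2 + dot x (row i b) ^+ 2) = dot x x.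
Proof.
move=> ab.
transitivity (\sum_j \sum_k x 0 j * x 0 k * \sum_i (a i j * a i k + b i j * b i k)).
  under [RHS]eq_bigr => j _.
    under eq_bigr => k _ do rewrite mulr_sumr.
    rewrite exchange_big; over.
  rewrite exchange_big; apply: eq_bigr => i _ /=.
  rewrite !dotE !expr2 !mulr_suml -big_split; apply: eq_bigr => j _ /=.
  rewrite !mulr_sumr -big_split; apply: eq_bigr => k _; rewrite !mxE /=; ring.
rewrite dotE; apply: eq_bigr => j _; rewrite (bigD1 j) //= ab eqxx mulr1.
rewrite big1 ?addr0 // => k; rewrite eq_sym ab => /negPf->; exact: mulr0.
Qed.

(** As in Ky Fan's principle, summing the form over the first [m] eigenvectors gives the sum of
    eigenvalues. By Bessel's inequality a square [dot w y ^+ 2] with [y] of length at most 1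
    contributes at most its coefficient, so each subtracted direction is charged once, wherever the
    eigenvectors point. *)
Lemma sum_lambda_ge M (m k : nat) (al be ga : R) (t : 'I_k -> 'rV[R]_n) xi :
  M^T = M -> (m <= n)%N -> 0 <= be -> 0 <= ga ->
  (forall i, dot (t i) (t i) <= 1) -> dot xi xi <= 1 ->
  (forall w, al * dot w w - be * (\sum_i dot w (t i) ^+ 2) - ga * dot w xi ^+ 2
     <= qform M w) ->
  m%:R * al - be * k%:R - ga <= \sum_(i < m) lambda i M.
Proof.
move=> Ms mn be0 ga0 t1 xi1 Mw.
have [d [a [b [lE dE ab1 ab _]]]] := spectral_sym Ms.
(* [S y] is the squared length of the projection of [y] onto the span of the first [m]
   eigenvectors. *)
pose S y := \sum_(i < n | (i < m)%N) (dot y (row i a) ^+ 2 + dot y (row i b) ^+ 2).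
have S1 y : dot y y <= 1 -> S y <= 1.
  apply: le_trans; rewrite -(bessel_sum y ab) [leRHS](bigID (fun i : 'I_n => (i < m)%N)).
  by rewrite lerDl sumr_ge0 // => i _; rewrite addr_ge0 ?sqr_ge0.
rewrite (big_ord_widen n (fun i => lambda i M) mn).
apply: (@le_trans _ _ (al * m%:R - be * (\sum_j S (t j)) - ga * S xi)).
  have H1 : be * (\sum_j S (t j)) <= be * k%:R.
    rewrite ler_wpM2l //; apply: le_trans (ler_sum _ (fun j _ => S1 _ (t1 j))) _.
    by rewrite sumr_const card_ord.
  have H2 : ga * S xi <= ga by rewrite ler_piMr // S1.
  lra.
have -> : m%:R = \sum_(i < n | (i < m)%N)
    (dot (row i a) (row i a) + dot (row i b) (row i b)).
  under eq_bigr do rewrite ab1.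
  by rewrite -(big_ord_widen n (fun=> 1) mn) sumr_const card_ord.
rewrite /S exchange_big /= !mulr_sumr -!sumrB; apply: ler_sum => i im.
rewrite lE dE; apply: le_trans (lerD (Mw (row i a)) (Mw (row i b))).
rewrite big_split /= ![dot _ xi]dotC.
under [X in be * (X + _)]eq_bigr do rewrite dotC.
under [X in be * (_ + X)]eq_bigr do rewrite dotC.
lra.
Qed.

(** Diagonalising [N] turns the trace of the product into a sum of eigenvalues of [N] times values
    of the form of [A], all nonnegative. *)
Lemma trace_psd_ge0 A N : N^T = N -> (forall w, 0 <= qform A w) ->
  (forall w, 0 <= qform N w) -> 0 <= \sum_i \sum_j A i j * N i j.
Proof.
move=> Ns Ap Np.
have [d [a [b [_ dE _ _ NE]]]] := spectral_sym Ns.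
have -> : \sum_i \sum_j A i j * N i j =
    \sum_i d i * (qform A (row i a) + qform A (row i b)).
  under eq_bigr => j _.
    under eq_bigr => k _ do rewrite NE mulr_sumr.
    rewrite exchange_big; over.
  rewrite exchange_big; apply: eq_bigr => i _ /=.
  rewrite !qformE -big_split mulr_sumr; apply: eq_bigr => j _ /=.
  rewrite -big_split mulr_sumr; apply: eq_bigr => k _ /=.
  rewrite !mxE; ring.
by apply: sumr_ge0 => i _; rewrite mulr_ge0 ?dE ?addr_ge0.
Qed.

Lemma posdef_coercive A : A^T = A -> posdefmx A ->
  exists2 la : R, 0 < la & forall w, la * dot w w <= qform A w.
Proof.
move=> As Ap.
have [d [a [b [_ dE ab1 ab AE]]]] := spectral_sym As.
have d0 i : 0 < d i.
  have qp w : w != 0 -> 0 < qform A w by exact: Ap.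
  have q0 w : 0 <= qform A w.
    have [->|/qp/ltW//] := eqVneq w 0; by rewrite qformE big1 // => j _; rewrite big1 // => k _; rewrite mxE !mul0r.
  rewrite dE; have [a0|/qp a0] := eqVneq (row i a) 0; last exact: ltr_wpDr.
  apply: ltr_wpDl => //; apply: qp; apply/eqP => b0.
  by have := ab1 i; rewrite a0 b0 !dot0l addr0 => /eqP; rewrite eq_sym oner_eq0.
(* The initial value 1 caps the smallest eigenvalue and keeps the minimum positive over an empty
   index set. *)
exists (\big[Num.min/1]_i d i).
  by elim/big_ind: _ => // x y x0 y0; rewrite lt_min x0.
move=> w; rewrite -(bessel_sum w ab) mulr_sumr.
have -> : qform A w = \sum_i d i * (dot w (row i a) ^+ 2 + dot w (row i b) ^+ 2).
  rewrite qformE.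
  under eq_bigr => j _.
    under eq_bigr => k _ do rewrite AE mulr_sumr.
    rewrite exchange_big; over.
  rewrite exchange_big; apply: eq_bigr => i _ /=.
  rewrite !dotE !expr2 !mulr_suml -big_split mulr_sumr; apply: eq_bigr => j _ /=.
  rewrite !mulr_sumr -big_split mulr_sumr; apply: eq_bigr => k _; rewrite !mxE /=; ring.
apply: ler_sum => i _; rewrite ler_wpM2r ?addr_ge0 ?sqr_ge0 //.
by rewrite (bigD1 i) //= ge_min lexx.
Qed.

End Spectral.

(** * Coordinates, gradients and Hessians of C^2 functions *)

Section Coordinates.
Context {R : realType}.

Lemma near0_right_ex (P : R -> Prop) :
  (\forall s \near (0 : R)^'+, P s) -> exists2 s, 0 < s & P s.
Proof.
move=> H; have [s [s0 Ps]] := filter_ex (filterI (nbhs_right_gt (0 : R)) H).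
by exists s.
Qed.

Lemma Cm_coord (V : normedModType R) (B : set V) (m p q : nat)
    (g : V -> 'M[R]_(p, q)) i j : open B ->
  Cm m B g -> Cm m B (fun z => g z i j).
Proof.
move=> oB; elim: m g => [|m IH] g gm.
  split=> //; apply/(within_openP oB) => x Bx.
  have gc := Cm_continuous oB gm Bx.
  by apply: (cvg_comp g (fun M : 'M[R]_(p, q) => M i j)) gc _; exact: coord_continuous.
split.
  apply/(within_openP oB) => x Bx.
  have gc := Cm_continuous oB gm Bx.
  by apply: (cvg_comp g (fun M : 'M[R]_(p, q) => M i j)) gc _; exact: coord_continuous.
move=> d _; have gd z : B z -> derivable g z d by move=> Bz; exact: Cm_derivable gm Bz.
split=> [x Bx|]; first exact: ((derivable_mxP _ _ _).1 (gd x Bx)).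
have H := IH _ (Cm_derive d gm).
rewrite -/(Cm m B _); apply: (Cm_ext oB _ H) => z Bz.
by rewrite (derive_mx (gd z Bz)) mxE.
Qed.

End Coordinates.

Section Calculus.
Context {R : realType} {n : nat}.
Implicit Types (f : 'rV[R]_n -> R) (x y d e : 'rV[R]_n) (A : set 'rV[R]_n).

Lemma derive_grad A f x d : open A -> Cm 1 A f -> A x ->
  'D_d f x = dot d (grad f x).
Proof.
move=> oA f1 Ax; rewrite {1}(row_sum_delta d) (derive_sum_dir oA) // dotE.
by apply: eq_bigr => i _; rewrite mxE.
Qed.

Lemma hess_sym A f x : open A -> Cm 2 A f -> A x -> (hess f x)^T = hess f x.
Proof.
move=> oA f2 Ax; apply/matrixP => i j; rewrite !mxE; exact: derive2_sym oA _ _ _ _ f2 Ax.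
Qed.

Lemma derive2_hess A f x d e : open A -> Cm 2 A f -> A x ->
  'D_e ('D_d f) x = \sum_i \sum_j e 0 i * d 0 j * hess f x i j.
Proof.
move=> oA f2 Ax.
transitivity (dot e (\row_i dot d (\row_j hess f x i j))); last first.
  rewrite dotE; apply: eq_bigr => i _; rewrite mxE dotE mulr_sumr.
  by apply: eq_bigr => j _; rewrite mxE mulrA.
rewrite (derive_grad _ oA (Cm_derive d f2) Ax); congr dot; apply/rowP => i.
rewrite !mxE (derive2_sym oA _ _ f2 Ax) (derive_grad _ oA (Cm_derive _ f2) Ax).
congr dot; apply/rowP => j; rewrite !mxE.
exact: derive2_sym oA _ _ _ _ f2 Ax.
Qed.

Lemma derive2_qform A f x d : open A -> Cm 2 A f -> A x ->
  'D_d ('D_d f) x = qform (hess f x) d.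
Proof. by move=> oA f2 Ax; rewrite (derive2_hess _ _ oA f2 Ax) qformE. Qed.

Lemma ball_segment (x0 : 'rV[R]_n) (r t : R) x y : 0 <= t <= 1 ->
  ball x0 r x -> ball x0 r y -> ball x0 r (x + t *: (y - x)).
Proof.
move=> /andP[t0 t1]; rewrite -ball_normE /= => xr yr.
have -> : x0 - (x + t *: (y - x)) = (1 - t) *: (x0 - x) + t *: (x0 - y).
  by rewrite scalerBl scale1r !scalerBr; apply/rowP => i; rewrite !mxE; ring.
apply: le_lt_trans (ler_normD _ _) _; rewrite !normrZ (ger0_norm t0) ger0_norm ?subr_ge0 //.
have [->|t1'] := eqVneq t 1; first by rewrite subrr mul0r add0r mul1r.
have tl : 0 < 1 - t by rewrite subr_gt0 lt_def eq_sym t1' t1.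
have H1 : (1 - t) * `|x0 - x| < (1 - t) * r by rewrite ltr_pM2l.
have H2 : t * `|x0 - y| <= t * r by rewrite ler_wpM2l // ltW.
lra.
Qed.

(** One parameter [s] is at once the radius of the ball and the inverse of the Lipschitz and Taylor
    constants. A statement about all small [s] can be intersected over the coordinates, and later
    over a compact set, to yield a single constant. *)
Lemma C2_local_bounds A f x0 : open A -> Cm 2 A f -> A x0 ->
  \forall s \near (0 : R)^'+, ball x0 s `<=` A /\
    forall x y, ball x0 s x -> ball x0 s y ->
      `|f y - f x| <= s^-1 * enorm (y - x) /\
      `|f y - f x - 'D_(y - x) f x| <= s^-1 * dot (y - x) (y - x).
Proof.
move=> oA f2 Ax0.
have nA := open_nbhs_nbhs (conj oA Ax0).
have f1 := CmW f2.
pose L : R := \sum_i `|grad f x0 0 i| + \sum_i \sum_j `|hess f x0 i j| + 1.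
have bnd (g : 'rV[R]_n -> R) : {for x0, continuous g} -> `|g x0| + 1 <= L ->
    \forall x \near x0, `|g x| <= L.
  move=> gc gL; have /cvgrPdist_lt/(_ 1 ltr01) := gc.
  apply: filterS => x gx; apply: le_trans gL; rewrite -(subrK (g x0) (g x)).
  by rewrite addrC (le_trans (ler_normD _ _)) // lerD2l distrC ltW.
have gL i : `|grad f x0 0 i| + 1 <= L.
  rewrite /L lerD2r (bigD1 i) //= -addrA lerDl addr_ge0 ?sumr_ge0 // => j _.
  by rewrite sumr_ge0.
have hL i j : `|hess f x0 i j| + 1 <= L.
  rewrite /L lerD2r [X in _ + X](bigD1 i) //= [X in _ + (X + _)](bigD1 j) //= addrCA -addrA lerDl.
  by rewrite !addr_ge0 ?sumr_ge0 // => i' _; rewrite ?sumr_ge0.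
have /nbhs_ballP[r /= r0 rb] : \forall x \near x0, [/\ A x,
    forall i, `|grad f x 0 i| <= L & forall i j, `|hess f x i j| <= L].
  have N1 : \forall x \near x0, forall i, `|grad f x 0 i| <= L.
    apply: (@filter_forall _ _ (fun i x => `|grad f x 0 i| <= L) (nbhs x0) _) => i.
    have := bnd _ (Cm_continuous oA (Cm_derive (delta_mx 0 i) f1) Ax0).
    move=> H; have {}H : \forall x \near x0, `|'D_(delta_mx 0 i) f x| <= L.
      by apply: H; have := gL i; rewrite mxE.
    by apply: filterS H => x; rewrite mxE.
  have N2 : \forall x \near x0, forall i j, `|hess f x i j| <= L.
    apply: (@filter_forall _ _ (fun i x => forall j, `|hess f x i j| <= L) (nbhs x0) _) => i.
    apply: (@filter_forall _ _ (fun j x => `|hess f x i j| <= L) (nbhs x0) _) => j.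
    have := bnd _ (Cm_continuous oA (Cm_derive (delta_mx 0 i) (Cm_derive (delta_mx 0 j) f2)) Ax0).
    move=> H; have {}H : \forall x \near x0, `|'D_(delta_mx 0 i) ('D_(delta_mx 0 j) f) x| <= L.
      by apply: H; have := hL i j; rewrite mxE.
    by apply: filterS H => x; rewrite mxE.
  by near=> x; apply: And3; [exact: (near nA x) | exact: (near N1 x) | exact: (near N2 x)].
have L0 : 0 <= L by rewrite !addr_ge0 // sumr_ge0 // => i _; rewrite sumr_ge0.
pose K := n%:R * L + n%:R * n%:R * L + 1.
have K0 : 0 < K by rewrite ltr_wpDl // addr_ge0 // !mulr_ge0.
near=> s.
have s0 : 0 < s by [].
have sr : s <= r by near: s; exact: nbhs_right_le.
have Ks : K <= s^-1.
  rewrite -[K]invrK lef_pV2 ?posrE ?invr_gt0 //; near: s; apply: nbhs_right_le.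
  by rewrite invr_gt0.
have sb : ball x0 s `<=` ball x0 r by apply: le_ball.
split; first by move=> x /sb/rb[].
move=> x y xs ys.
have P (t : R) : 0 <= t <= 1 -> ball x0 r (x + t *: (y - x)).
  by move=> t01; apply: ball_segment => //; exact: sb.
have yE : x + (y - x) = y by rewrite addrC subrK.
split.
  have [t t01] := @mvt_line R _ f x (y - x)
    (fun t t01 => Cm_derivable f1 (let: And3 a _ _ := rb _ (P t t01) in a)).
  rewrite yE => ->; have [Az gz _] := rb _ (P t t01).
  rewrite (derive_grad _ oA f1 Az) dotE; apply: le_trans (ler_norm_sum _ _ _) _.
  apply: (@le_trans _ _ (\sum_(i < n) L * enorm (y - x))).
    by apply: ler_sum => i _; rewrite normrM mulrC ler_pM // coord_le_enorm.
  rewrite sumr_const card_ord -[(L * _) *+ n]mulr_natl mulrA ler_wpM2r ?enorm_ge0 //.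
  by apply: le_trans Ks; rewrite /K -addrA lerDl addr_ge0 // !mulr_ge0.
have := @taylor2_bound R _ A f x (y - x) (s^-1 * dot (y - x) (y - x)) f2.
rewrite yE; apply => t t01.
have [Az _ hz] := rb _ (P t t01); split => //.
rewrite (derive2_qform _ oA f2 Az); apply: le_trans (qform_le _ hz) _.
rewrite ler_wpM2r ?dot_ge0 //; apply: le_trans Ks; rewrite /K [_ * L + _]addrC -addrA lerDl.
by rewrite addr_ge0 // mulr_ge0.
Unshelve. all: by end_near. Qed.

Lemma is_derive_sqrdist (f : R -> R) (c t df : R) : is_derive t 1 f df ->
  is_derive t 1 (fun s => (c - f s) ^+ 2) (- 2 * (c - f t) * df).
Proof.
move=> fd.
have -> : (fun s => (c - f s) ^+ 2) = (cst c - f) ^+ 2.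
  by apply/funext => s; rewrite -[RHS]/((cst c - f) s ^+ 2).
apply: is_derive_eq; rewrite sub0r expr1 -[(cst c - f) t]/(c - f t) scalerN.
rewrite -[_ *: df]/(_ * df); ring.
Qed.

End Calculus.

(** * Nearest points and tangent spaces *)

Section Submanifold.
Context {R : realType} {n : nat}.
Implicit Types (x y e nu : 'rV[R]_n) (E : set 'rV[R]_n).

Definition nearest E x e := E e /\ forall e', E e' -> dot (x - e) (x - e) <= dot (x - e') (x - e').

(* The rows of T stand for a spanning family of the tangent space of E at e;
   s^-1 bounds the curvature of E as seen from e, globally on E. *)
Definition tangent_at E k (s : R) e (T : 'M[R]_(k, n)) :=
  (forall x, nearest E x e -> forall i, dot (x - e) (row i T) = 0) /\
  (forall nu, (forall i, dot nu (row i T) = 0) -> forall e', E e' ->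
     `|dot nu (e' - e)| <= s^-1 * enorm nu * dot (e' - e) (e' - e)).

(** The squared distance from [x] to [c t] is minimal at [t = 0], so its derivative
    [- 2 * dot (x - c 0) tau] vanishes there. *)
Lemma nearest_curve E (c : R -> 'rV[R]_n) x (tau : 'rV[R]_n) :
  (\forall t \near (0 : R), E (c t) /\ forall l, derivable (fun s => c s 0 l) t 1) ->
  (forall l, 'D_1 (fun s => c s 0 l) (0 : R) = tau 0 l) ->
  nearest E x (c 0) -> dot (x - c 0) tau = 0.
Proof.
move=> /nbhs_ballP[r /= r0 rb] ctau [_ xn].
have inr t : t \in `]- r, r[%R -> E (c t) /\ forall l, derivable (fun s => c s 0 l) t 1.
  rewrite in_itv /= => tr; apply: rb; rewrite -ball_normE /= sub0r normrN.
  by rewrite ltr_norml.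
pose g : R -> R := \sum_l (fun t : R => (x 0 l - c t 0 l) ^+ 2).
have gE t : g t = dot (x - c t) (x - c t).
  by rewrite /g fct_sumE dotE; apply: eq_bigr => l _; rewrite !mxE.
have gd t : t \in `]- r, r[%R ->
    is_derive t 1 g (\sum_l - 2 * (x 0 l - c t 0 l) * 'D_1 (fun s => c s 0 l) t).
  move=> /inr[_ cd]; apply: is_derive_sum => l; apply: is_derive_sqrdist.
  exact: derivableP (cd l).
have in0 : (0 : R) \in `]- r, r[%R by rewrite in_itv /= oppr_lt0 r0.
have rr : - r <= r by lra.
have [|t tr|_ g0] := derive1_at_min rr _ in0 (f := g).
- by move=> t /gd[].
- by rewrite !gE; apply: xn; have [] := inr t tr.
have [_] := gd 0 in0; rewrite g0 => /esym.
under eq_bigr => l _ do rewrite ctau -mulrA.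
rewrite -mulr_sumr => /eqP; rewrite mulf_eq0 oppr_eq0 pnatr_eq0 /= => /eqP.
by move=> H; rewrite dotE -[RHS]H; apply: eq_bigr => l _; rewrite !mxE.
Qed.

(** The rows of [T] are the derivatives of [psi] at [phi e] along the first [k] coordinate axes. For
    the curvature bound, [e' - e] is the linear part of [psi] plus a Taylor remainder: the linear
    part is tangent to [E], so a normal [nu] sees only the remainder, which is quadratic in
    [e' - e]. *)
Lemma tangent_near E k p : (k <= n)%N -> smooth_submanifold k E -> E p ->
  \forall e \near p & s \near (0 : R)^'+, E e ->
    exists T : 'M[R]_(k, n), tangent_at E s e T.
Proof.
move=> kn /[swap] Ep /(_ p Ep)[U [W [phi [psi [[oU oW Up] [phis psis] phiK psiK EU]]]]].
have Wp := (phiK _ Up).1.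
have phi2 l := Cm_coord 0 l oU (phis 2%N).
have psi2 l := Cm_coord 0 l oW (psis 2%N).
have N1 : \forall s \near (0 : R)^'+, forall l, ball (phi p) s `<=` W /\
    forall y z, ball (phi p) s y -> ball (phi p) s z ->
      `|psi z 0 l - psi y 0 l| <= s^-1 * enorm (z - y) /\
      `|psi z 0 l - psi y 0 l - 'D_(z - y) (fun w => psi w 0 l) y| <= s^-1 * dot (z - y) (z - y).
  apply: filter_forall => l; exact: C2_local_bounds oW (psi2 l) Wp.
have N2 : \forall s \near (0 : R)^'+, forall l, ball p s `<=` U /\
    forall y z, ball p s y -> ball p s z ->
      `|phi z 0 l - phi y 0 l| <= s^-1 * enorm (z - y) /\
      `|phi z 0 l - phi y 0 l - 'D_(z - y) (fun w => phi w 0 l) y| <= s^-1 * dot (z - y) (z - y).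
  apply: filter_forall => l; exact: C2_local_bounds oU (phi2 l) Up.
have [r1 r10 {}N1] := near0_right_ex N1.
have [r2 r20 {}N2] := near0_right_ex N2.
have [r [r0 rr2 rb]] : exists r : R, [/\ 0 < r, r <= r2 &
    forall x, ball p r x -> U x /\ ball (phi p) r1 (phi x)].
  have /nbhs_ballP[r3 /= r30 r3b] : \forall x \near p, U x /\ ball (phi p) r1 (phi x).
    near=> x; split; near: x; first exact: open_nbhs_nbhs.
    by apply: (Cm_continuous oU (phis 0%N) Up); exact: nbhsx_ballx.
  exists (Num.min r2 r3); split; first by rewrite lt_min r20.
    by rewrite ge_min lexx.
  by move=> x xr; apply: r3b; apply: le_ball xr; rewrite ge_min lexx orbT.
(* The first summand serves the points [e'] of the chart: [phi] is Lipschitz with constant [r2^-1]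
   per coordinate, and [r1^-1] bounds the Taylor remainder of [psi]. The summand [2 / r] serves the
   points of [E] outside the chart ball. *)
pose Kc := n%:R * r1^-1 * (n%:R * r2^-1 ^+ 2) + 2 / r + 1.
have P1 : 0 <= n%:R * r1^-1 * (n%:R * r2^-1 ^+ 2) :> R.
  by rewrite !mulr_ge0 ?exprn_ge0 ?invr_ge0 // ltW.
have P2 : 0 <= 2 / r by rewrite divr_ge0 // ltW.
have Kc0 : 0 < Kc by rewrite ltr_wpDl // addr_ge0.
have r20' : 0 < r / 2 by rewrite divr_gt0.
near=> e s; move=> /= Ee.
have er : ball p (r / 2) e by near: e; exact: nbhsx_ballx.
have s0 : 0 < s by near: s; exact: nbhs_right_gt.
have Ks : Kc <= s^-1.
  rewrite -[Kc]invrK lef_pV2 ?posrE ?invr_gt0 //; near: s; apply: nbhs_right_le.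
  by rewrite invr_gt0.
have {}er' : ball p r e by apply: le_ball er; rewrite ler_pdivrMr // ler_pMr // ler1n.
have [Ue yb] := rb _ er'.
have [We psiE] := phiK _ Ue.
pose dl (i : 'I_k) : 'rV[R]_n := delta_mx 0 (widen_ord kn i).
pose T := \matrix_(i < k, l < n) 'D_(dl i) (fun w => psi w 0 l) (phi e).
exists T; split.
  move=> x xn i; pose c t := psi (phi e + t *: dl i).
  have c0 : c 0 = e by rewrite /c scale0r addr0.
  have xn' : nearest E x (c 0) by rewrite c0.
  suff H : dot (x - c 0) (row i T) = 0 by move: H; rewrite c0.
  apply: nearest_curve xn'.
    near=> t.
    have Wt : W (phi e + t *: dl i) by near: t; exact: segment_near.
    split.
      apply/(EU _ (psiK _ Wt).1) => j kj; rewrite (psiK _ Wt).2 mxE.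
      rewrite ((EU _ Ue).1 Ee j kj) add0r !mxE eqxx /=.
      suff /negPf-> : j != widen_ord kn i by rewrite mulr0.
      by rewrite -val_eqE /= gtn_eqF // (leq_trans (ltn_ord i)).
    by move=> l; have [] := is_derive_line (Cm_derivable (d := dl i) (psi2 l) Wt).
  move=> l; rewrite !mxE.
  have := @is_derive_line R _ _ (fun w => psi w 0 l) (phi e) (dl i) 0.
  rewrite scale0r addr0 => /(_ (Cm_derivable (psi2 l) We)) [_ <-] //.
move=> nu nuT e' Ee'.
(* For [e'] outside the ball, Cauchy-Schwarz suffices because [1 <= 2 / r * enorm (e' - e)]. *)
have [e'r|e'r] := pselect (ball p r e'); last first.
  have D : r / 2 <= enorm (e' - e).
    apply: le_trans (norm_le_enorm _); rewrite leNgt; apply/negP => H; apply: e'r.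
    rewrite (splitr r); apply: ball_triangle er _.
    by rewrite -ball_normE /= distrC.
  apply: le_trans (dot_le_enorm _ _) _.
  rewrite -sqr_enorm [s^-1 * _]mulrC -mulrA ler_wpM2l ?enorm_ge0 // expr2 mulrA.
  rewrite ler_peMl ?enorm_ge0 //.
  apply: (@le_trans _ _ (2 / r * (r / 2))); first by rewrite [leRHS](_ : _ = 1) //; field; exact: lt0r_neq0.
  apply: ler_pM => //; first exact: ltW.
  by apply: le_trans Ks; rewrite /Kc -addrA [2 / r + 1]addrC addrA lerDr addr_ge0.
have [Ue' yb'] := rb _ e'r.
have [We' psiE'] := phiK _ Ue'.
set y := phi e in yb We psiE *; set y' := phi e' in yb' We' psiE'.
have yy i : `|(y' - y) 0 i| <= r2^-1 * enorm (e' - e).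
  have [_ H] := N2 i; rewrite 2!mxE; apply: (H e e' _ _).1.
    exact: le_ball er'.
  exact: le_ball e'r.
have dyy : dot (y' - y) (y' - y) <= n%:R * r2^-1 ^+ 2 * dot (e' - e) (e' - e).
  rewrite dotE; apply: (@le_trans _ _ (\sum_(i < n) (r2^-1 * enorm (e' - e)) ^+ 2)).
    apply: ler_sum => i _; rewrite -expr2 -real_normK ?num_real //.
    by rewrite ler_pXn2r ?nnegrE ?mulr_ge0 ?enorm_ge0 ?invr_ge0 // ltW.
  by rewrite sumr_const card_ord -[(_ ^+ 2) *+ n]mulr_natl exprMn sqr_enorm mulrA.
pose rem : 'rV[R]_n := \row_l ((e' - e) 0 l - 'D_(y' - y) (fun w => psi w 0 l) y).
have remE l : `|rem 0 l| <= r1^-1 * dot (y' - y) (y' - y).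
  have [_ H] := N1 l; rewrite !mxE -{1}psiE -{1}psiE'; exact: (H y y' yb yb').2.
have -> : dot nu (e' - e) = dot nu rem.
  have -> : e' - e = rem + \row_l 'D_(y' - y) (fun w => psi w 0 l) y.
    by apply/rowP => l; rewrite !mxE subrK.
  rewrite dotDr -[RHS]addr0; congr (_ + _).
  have -> : (\row_l 'D_(y' - y) (fun w => psi w 0 l) y : 'rV[R]_n) =
    \sum_(i < n) (y' - y) 0 i *: \row_l 'D_(delta_mx 0 i) (fun w => psi w 0 l) y.
    apply/rowP => l; rewrite summxE mxE {1}(row_sum_delta (y' - y)).
    rewrite (derive_sum_dir oW _ _ _ (CmW (psi2 l)) We).
    by apply: eq_bigr => i _; rewrite !mxE.
  rewrite dot_sumr big1 // => i _; rewrite dotZr.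
  (* Chart coordinates of index at least [k] vanish on [E], so only tangent directions occur in the
     linear part. *)
  have [ik|ki] := ltnP i k; last first.
    by rewrite 2!mxE ((EU _ Ue').1 Ee' i ki) ((EU _ Ue).1 Ee i ki) subrr mul0r.
  have := nuT (Ordinal ik); rewrite (_ : row _ _ = \row_l 'D_(delta_mx 0 i) (fun w => psi w 0 l) y).
    by move=> ->; rewrite mulr0.
  apply/rowP => l; rewrite !mxE /dl; congr ('D_(delta_mx 0 _) _ _).
  exact: val_inj.
rewrite dotE; apply: le_trans (ler_norm_sum _ _ _) _.
apply: (@le_trans _ _ (\sum_(i < n) enorm nu * (r1^-1 * dot (y' - y) (y' - y)))).
  by apply: ler_sum => l _; rewrite normrM ler_pM // coord_le_enorm.
rewrite sumr_const card_ord -[(enorm nu * _) *+ n]mulr_natl.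
apply: (@le_trans _ _ (Kc * enorm nu * dot (e' - e) (e' - e))); last first.
  by rewrite !ler_wpM2r ?enorm_ge0 ?dot_ge0.
apply: (@le_trans _ _ (n%:R * (enorm nu * (r1^-1 * (n%:R * r2^-1 ^+ 2 * dot (e' - e) (e' - e)))))).
  by rewrite !ler_wpM2l ?enorm_ge0 ?invr_ge0 // ltW.
have Q : 0 <= enorm nu * dot (e' - e) (e' - e) by rewrite mulr_ge0 ?enorm_ge0 ?dot_ge0.
have H : n%:R * r1^-1 * (n%:R * r2^-1 ^+ 2) <= Kc by rewrite /Kc -addrA lerDl addr_ge0.
have := ler_wpM2r Q H; congr (_ <= _); [ring | exact: mulrA].
Unshelve. all: by end_near. Qed.

(* Compactness makes the constant of tangent_near uniform. *)
Lemma tangent_uniform E k : (k <= n)%N -> closed_submanifold k E ->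
  exists2 C : R, 0 < C & forall e, E e -> exists T : 'M[R]_(k, n), tangent_at E C^-1 e T.
Proof.
move=> kn [/compact_near_coveringP/near_covering_withinP cE sE].
have H := cE R (0 : R)^'+ (fun s e => exists T : 'M[R]_(k, n), tangent_at E s e T) _.
have [|r r0 HE] := near0_right_ex (H _ _).
  by move=> p Ep; exact: tangent_near.
exists r^-1; first by rewrite invr_gt0.
by move=> e Ee; rewrite invrK; exact: HE.
Qed.

End Submanifold.

(** * Orthonormal frames and a quadratic lower bound for the squared distance *)

Section Frames.
Context {R : realType} {n : nat}.
Implicit Types (x y e nu : 'rV[R]_n).

(* Zero vectors are allowed among the t i, so that no rank has to be computed. *)
Definition subframe k (t : 'I_k -> 'rV[R]_n) :=
  (forall i j, i != j -> dot (t i) (t j) = 0) /\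
  (forall i, dot (t i) (t i) = 0 \/ dot (t i) (t i) = 1).

Lemma gram_schmidt_nat (T : nat -> 'rV[R]_n) k : exists t : nat -> 'rV[R]_n,
  [/\ forall i j, (i < k)%N -> (j < k)%N -> i != j -> dot (t i) (t j) = 0,
      forall i, (i < k)%N -> dot (t i) (t i) = 0 \/ dot (t i) (t i) = 1
    & forall nu, (forall i, (i < k)%N -> dot nu (t i) = 0) <->
                 (forall i, (i < k)%N -> dot nu (T i) = 0)].
Proof.
elim: k => [|k [t [tO tN tT]]]; first by exists T.
pose r := T k - \sum_(i < k) dot (T k) (t i) *: t i.
have rt j : (j < k)%N -> dot r (t j) = 0.
  move=> jk; rewrite /r dotDl dotNl dot_suml (bigD1 (Ordinal jk)) //= big1 ?addr0; last first.
    by move=> i ij; rewrite dotZl tO ?mulr0.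
  rewrite dotZl; case: (tN j jk) => E; rewrite E; last by rewrite mulr1 subrr.
  by move/eqP : E; rewrite dot_eq0 => /eqP->; rewrite dot0r mul0r subrr.
have nur nu : (forall i, (i < k)%N -> dot nu (t i) = 0) -> dot nu r = dot nu (T k).
  move=> nt; rewrite /r dotDr dotNr dot_sumr big1 ?subr0 // => i _.
  by rewrite dotZr nt ?mulr0.
(* If [T k] depends linearly on the earlier vectors, then [r] vanishes and the appended vector is
   0. *)
pose t' i := if i == k then (enorm r)^-1 *: r else t i.
have t'k : t' k = (enorm r)^-1 *: r by rewrite /t' eqxx.
have t'E i : (i < k)%N -> t' i = t i by move=> ik; rewrite /t' ltn_eqF.
exists t'; split.
- move=> i j; rewrite !ltnS leq_eqVlt => /orP[/eqP->|ik]; rewrite leq_eqVlt => /orP[/eqP->|jk].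
  + by rewrite eqxx.
  + by rewrite t'k t'E // dotZl rt ?mulr0.
  + by rewrite t'k t'E // dotZr dotC rt ?mulr0.
  + by rewrite !t'E //; exact: tO.
- move=> i; rewrite ltnS leq_eqVlt => /orP[/eqP->|ik]; last by rewrite t'E //; exact: tN.
  rewrite t'k dotZl dotZr -sqr_enorm.
  have [->|r0] := eqVneq (enorm r) 0; first by left; rewrite expr0n /= !mulr0.
  by right; field.
- move=> nu; split=> H i; rewrite ltnS leq_eqVlt => /orP[/eqP->|ik].
  + have H' j : (j < k)%N -> dot nu (t j) = 0 by move=> jk; rewrite -t'E ?H // ltnS ltnW.
    have := H k (ltnSn k); rewrite t'k dotZr => /eqP; rewrite mulf_eq0 invr_eq0.
    rewrite enorm_eq0 -nur // => /orP[/eqP->|/eqP->//]; exact: dot0r.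
  + have H' j : (j < k)%N -> dot nu (t j) = 0 by move=> jk; rewrite -t'E ?H // ltnS ltnW.
    exact: (tT nu).1.
  + have H' j : (j < k)%N -> dot nu (t j) = 0.
      move=> jk; apply: (tT nu).2 => // l lk; by rewrite H // ltnS ltnW.
    by rewrite t'k dotZr nur // H // mulr0.
  + rewrite t'E //; apply: (tT nu).2 => // l lk; by rewrite H // ltnS ltnW.
Qed.

Lemma gram_schmidt k (T : 'M[R]_(k, n)) : exists t : 'I_k -> 'rV[R]_n,
  subframe t /\
  forall nu, (forall i, dot nu (t i) = 0) <-> (forall i, dot nu (row i T) = 0).
Proof.
pose T' i := if insub i is Some j then row (j : 'I_k) T else 0.
have [t [tO tN tT]] := gram_schmidt_nat T' k.
have T'E (i : 'I_k) : T' i = row i T by rewrite /T' valK.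
exists (fun i : 'I_k => t i); split; first by split=> [i j ij|i]; [exact: tO | exact: tN].
move=> nu; split=> H i.
- rewrite -T'E; apply: (tT nu).1 => // j jk; exact: (H (Ordinal jk)).
- apply: (tT nu).2 => // j jk; by rewrite (T'E (Ordinal jk)).
Qed.

Section projection.
Variables (k : nat) (t : 'I_k -> 'rV[R]_n).
Hypothesis tf : subframe t.

Definition proj x := \sum_i dot x (t i) *: t i.

Lemma dot_proj x y : dot (proj x) y = \sum_i dot x (t i) * dot y (t i).
Proof. by rewrite dot_suml; apply: eq_bigr => i _; rewrite dotZl [dot (t i) y]dotC. Qed.

Lemma proj_frame x j : dot (proj x) (t j) = dot x (t j).
Proof.
have [tO tN] := tf.
rewrite dot_proj (bigD1 j) //= big1 ?addr0; last first.
  by move=> i ij; rewrite tO 1?eq_sym // mulr0.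
case: (tN j) => E; rewrite E ?mulr1 //.
by move/eqP : E; rewrite dot_eq0 => /eqP->; rewrite dot0r mul0r.
Qed.

Lemma proj_orth x j : dot (x - proj x) (t j) = 0.
Proof. by rewrite dotDl dotNl proj_frame subrr. Qed.

Lemma proj_orth_proj x y : dot (x - proj x) (proj y) = 0.
Proof. by rewrite dot_sumr big1 // => i _; rewrite dotZr proj_orth mulr0. Qed.

Lemma dot_proj_decomp x y :
  dot x y = dot (proj x) (proj y) + dot (x - proj x) (y - proj y).
Proof.
have := proj_orth_proj x y; have := proj_orth_proj y x.
rewrite !(dotDl, dotDr, dotNl, dotNr) => E1 E2.
have := dotC (proj x) (proj y); have := dotC (proj x) y; lra.
Qed.

Lemma dot_proj_sum x : dot (proj x) (proj x) = \sum_i dot x (t i) ^+ 2.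
Proof. by rewrite dot_proj; apply: eq_bigr => i _; rewrite proj_frame. Qed.

Lemma subframe_le1 i : dot (t i) (t i) <= 1.
Proof. by case: (tf.2 i) => ->. Qed.

End projection.

Lemma projB k (t : 'I_k -> 'rV[R]_n) x y : proj t (x - y) = proj t x - proj t y.
Proof.
rewrite /proj -sumrB; apply: eq_bigr => i _.
by rewrite dotDl dotNl scalerDl scaleNr.
Qed.

(* X and Y are x - e and e' - e: the squared distance from x to E is bounded
   below by a quadratic polynomial in x. *)
Lemma touching_aux k (t : 'I_k -> 'rV[R]_n) (X Y : 'rV[R]_n) (C r : R) :
  subframe t -> 0 <= C -> 0 <= r -> C * r <= 1 / 8 ->
  (forall nu, (forall i, dot nu (t i) = 0) -> `|dot nu Y| <= C * enorm nu * dot Y Y) ->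
  enorm X <= r -> enorm (X - Y) <= enorm X ->
  dot X X - (1 + 8 * C * r) * (\sum_i dot X (t i) ^+ 2) <= dot (X - Y) (X - Y).
Proof.
move=> tf C0 r0 Cr nuY Xr XY.
(* [a] and [b] are the tangential parts. The normal part [Y'] is of second order by the curvature
   bound, so [Y] is controlled by [b], and the cross term [dot X' Y'] by a small multiple of
   [dot b b]. *)
set a := proj t X; set b := proj t Y; set X' := X - a; set Y' := Y - b.
have Y'Y : enorm Y' <= C * dot Y Y.
  have [->|Y'0] := eqVneq (enorm Y') 0; first by rewrite mulr_ge0 ?dot_ge0.
  have Y'p : 0 < enorm Y' by rewrite lt_def Y'0 enorm_ge0.
  have := nuY Y' (proj_orth tf Y).
  have -> : dot Y' Y = enorm Y' ^+ 2.
    rewrite sqr_enorm [RHS]/dot -/(dot _ _) [in RHS]/Y' dotDr dotNr.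
    by rewrite (proj_orth_proj tf) subr0.
  rewrite ger0_norm ?sqr_ge0 // expr2 [C * _]mulrC -mulrA.
  by rewrite ler_pM2l.
have Y2r : enorm Y <= 2 * r.
  have := enorm_triangle X (Y - X); rewrite addrC subrK enormB; lra.
have YY : dot Y Y <= 2 * dot b b.
  have E : dot Y Y = dot b b + enorm Y' ^+ 2 by rewrite (dot_proj_decomp tf) sqr_enorm.
  have Y4 : dot Y Y <= 4 * r ^+ 2.
    have -> : 4 * r ^+ 2 = (2 * r) ^+ 2 by ring.
    rewrite -sqr_enorm ler_pXn2r ?nnegrE ?enorm_ge0 ?mulr_ge0 //.
  have H1 : enorm Y' ^+ 2 <= (C * dot Y Y) ^+ 2.
    by rewrite ler_pXn2r ?nnegrE ?enorm_ge0 ?mulr_ge0 ?dot_ge0.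
  have H2 : (C * dot Y Y) ^+ 2 <= 4 * (C * r) ^+ 2 * dot Y Y.
    have -> : (C * dot Y Y) ^+ 2 = C ^+ 2 * dot Y Y * dot Y Y by ring.
    have -> : 4 * (C * r) ^+ 2 * dot Y Y = C ^+ 2 * (4 * r ^+ 2) * dot Y Y by ring.
    by rewrite ler_wpM2r ?dot_ge0 // ler_wpM2l ?sqr_ge0.
  have H3 : (C * r) ^+ 2 <= 1 / 64.
    have -> : 1 / 64 = (1 / 8) ^+ 2 :> R by field.
    by rewrite ler_pXn2r ?nnegrE ?mulr_ge0 //; lra.
  have H4 : (C * r) ^+ 2 * dot Y Y <= 1 / 64 * dot Y Y by rewrite ler_wpM2r ?dot_ge0.
  have := dot_ge0 Y; lra.
have X'r : enorm X' <= r.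
  apply: le_trans Xr; rewrite -(@ler_pXn2r _ 2) ?nnegrE ?enorm_ge0 // !sqr_enorm.
  by rewrite [leRHS](dot_proj_decomp tf) lerDr dot_ge0.
have cross : dot X' Y' <= 2 * C * r * dot b b.
  apply: le_trans (le_trans (ler_norm _) (dot_le_enorm _ _)) _.
  apply: (@le_trans _ _ (r * (C * (2 * dot b b)))); last by rewrite le_eqVlt; apply/orP; left; apply/eqP; ring.
  apply: ler_pM => //; rewrite ?enorm_ge0 //.
  by apply: le_trans Y'Y _; rewrite ler_wpM2l.
rewrite (dot_proj_decomp tf (X - Y)) projB -/a -/b.
have -> : X - Y - (a - b) = X' - Y' by rewrite /X' /Y'; apply/rowP => i; rewrite !mxE; ring.
rewrite [dot X X](dot_proj_decomp tf) -(dot_proj_sum tf) -/a -/X'.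
have Y'0 := dot_ge0 Y'.
clearbody X' Y' a b.
rewrite !(dotDl, dotDr, dotNl, dotNr) [dot b a]dotC [dot Y' X']dotC.
(* With this [mu] the cross term costs at most [mu * dot b b], and the remaining form in [a] and [b]
   is nonnegative because (1 + 2 mu)(1 - mu) >= 1 for 0 <= mu <= 1/2. *)
set mu := 4 * C * r.
have mu0 : 0 <= mu by rewrite /mu !mulr_ge0.
have mu2 : mu <= 1 / 2 by rewrite /mu; lra.
have -> : 8 * C * r = 2 * mu by rewrite /mu; ring.
have S : 0 <= (1 + 2 * mu) * dot a a - 2 * dot a b + (1 - mu) * dot b b.
  have := dot_ge0 ((1 + 2 * mu) *: a - b).
  rewrite !(dotDl, dotDr, dotNl, dotNr, dotZl, dotZr) [dot b a]dotC => H.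
  have mu1 : 0 < 1 + 2 * mu by lra.
  rewrite -(pmulr_rge0 _ mu1).
  have bb : 0 <= (mu - 2 * mu ^+ 2) * dot b b.
    rewrite mulr_ge0 ?dot_ge0 //.
    have -> : mu - 2 * mu ^+ 2 = mu * (1 - 2 * mu) by ring.
    by rewrite mulr_ge0 //; lra.
  nra.
have : 2 * dot X' Y' <= mu * dot b b by rewrite /mu; lra.
lra.
Qed.

End Frames.

Lemma lipschitz_norm_continuous (R : realType) (V W : normedModType R) (f : V -> W) (K : R) :
  0 <= K -> (forall x y, `|f x - f y| <= K * `|x - y|) -> continuous f.
Proof.
move=> K0 fl x; apply/cvgrPdist_lt => eps eps0.
have n1 : 0 < K + 1 by rewrite ltr_wpDl.
apply/nbhs_ballP; exists (eps / (K + 1)) => /=; first by rewrite divr_gt0.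
move=> y; rewrite -ball_normE /= ltr_pdivlMr // mulrC => xy.
by apply: le_lt_trans (fl x y) _; apply: le_lt_trans xy; rewrite ler_wpM2r // lerDl.
Qed.

(** * The distance function of a compact set *)

Section Distance.
Context {R : realType} {n : nat}.
Implicit Types (x y e nu : 'rV[R]_n) (E : set 'rV[R]_n).

Lemma enorm_lipschitz_continuous (f : 'rV[R]_n -> R) :
  (forall x y, `|f x - f y| <= enorm (x - y)) -> continuous f.
Proof.
move=> fl; apply: (@lipschitz_norm_continuous _ _ _ f n%:R) => // x y.
exact: le_trans (fl x y) (enorm_le_norm _).
Qed.

(** Real-valued version of [eucl_dist]. For empty [E] it is 0 instead of +oo, so that case is
    treated separately in the theorem. *)
Definition dE E x : R := inf [set enorm (x - e) | e in E].

Lemma dE_le E x e : E e -> dE E x <= enorm (x - e).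
Proof.
move=> Ee; apply: ge_inf; last by exists e.
by exists 0 => _ [e' _ <-]; exact: enorm_ge0.
Qed.

Lemma dE_nearest E x e : nearest E x e -> dE E x = enorm (x - e).
Proof.
move=> [Ee xe]; apply/eqP; rewrite eq_le dE_le //=.
apply: lb_le_inf; first by exists (enorm (x - e)), e.
move=> _ [e' Ee' <-]; rewrite -(@ler_pXn2r _ 2) ?nnegrE ?enorm_ge0 // !sqr_enorm.
exact: xe.
Qed.

Section compact.
Variable E : set 'rV[R]_n.
Hypotheses (cE : compact E) (E0 : E !=set0).

Lemma nearest_exists x : exists e, nearest E x e.
Proof.
have fc : continuous (fun e => enorm (x - e)).
  apply: enorm_lipschitz_continuous => e e'; rewrite ler_norml; apply/andP; split.
    have := enorm_triangle (x - e) (e - e'); rewrite subrKA; lra.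
  have := enorm_triangle (x - e') (e' - e); rewrite subrKA enormB; rewrite [enorm (e' - e)]enormB; lra.
have [e /set_mem Ee emin] := EVT_min_rV E0 cE (continuous_subspaceT fc).
exists e; split=> // e' Ee'.
by rewrite -!sqr_enorm ler_pXn2r ?nnegrE ?enorm_ge0 // emin // inE.
Qed.

Lemma dE_ge0 x : 0 <= dE E x.
Proof. by have [e /dE_nearest->] := nearest_exists x; exact: enorm_ge0. Qed.

Lemma dE_eq0 x : dE E x = 0 <-> E x.
Proof.
split=> [|Ex].
  have [e xe] := nearest_exists x; rewrite (dE_nearest xe) => /eqP.
  by rewrite enorm_eq0 subr_eq0 => /eqP->; case: xe.
by apply/eqP; rewrite eq_le dE_ge0 andbT (le_trans (dE_le x Ex)) // subrr enorm0.
Qed.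

Lemma dE_gt0 x : ~ E x -> 0 < dE E x.
Proof. by move=> nEx; rewrite lt_def dE_ge0 andbT; apply/eqP => /dE_eq0. Qed.

Lemma dE_lipschitz x y : `|dE E x - dE E y| <= enorm (x - y).
Proof.
have aux a b : dE E a - dE E b <= enorm (a - b).
  have [e be] := nearest_exists b; rewrite (dE_nearest be).
  have := dE_le a be.1; have := enorm_triangle (a - b) (b - e); rewrite subrKA; lra.
by rewrite ler_norml aux andbT; have := aux y x; rewrite enormB; lra.
Qed.

Lemma dE_continuous : continuous (dE E).
Proof. exact: enorm_lipschitz_continuous dE_lipschitz. Qed.

Lemma eucl_dist_dE x : eucl_dist x E = (dE E x)%:E.
Proof.
have eE y : Num.sqrt (\sum_i (x 0 i - y 0 i) ^+ 2) = enorm (x - y).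
  by rewrite /enorm dotE; congr Num.sqrt; apply: eq_bigr => i _; rewrite !mxE expr2.
have [e xe] := nearest_exists x.
apply/eqP; rewrite eq_le; apply/andP; split.
  apply: ereal_inf_lbound; exists e; first exact: xe.1.
  by rewrite eE (dE_nearest xe).
apply: le_ereal_inf_tmp => _ [y Ey <-].
by rewrite eE lee_fin dE_le.
Qed.

Lemma dE_band_compact (a b : R) : compact [set x | a <= dE E x <= b].
Proof.
have [M [Mr EM]] := compact_bounded cE.
have EB e : E e -> `|e| <= M + 1 by move=> Ee; apply: EM => //; rewrite ltrDl.
apply: bounded_closed_compact; last first.
  have -> : [set x | a <= dE E x <= b] = dE E @^-1` `[a, b].
    by apply/seteqP; split=> x /=; rewrite in_itv.
  by apply: preimage_closed => [x _|]; [exact: dE_continuous | exact: interval_closed].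
exists (M + 1 + b); split; first exact: num_real.
move=> z Mz x /= /andP[_ xb]; apply: ltW; apply: le_lt_trans Mz.
have [e xe] := nearest_exists x.
have := EB e xe.1; have := norm_le_enorm (x - e); rewrite -(dE_nearest xe).
have := ler_normD (x - e) e; rewrite subrK; lra.
Qed.

(** Compactness makes the radius uniform: each point of [E] is the centre of a ball inside [A], and
    half of its radius works for all nearby centres. *)
Lemma dE_nbhd (A : set 'rV[R]_n) : open A -> E `<=` A ->
  exists2 r : R, 0 < r & forall x, dE E x < r -> A x.
Proof.
move=> oA EA.
move: (cE) => /compact_near_coveringP/(_ R (0 : R)^'+ (fun s e => ball e s `<=` A) _) H.
have [|r r0 rA] := near0_right_ex (H _).
  move=> e Ee; have /nbhs_ballP[r /= r0 rA] := open_nbhs_nbhs (conj oA (EA e Ee)).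
  near=> e' s.
  have sr : s <= r / 2 by near: s; apply: nbhs_right_le; rewrite divr_gt0.
  move=> /= z zs.
  apply: rA; rewrite (splitr r).
  apply: (@ball_triangle _ _ e'); first by near: e'; apply: nbhsx_ballx; rewrite divr_gt0.
  exact: le_ball zs.
exists r => // x; have [e xe] := nearest_exists x; rewrite (dE_nearest xe) => H1.
apply: (rA e xe.1); rewrite -ball_normE /= distrC.
exact: le_lt_trans (norm_le_enorm _) H1.
Unshelve. all: by end_near. Qed.

End compact.
End Distance.

(** * Comparison with the logarithmic barrier *)

Section Barrier.
Context {R : realType}.

Lemma is_derive_inv (f : R -> R) (t df : R) : f t != 0 -> is_derive t 1 f df ->
  is_derive t 1 (fun s => (f s)^-1) (- df / f t ^+ 2).
Proof.
move=> ft0 [fd <-]; split; first exact: derivableV.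
by rewrite (deriveV ft0 fd) -[_ *: _]/(_ * _) mulrC mulrN -mulNr.
Qed.

Lemma is_derive_quadratic (s p c t : R) :
  is_derive t 1 (fun t : R => s + 2 * p * t + c * t ^+ 2) (2 * p + 2 * c * t).
Proof.
have -> : (fun t : R => s + 2 * p * t + c * t ^+ 2) =
   cst s + (2 * p) \*: (id : R -> R) + c \*: (id : R -> R) ^+ 2.
  by apply/funext => z.
apply: is_derive_eq; rewrite /= -![_ *: _]/(_ * _); ring.
Qed.

Section barrier_fun.
Variables al be ga : R.

(** For s = d^2 this is al d^2 + be d + 2 ga ln d. With nonnegative coefficients it increases with
    [s], so a polynomial touching d^2 from below can be substituted for d^2. *)
Definition barrier (s : R) := al * s + be * Num.sqrt s + ga * ln s.

Definition barrier1 (s : R) := al + be * (2 * Num.sqrt s)^-1 + ga * s^-1.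

Definition barrier2 (s : R) := - be / (4 * s * Num.sqrt s) - ga / s ^+ 2.

Lemma barrier_le (s s' : R) : 0 <= al -> 0 <= be -> 0 <= ga -> 0 < s -> s <= s' ->
  barrier s <= barrier s'.
Proof.
move=> al0 be0 ga0 s0 ss'; have s'0 : 0 < s' by exact: lt_le_trans ss'.
by rewrite /barrier !lerD // ler_wpM2l // ?ler_wsqrtr // ler_ln.
Qed.

Lemma is_derive_barrier (f : R -> R) (t df : R) : 0 < f t -> is_derive t 1 f df ->
  is_derive t 1 (fun z => barrier (f z)) (barrier1 (f t) * df).
Proof.
move=> ft fd.
have D1 : is_derive t 1 (fun z => Num.sqrt (f z)) ((2 * Num.sqrt (f t))^-1 * df).
  by apply: is_derive1_comp; exact: is_derive1_sqrt.
have D2 : is_derive t 1 (fun z => ln (f z)) ((f t)^-1 * df).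
  by apply: is_derive1_comp; exact: is_derive1_ln.
have -> : (fun z => barrier (f z)) =
   al \*: f + be \*: (fun z => Num.sqrt (f z)) + ga \*: (fun z => ln (f z)).
  by apply/funext => z.
apply: is_derive_eq; rewrite -![_ *: _]/(_ * _) /barrier1; ring.
Qed.

Lemma is_derive_barrier1 (f : R -> R) (t df : R) : 0 < f t -> is_derive t 1 f df ->
  is_derive t 1 (fun z => barrier1 (f z)) (barrier2 (f t) * df).
Proof.
move=> ft fd.
have s0 : 0 < Num.sqrt (f t) by rewrite sqrtr_gt0.
have D1 : is_derive t 1 (fun z => Num.sqrt (f z)) ((2 * Num.sqrt (f t))^-1 * df).
  by apply: is_derive1_comp; exact: is_derive1_sqrt.
have D1' : is_derive t 1 (fun z => 2 * Num.sqrt (f z)) (2 * ((2 * Num.sqrt (f t))^-1 * df)).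
  exact: (is_deriveZ (f := fun z => Num.sqrt (f z)) 2).
have D1'' := is_derive_inv (f := fun z => 2 * Num.sqrt (f z)) (lt0r_neq0 (mulr_gt0 (ltr0Sn R 1) s0)) D1'.
have D2 := is_derive_inv (lt0r_neq0 ft) fd.
have -> : (fun z => barrier1 (f z)) =
   cst al + be \*: (fun z => (2 * Num.sqrt (f z))^-1) + ga \*: (fun z => (f z)^-1).
  by apply/funext => z.
apply: is_derive_eq; rewrite -![_ *: _]/(_ * _) /barrier2.
have E : f t = Num.sqrt (f t) ^+ 2 by rewrite sqr_sqrtr // ltW.
set r := Num.sqrt (f t) in s0 E *; rewrite E.
by field; exact: lt0r_neq0.
Qed.

Lemma is_derive2_barrier_quadratic (s p c : R) : 0 < s ->
  is_derive (0 : R) 1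
    (fun t => barrier1 (s + 2 * p * t + c * t ^+ 2) * (2 * p + 2 * c * t))
    (barrier2 s * (4 * p ^+ 2) + barrier1 s * (2 * c)).
Proof.
move=> s0.
pose f (t : R) := s + 2 * p * t + c * t ^+ 2.
have f0 : f 0 = s by rewrite /f expr0n /= !mulr0 !addr0.
have fd := is_derive_quadratic s p c 0.
have D1 : is_derive (0 : R) 1 (fun z => barrier1 (f z)) (barrier2 (f 0) * (2 * p + 2 * c * 0)).
  by apply: is_derive_barrier1; rewrite ?f0.
have D2 : is_derive (0 : R) 1 (fun t : R => 2 * p + 2 * c * t) (2 * c).
  have -> : (fun t : R => 2 * p + 2 * c * t) = cst (2 * p) + (2 * c) \*: (id : R -> R).
    by apply/funext => z.
  by apply: is_derive_eq; rewrite -![_ *: _]/(_ * _) add0r mulr1.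
have := is_deriveM D1 D2.
rewrite -![_ *: _]/(_ * _) => D; apply: is_derive_eq D _.
rewrite f0; ring.
Qed.

End barrier_fun.
End Barrier.

(** * Derivative tests at a minimum *)

Section Touching.
Context {R : realType} {n : nat}.
Implicit Types (x y e d : 'rV[R]_n) (A E : set 'rV[R]_n).

(** Testing one line at a time suffices: gradients are read off along directions and Hessians are
    compared as quadratic forms. Of the comparison function only a one-variable profile [p] along
    the line is differentiated. *)
Lemma line_test A (u v : 'rV[R]_n -> R) x0 d (p p1 : R -> R) (p2 : R) :
  open A -> Cm 2 A u -> Cm 2 A v -> A x0 ->
  (\forall t \near (0 : R), is_derive (t : R) (1 : R) p (p1 t)) ->
  is_derive (0 : R) 1 p1 p2 ->
  (\forall t \near (0 : R), u x0 - v x0 - p 0 <= u (x0 + t *: d) - v (x0 + t *: d) - p t) ->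
  'D_d u x0 = 'D_d v x0 + p1 0 /\ qform (hess v x0) d + p2 <= qform (hess u x0) d.
Proof.
move=> oA u2 v2 Ax0 pd p1d pm.
have [u1 v1] := (CmW u2, CmW v2).
pose g t := u (x0 + t *: d) - v (x0 + t *: d) - p t.
pose g1 t := 'D_d u (x0 + t *: d) - 'D_d v (x0 + t *: d) - p1 t.
have gd : \forall t \near (0 : R), is_derive (t : R) (1 : R) g (g1 t).
  near=> t.
  have At : A (x0 + t *: d) by near: t; exact: segment_near.
  have D1 := is_derive_line (Cm_derivable (d := d) u1 At).
  have D2 := is_derive_line (Cm_derivable (d := d) v1 At).
  have D3 : is_derive (t : R) (1 : R) p (p1 t) by near: t.
  exact: is_deriveB (is_deriveB D1 D2) D3.
have g1d : is_derive (0 : R) (1 : R) g1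
    ('D_d ('D_d u) x0 - 'D_d ('D_d v) x0 - p2).
  have A0 : A (x0 + (0 : R) *: d) by rewrite scale0r addr0.
  have D1 := is_derive_line (Cm_derivable (d := d) (Cm_derive d u2) A0).
  have D2 := is_derive_line (Cm_derivable (d := d) (Cm_derive d v2) A0).
  have := is_deriveB (is_deriveB D1 D2) p1d.
  by rewrite scale0r addr0.
have [|g10 g20] := second_order_min gd g1d.
  apply: filterS pm => t; by rewrite /g scale0r addr0.
move: g10 g20; rewrite /g1 scale0r addr0 !(derive2_qform _ oA _ Ax0) // => g10 g20.
by split; [apply/eqP; rewrite -subr_eq0 opprD addrA g10 | rewrite -subr_ge0 opprD addrA].
Unshelve. all: by end_near. Qed.

Section touching_E.
Variables (E : set 'rV[R]_n) (k : nat) (C : R).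
Hypotheses (cE : compact E) (C0 : 0 < C).
Hypothesis tanE : forall e, E e -> exists T : 'M[R]_(k, n), tangent_at E C^-1 e T.

(** [dE E x ^+ 2] is the squared distance from [x] to one of its nearest points, which
    [touching_aux] with [r = 2 * dE E x0] bounds from below. Both sides agree at [x0], where the
    tangential terms vanish. *)
Lemma touching_dE x0 e : nearest E x0 e -> 0 < dE E x0 -> 16 * C * dE E x0 <= 1 ->
  exists t : 'I_k -> 'rV[R]_n, [/\ subframe t, forall i, dot (x0 - e) (t i) = 0
    & \forall x \near x0, dot (x - e) (x - e) -
       (1 + 16 * C * dE E x0) * (\sum_i dot (x - e) (t i) ^+ 2) <= dE E x ^+ 2].
Proof.
move=> xe d0 Cd.
have E0 : E !=set0 by exists e; exact: xe.1.
have [T [Tx Tnu]] := tanE xe.1.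
have [t [tf tT]] := gram_schmidt T.
exists t; split => //; first by move=> i; apply: (tT _).2; exact: Tx.
have xr : \forall x \near x0, enorm (x - e) < 2 * dE E x0.
  have fc : continuous (fun x => enorm (x - e)).
    apply: enorm_lipschitz_continuous => x y; rewrite ler_norml; apply/andP; split.
      have := enorm_triangle (y - x) (x - e); rewrite subrKA enormB; lra.
    have := enorm_triangle (x - y) (y - e); rewrite subrKA; lra.
  have : enorm (x0 - e) < 2 * dE E x0 by rewrite -(dE_nearest xe); lra.
  by move=> H; exact: (cvgr_lt _ (fc x0) _ H).
near=> x.
have xr' : enorm (x - e) < 2 * dE E x0 by near: x.
have [e' xe'] := nearest_exists cE E0 x.
rewrite (dE_nearest xe') sqr_enorm.
have -> : x - e' = (x - e) - (e' - e) by rewrite opprB addrA subrK.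
have -> : 16 * C * dE E x0 = 8 * C * (2 * dE E x0) by ring.
apply: (touching_aux tf (ltW C0)).
- by rewrite mulr_ge0 // ltW.
- lra.
- move=> nu nut; have := Tnu nu ((tT nu).1 nut) e' xe'.1; by rewrite invrK.
- exact: ltW.
- have -> : (x - e) - (e' - e) = x - e' by rewrite opprB addrA subrK.
  by rewrite -(dE_nearest xe') dE_le //; exact: xe.1.
Unshelve. all: by end_near. Qed.

Lemma touching_line (x0 e d : 'rV[R]_n) (t : 'I_k -> 'rV[R]_n) (g z : R) :
  (forall i, dot (x0 - e) (t i) = 0) ->
  dot (x0 + z *: d - e) (x0 + z *: d - e) -
     (1 + g) * (\sum_i dot (x0 + z *: d - e) (t i) ^+ 2) =
  dot (x0 - e) (x0 - e) + 2 * dot (x0 - e) d * z +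
    (dot d d - (1 + g) * (\sum_i dot d (t i) ^+ 2)) * z ^+ 2.
Proof.
move=> xt; have -> : x0 + z *: d - e = (x0 - e) + z *: d by rewrite addrAC.
have -> : \sum_i dot (x0 - e + z *: d) (t i) ^+ 2 = z ^+ 2 * \sum_i dot d (t i) ^+ 2.
  by rewrite mulr_sumr; apply: eq_bigr => i _; rewrite dotDl dotZl xt add0r exprMn.
move: (x0 - e) => X; rewrite !(dotDl, dotDr, dotZl, dotZr) [dot d X]dotC; ring.
Qed.

(* Since -ln d is harmonic on planes, the logarithm is exactly balanced in
   2 normal directions; the term be * d makes the barrier strict. *)
Lemma barrier_no_min A (u v : 'rV[R]_n -> R) x0 (K al be ga : R) :
  (k.+2 <= n)%N -> open A -> Cm 2 A u -> Cm 2 A v -> A x0 -> 0 < dE E x0 ->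
  \sum_(i < k.+2) lambda i (hess u x0) <= 0 ->
  (forall d, - K * dot d d <= qform (hess v x0) d) ->
  0 <= al -> 0 < be -> 0 <= ga ->
  16 * C * dE E x0 <= 1 -> 32 * C * k%:R * dE E x0 <= 4 -> 64 * C * k%:R * ga <= be ->
  (k.+2%:R * K + 16 * C * k%:R * be) * (2 * dE E x0) < be ->
  (\forall x \near x0, u x0 - v x0 - barrier al be ga (dE E x0 ^+ 2) <=
                       u x - v x - barrier al be ga (dE E x ^+ 2)) ->
  False.
Proof.
move=> kn oA u2 v2 Ax0 d0 ulam Kv al0 be0 ga0 c1 c2 c3 c4 um.
have E0 : E !=set0.
  apply/set0P/eqP => EE; move: d0; rewrite /dE EE image_set0 inf0 ltxx //.
have [e xe] := nearest_exists cE E0 x0.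
have [t [tf xt tle]] := touching_dE xe d0 c1.
set D := dE E x0 in d0 c1 c2 c3 c4 um tle.
set g := 16 * C * D in tle.
have DE : dot (x0 - e) (x0 - e) = D ^+ 2 by rewrite -sqr_enorm -(dE_nearest xe).
have D2 : 0 < D ^+ 2 by rewrite exprn_gt0.
have g0 : 0 <= g by rewrite /g !mulr_ge0 // ltW.
(* The barrier increases with the squared distance, so replacing the latter by the polynomial
   touching it from below keeps [x0] a minimum along every line. *)
have hessu w : qform (hess v x0) w + (barrier2 be ga (D ^+ 2) * (4 * dot (x0 - e) w ^+ 2) +
     barrier1 al be ga (D ^+ 2) * (2 * (dot w w - (1 + g) * (\sum_i dot w (t i) ^+ 2)))) <=
     qform (hess u x0) w.
  set c := dot w w - _; set p := dot (x0 - e) w.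
  pose f (z : R) := D ^+ 2 + 2 * p * z + c * z ^+ 2.
  have f0 : f 0 = D ^+ 2 by rewrite /f expr0n /= !mulr0 !addr0.
  have fpos : \forall z \near (0 : R), 0 < f z.
    have [fd _] := is_derive_quadratic (D ^+ 2) p c 0.
    have fc : {for 0, continuous f} by apply: differentiable_continuous; exact/derivable1_diffP.
    by apply: (cvgr_gt _ fc); rewrite f0.
  apply: (line_test (p := fun z => barrier al be ga (f z))
    (p1 := fun z => barrier1 al be ga (f z) * (2 * p + 2 * c * z)) oA u2 v2 Ax0 _ _ _).2.
  - near=> z; apply: is_derive_barrier; first by near: z.
    exact: is_derive_quadratic.
  - exact: is_derive2_barrier_quadratic.
  - have L1 := line_near w um; have L2 := line_near w tle.
    near=> z.
    have fz : 0 < f z by near: z.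
    have H1 := near L1 z; have H2 := near L2 z.
    rewrite f0; apply: le_trans (H1 _) _; first by [].
    rewrite lerD2l lerN2; apply: barrier_le => //; first exact: ltW.
    by have := H2 _; rewrite touching_line // DE; apply.
set G1 := barrier1 al be ga (D ^+ 2) in hessu; set G2 := barrier2 be ga (D ^+ 2) in hessu.
have sD : Num.sqrt (D ^+ 2) = D by rewrite sqrtr_sqr gtr0_norm.
have Dn0 := lt0r_neq0 d0.
have G1E : G1 = al + (be * D^-1) / 2 + ga * D^-1 ^+ 2 by rewrite /G1 /barrier1 sD; field.
have G2E : 4 * D ^+ 2 * - G2 = be * D^-1 + 4 * (ga * D^-1 ^+ 2) by rewrite /G2 /barrier2 sD; field.
have a10 : 0 <= be * D^-1 by rewrite mulr_ge0 ?invr_ge0 // ltW.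
have b10 : 0 <= ga * D^-1 ^+ 2 by rewrite mulr_ge0 ?exprn_ge0 ?invr_ge0 // ltW.
have G10 : 0 <= G1 by rewrite G1E; lra.
have xi1 : dot (D^-1 *: (x0 - e)) (D^-1 *: (x0 - e)) <= 1.
  by rewrite dotZl dotZr DE expr2 mulKf // mulVf.
(* The lower bound for the form of [hess u x0] falls below [2 * G1 - K] only through the [k] tangent
   vectors and the unit vector from [e] to [x0]; the [k + 2] lowest eigenvalues are charged for each
   of them at most once. *)
have := @sum_lambda_ge R n (hess u x0) k.+2 k (2 * G1 - K) (2 * G1 * (1 + g))
  (4 * D ^+ 2 * - G2) t (D^-1 *: (x0 - e)) (hess_sym oA u2 Ax0) kn _ _ (subframe_le1 tf) xi1 _.
have g1 : 0 <= 1 + g by lra.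
have P1 : 0 <= 2 * G1 * (1 + g) by rewrite !mulr_ge0.
have P2 : 0 <= 4 * D ^+ 2 * - G2 by rewrite G2E; lra.
have P3 w : (2 * G1 - K) * dot w w - 2 * G1 * (1 + g) * (\sum_i dot w (t i) ^+ 2) -
    4 * D ^+ 2 * - G2 * dot w (D^-1 *: (x0 - e)) ^+ 2 <= qform (hess u x0) w.
  apply: le_trans (hessu w); have := Kv w.
  rewrite dotZr [dot w (x0 - e)]dotC exprMn.
  have -> : 4 * D ^+ 2 * - G2 * (D^-1 ^+ 2 * dot (x0 - e) w ^+ 2) =
            - (4 * G2 * dot (x0 - e) w ^+ 2) by field.
  lra.
move=> /(_ P1 P2 P3) H.
have {}H := le_trans H ulam.
have k2 : k.+2%:R = k%:R + 2 :> R by rewrite -addn2 natrD.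
(* Subtracting [G2E] from 4 times [G1E] leaves [4 * al + be / D]: the terms in ga / D^2 cancel. This
   exceeds the errors [(k + 2) * K] and [2 * k * g * G1], which [Q1] to [Q6] estimate. *)
rewrite k2 G2E G1E in H c4.
have k0 : 0 <= k%:R :> R by [].
have iD : 0 < D^-1 by rewrite invr_gt0.
have ga1 : g * (be * D^-1) = 16 * C * be by rewrite /g; field.
have gb1 : g * (ga * D^-1 ^+ 2) = 16 * C * ga * D^-1 by rewrite /g; field.
have Q1 : 2 * k%:R * g * al <= 4 * al.
  have -> : 2 * k%:R * g * al = (32 * C * k%:R * D) * al by rewrite /g; ring.
  by rewrite ler_wpM2r.
have Q2 : 64 * C * k%:R * ga * D^-1 <= be * D^-1 by rewrite ler_pM2r.
have Q3 : ((k%:R + 2) * K + 16 * C * k%:R * be) * 2 < be * D^-1.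
  by rewrite ltr_pdivlMr //; move: c4; rewrite mulrA.
have Q4 : k%:R * (g * (be * D^-1)) = 16 * C * k%:R * be by rewrite ga1; ring.
have Q5 : k%:R * (g * (ga * D^-1 ^+ 2)) = 16 * C * k%:R * ga * D^-1 by rewrite gb1; ring.
set a1 := be * D^-1 in H a10 Q2 Q3 Q4; set b1 := ga * D^-1 ^+ 2 in H b10 Q5.
clear - H Q1 Q2 Q3 Q4 Q5 al0.
have Q6 : k%:R * (g * b1) <= a1 / 4 by lra.
clear Q5 Q2.
lra.
Unshelve. all: by end_near. Qed.

End touching_E.
End Touching.

Lemma near_dist_lt (R : realType) (V : normedModType R) (f : V -> R) x (e : R) :
  {for x, continuous f} -> 0 < e -> \forall y \near x, `|f x - f y| < e.
Proof. by move=> /cvgrPdist_lt H e0; exact: H. Qed.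

Lemma near_forall (R : realType) (V : normedModType R) (I : finType)
    (P : I -> V -> Prop) (x : V) :
  (forall i, \forall y \near x, P i y) -> \forall y \near x, forall i, P i y.
Proof. by move=> H; exact: (@filter_forall _ _ P (nbhs x) _ H). Qed.

(** * Uniform ellipticity near E *)

Section Operator.
Context {R : realType} {n : nat}.
Implicit Types (z d : jet R n) (M N : 'M[R]_n) (x p : 'rV[R]_n).

Lemma mulr_le_norm (a b K : R) : `|b| <= K -> a * b <= K * `|a|.
Proof.
by move=> bK; apply: le_trans (ler_norm _) _; rewrite normrM mulrC ler_wpM2r.
Qed.

Definition symm M : 'M[R]_n := 2^-1 *: (M + M^T).

Lemma symm_sym M : symmx (symm M).
Proof. by rewrite /symmx /symm /= linearZ /= linearD /= trmxK addrC. Qed.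

Lemma symm_id M : symmx M -> symm M = M.
Proof.
move=> /= Ms; rewrite /symm Ms -mulr2n -[M *+ 2]scaler_nat scalerA mulVf ?scale1r //.
Qed.

Lemma symmD M N : symm (M + N) = symm M + symm N.
Proof. by apply/matrixP => i j; rewrite !mxE; ring. Qed.

Lemma symmZ (a : R) M : symm (a *: M) = a *: symm M.
Proof. by apply/matrixP => i j; rewrite !mxE; ring. Qed.

(** Values of [F] at nonsymmetric matrices carry no information. Composed with [symj], [F] becomes a
    C^1 function on the open set [jets], to which the calculus of [Cm] applies. *)
Definition symj z : jet R n := (z.1, symm z.2).

Lemma norm_mx_lt (p q : nat) (A : 'M[R]_(p, q)) (r : R) : 0 < r ->
  (forall i j, `|A i j| < r) -> `|A| < r.
Proof.
move=> r0 Ar; rewrite [ltLHS]/Num.Def.normr/= mx_normrE.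
by apply: bigmax_lt => // -[i j] _ /=; exact: Ar.
Qed.

Lemma norm_mx_ge (p q : nat) (A : 'M[R]_(p, q)) i j : `|A i j| <= `|A|.
Proof.
rewrite [leRHS]/Num.Def.normr/= mx_normrE.
exact: (le_bigmax _ (fun ij => `|A ij.1 ij.2|) (i, j)).
Qed.

Lemma symm_continuous : continuous symm.
Proof.
apply: (@lipschitz_norm_continuous _ _ _ symm 1) => // M N.
have -> : symm M - symm N = symm (M - N) by apply/matrixP => i j; rewrite !mxE; ring.
rewrite mul1r [leLHS]/Num.Def.normr/= mx_normrE; apply: bigmax_le => // -[i j] _ /=.
rewrite mxE normrM gtr0_norm ?invr_gt0 // ler_pdivrMl // mxE.
apply: le_trans (ler_normD _ _) _; have := norm_mx_ge (M - N) i j.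
have := norm_mx_ge (M - N) j i; rewrite [(M - N)^T i j]mxE.
move: (`|_|) (`|_|) (`|_|) => *; lra.
Qed.

Lemma symj_continuous : continuous symj.
Proof.
move=> z.
have H1 : (fun w : jet R n => w.1) @ z --> z.1 by exact: cvg_fst.
have H2 : (fun w : jet R n => symm w.2) @ z --> symm z.2.
  by apply: (cvg_comp (fun w : jet R n => w.2) symm); [exact: cvg_snd | exact: symm_continuous].
exact: (cvg_pair H1 H2).
Qed.

Variables (Omega : set 'rV[R]_n) (F : jet R n -> R).
Hypotheses (oO : open Omega) (F_C1 : C1_operator Omega F).

Definition jets : set (jet R n) := [set z | Omega z.1.1.1].

Lemma open_jets : open jets.
Proof.
apply: (@open_comp _ _ (fun z : jet R n => z.1.1.1)) oO => z _.
by apply: (cvg_comp (fun z : jet R n => z.1.1) fst);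
  [apply: (cvg_comp (fun z : jet R n => z.1) fst) |]; exact: cvg_fst.
Qed.

Lemma comp_symj_continuous (G : jet R n -> R) z :
  {within [set z | Omega z.1.1.1 /\ symmx z.2], continuous G} -> jets z ->
  {for z, continuous (G \o symj)}.
Proof.
move=> /subspace_continuousP Gc Oz.
have Bz y : jets y -> [set z | Omega z.1.1.1 /\ symmx z.2] (symj y).
  by move=> Oy; split=> //; exact: symm_sym.
apply: (@cvg_comp _ _ _ symj G _ (within [set z | Omega z.1.1.1 /\ symmx z.2] (nbhs (symj z)))); last first.
  exact: Gc (Bz z Oz).
move=> P wP; have nP : nbhs z (symj @^-1` [set t | [set z | Omega z.1.1.1 /\ symmx z.2] t -> P t]).
  exact: symj_continuous wP.
have nA := open_nbhs_nbhs (conj open_jets Oz).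
exact: (@filterS2 _ (nbhs z) (nbhs_filter z) _ _ _ (fun y H1 Oy => H1 (Bz y Oy)) nP nA).
Qed.

Lemma is_derive_symj z d : jets z ->
  is_derive z d (F \o symj) ('D_(symj d) F (symj z)).
Proof.
move=> Oz; apply: line_is_derive.
have -> : (fun s : R => (F \o symj) (z + s *: d)) = (fun s : R => F (symj z + s *: symj d)).
  apply/funext => s /=; congr F; rewrite /symj; congr (_, _).
  by rewrite /= symmD symmZ.
have Fd : derivable F (symj z) (symj d).
  by have [_ /(_ (symj d) (symm_sym _))[H _]] := F_C1; apply: H; split=> //; exact: symm_sym.
have := @is_derive_line R _ _ F (symj z) (symj d) 0.
by rewrite scale0r addr0; apply.
Qed.

Lemma Cm_symj : Cm 1 jets (F \o symj).
Proof.
split; first by apply/(within_openP open_jets) => z; apply: comp_symj_continuous; case: F_C1.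
move=> d _; split=> [z Oz|]; first by have [] := is_derive_symj d Oz.
split=> //; apply/(within_openP open_jets) => z Oz.
have Gc : {for z, continuous ('D_(symj d) F \o symj)}.
  apply: comp_symj_continuous => //.
  by have [_ /(_ (symj d) (symm_sym _))[_ []]] := F_C1.
have E y : jets y -> ('D_(symj d) F \o symj) y = 'D_d (F \o symj) y.
  by move=> Oy; have [_ ->] := is_derive_symj d Oy.
rewrite /prop_for /continuous_at -E //; apply: cvg_trans Gc.
apply: near_eq_cvg; apply: (open_near_eq open_jets) Oz => y Oy; exact: E.
Qed.

Definition inS (s : R) : jet R n := (0, s, 0, 0).
Definition inP (p : 'rV[R]_n) : jet R n := (0, 0, p, 0).
Definition inM M : jet R n := (0, 0, 0, M).

Lemma dF_dME z i j : jets z -> symmx z.2 ->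
  dF_dM F z i j = 'D_(inM (delta_mx i j)) (F \o symj) z.
Proof.
move=> Oz zs; have [_ ->] := is_derive_symj (inM (delta_mx i j)) Oz.
rewrite mxE /symj /symm /= trmx_delta.
by rewrite (_ : (z.1, _) = z) //; case: z zs {Oz} => a b zs; congr (_, _); exact: symm_id.
Qed.

Lemma derive_inM z M : jets z -> symmx z.2 ->
  'D_(inM M) (F \o symj) z = \sum_i \sum_j M i j * dF_dM F z i j.
Proof.
move=> Oz zs.
have mor : {morph inM : x y / x + y} by move=> x y; rewrite /inM -[RHS]/(0 + 0, 0 + 0, 0 + 0, x + y) !addr0.
have inM0 : inM 0 = 0 by [].
rewrite pair_big /= {1}(matrix_sum_delta M) pair_big /= (big_morph inM mor inM0).
under eq_bigr => ij _.
  have -> : inM (M ij.1 ij.2 *: delta_mx ij.1 ij.2) = M ij.1 ij.2 *: inM (delta_mx ij.1 ij.2).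
    by rewrite /inM -[RHS]/(_ *: 0, _ *: 0, _ *: 0, _) !scaler0.
  over.
rewrite (derive_sum_dir open_jets _ _ _ Cm_symj Oz).
by apply: eq_bigr => -[i j] _; rewrite dF_dME.
Qed.

Lemma derive_inP z p : jets z ->
  'D_(inP p) (F \o symj) z = \sum_i p 0 i * 'D_(inP (delta_mx 0 i)) (F \o symj) z.
Proof.
move=> Oz.
have mor : {morph inP : x y / x + y} by move=> x y; rewrite /inP -[RHS]/(0 + 0, 0 + 0, x + y, 0 + 0) !addr0.
have inP0 : inP 0 = 0 by [].
rewrite {1}(row_sum_delta p) (big_morph inP mor inP0).
under eq_bigr => i _.
  have -> : inP (p 0 i *: delta_mx 0 i) = p 0 i *: inP (delta_mx 0 i).
    by rewrite /inP -[RHS]/(_ *: 0, _ *: 0, _, _ *: 0) !scaler0.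
  over.
exact: (derive_sum_dir open_jets _ _ _ Cm_symj Oz).
Qed.

Lemma derive_jet z (s : R) p M : jets z -> symmx z.2 ->
  'D_((0, s, p, M) : jet R n) (F \o symj) z = s * 'D_(inS 1) (F \o symj) z +
    \sum_i p 0 i * 'D_(inP (delta_mx 0 i)) (F \o symj) z +
    \sum_i \sum_j M i j * dF_dM F z i j.
Proof.
move=> Oz zs.
have -> : ((0, s, p, M) : jet R n) = s *: inS 1 + inP p + inM M.
  rewrite -[RHS]/(s *: 0 + 0 + 0, s * 1 + 0 + 0, s *: 0 + p + 0, s *: 0 + 0 + M).
  by rewrite !scaler0 !addr0 !add0r mulr1.
rewrite !(deriveD_dir open_jets _ _ Cm_symj Oz) (derive_scale _ _ Cm_symj Oz).
by rewrite derive_inP // derive_inM.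
Qed.

Hypothesis F_elliptic : forall (x : 'rV[R]_n) (s : R) (p : 'rV[R]_n) (M : 'M[R]_n),
  Omega x -> symmx M -> posdefmx (- dF_dM F (x, s, p, M)).

Lemma dF_dM_sym z : (dF_dM F z)^T = dF_dM F z.
Proof. by apply/matrixP => i j; rewrite !mxE addrC. Qed.

(** By the mean value theorem: along [M + t *: N] the derivative of [F] is minus the trace of a
    product of two positive semidefinite matrices. *)
Lemma operator_decr x (s : R) p M N : Omega x -> symmx M -> symmx N ->
  (forall w, 0 <= qform N w) -> F (x, s, p, M + N) <= F (x, s, p, M).
Proof.
move=> Ox Ms Ns N0.
have sMt (t : R) : symmx (M + t *: N) by rewrite /symmx /= linearD linearZ /= Ms Ns.
have FE (K : 'M[R]_n) : symmx K -> F (x, s, p, K) = (F \o symj) (x, s, p, K).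
  by move=> Ks; rewrite /= /symj /= symm_id.
have lineE (t : R) : ((x, s, p, M) : jet R n) + t *: inM N = (x, s, p, M + t *: N).
  rewrite -[LHS]/(x + t *: 0, s + t *: 0, p + t *: 0, M + t *: N).
  by rewrite !scaler0 !addr0.
have J (t : R) : jets (((x, s, p, M) : jet R n) + t *: inM N) by rewrite lineE.
have [t t01] := @mvt_line R _ (F \o symj) (x, s, p, M) (inM N)
  (fun t _ => Cm_derivable Cm_symj (J t)).
have := lineE 1; rewrite !scale1r => ->.
rewrite lineE -!FE //; last by have := sMt 1; rewrite scale1r.
rewrite (@derive_inM (x, s, p, M + t *: N) N Ox (sMt t)) => E; rewrite -subr_le0 E.
have := @trace_psd_ge0 R n (- dF_dM F (x, s, p, M + t *: N)) N Ns _ N0.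
rewrite -oppr_ge0 -sumrN => H; apply: le_trans (H _) _.
  move=> w; have [->|w0] := eqVneq w 0.
    by rewrite qformE big1 // => i _; rewrite big1 // => j _; rewrite mxE !mul0r.
  by apply: ltW; apply: F_elliptic.
rewrite le_eqVlt; apply/orP; left; apply/eqP; apply: eq_bigr => i _; rewrite -sumrN.
by apply: eq_bigr => j _; rewrite [in LHS]mxE mulNr mulrC.
Qed.

Variable v : 'rV[R]_n -> R.
Hypothesis v_C2 : Cm 2 Omega v.

Definition coercive_at (c : R) z :=
  [/\ forall w, c * dot w w <= qform (- dF_dM F z) w,
      forall i j, `|dF_dM F z i j| <= c^-1,
      `|'D_(inS 1) (F \o symj) z| <= c^-1 &
      forall i, `|'D_(inP (delta_mx 0 i)) (F \o symj) z| <= c^-1].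

(** The same [c] is the radius, the size of the perturbation and the ellipticity bound, so that
    compactness of [E] provides one value. The perturbations [s], [p], [N] leave room for the
    intermediate jets produced by the mean value theorem. *)
Definition uniform_at (c : R) e := forall x, enorm (x - e) < c -> Omega x /\
  forall (s : R) p N, `|s| <= c -> `|p| <= c -> `|N| <= c -> symmx N ->
    coercive_at c (x, v x + s, grad v x + p, hess v x + N).

Lemma uniform_near e0 : Omega e0 ->
  \forall e \near e0 & c \near (0 : R)^'+, uniform_at c e.
Proof.
move=> Oe0.
pose z0 : jet R n := (e0, v e0, grad v e0, hess v e0).
have Oz0 : jets z0 by [].
have z0s : symmx z0.2 by exact: hess_sym oO v_C2 Oe0.
have [|la la0 lap] := posdef_coercive (A := - dF_dM F z0) (_ : _) (F_elliptic _ _ Oe0 z0s).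
  by rewrite linearN /= dF_dM_sym.
(* An entrywise error [eta] changes the quadratic form by at most n^2 eta, hence by at most
   [la / 2], and half of the coercivity survives. *)
pose eta := la / 2 / (n%:R * n%:R + 1).
have nn : 0 < n%:R * n%:R + 1 :> R by rewrite ltr_wpDl.
have eta0 : 0 < eta by rewrite !divr_gt0.
have nc d : \forall z \near z0, `|'D_d (F \o symj) z0 - 'D_d (F \o symj) z| < eta.
  have := Cm_continuous open_jets (Cm_derive d Cm_symj) Oz0.
  by move=> H; exact: near_dist_lt H eta0.
have /nbhs_ballP[r /= r0 rb] : \forall z \near z0, [/\ jets z,
    forall i j, `|'D_(inM (delta_mx i j)) (F \o symj) z0 - 'D_(inM (delta_mx i j)) (F \o symj) z| < eta,
    `|'D_(inS 1) (F \o symj) z0 - 'D_(inS 1) (F \o symj) z| < eta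
  & forall i, `|'D_(inP (delta_mx 0 i)) (F \o symj) z0 - 'D_(inP (delta_mx 0 i)) (F \o symj) z| < eta].
  have N1 := open_nbhs_nbhs (conj open_jets Oz0).
  have N2 : \forall z \near z0, forall ij : 'I_n * 'I_n,
    `|'D_(inM (delta_mx ij.1 ij.2)) (F \o symj) z0 - 'D_(inM (delta_mx ij.1 ij.2)) (F \o symj) z| < eta.
    by apply: near_forall => ij; exact: nc.
  have N3 := nc (inS 1).
  have N4 : \forall z \near z0, forall i : 'I_n,
    `|'D_(inP (delta_mx 0 i)) (F \o symj) z0 - 'D_(inP (delta_mx 0 i)) (F \o symj) z| < eta.
    by apply: near_forall => i; exact: nc.
  near=> z; apply: And4; [exact: (near N1 z) | | exact: (near N3 z) | exact: (near N4 z)].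
  by move=> i j; exact: (near N2 z _ (i, j)).
pose L : R := \sum_i \sum_j `|dF_dM F z0 i j| + `|'D_(inS 1) (F \o symj) z0| +
  \sum_i `|'D_(inP (delta_mx 0 i)) (F \o symj) z0| + eta + 1.
have L0 : 0 < L.
  rewrite ltr_wpDl // !addr_ge0 ?sumr_ge0 // ?(ltW eta0) // => i _; by rewrite sumr_ge0.
have jv : \forall x \near e0, [/\ Omega x, `|v e0 - v x| < r / 2,
    `|grad v e0 - grad v x| < r / 2 & `|hess v e0 - hess v x| < r / 2].
  have r20 : 0 < r / 2 by rewrite divr_gt0.
  have v1 := CmW v_C2.
  have N1 := open_nbhs_nbhs (conj oO Oe0).
  have N2 := near_dist_lt (Cm_continuous oO v1 Oe0) r20.
  have N3 : \forall x \near e0, forall i : 'I_n, `|'D_(delta_mx 0 i) v e0 - 'D_(delta_mx 0 i) v x| < r / 2.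
    apply: near_forall => i.
    exact: (near_dist_lt (Cm_continuous oO (Cm_derive (delta_mx 0 i) v1) Oe0) r20).
  have N4 : \forall x \near e0, forall ij : 'I_n * 'I_n,
     `|'D_(delta_mx 0 ij.1) ('D_(delta_mx 0 ij.2) v) e0 - 'D_(delta_mx 0 ij.1) ('D_(delta_mx 0 ij.2) v) x| < r / 2.
    apply: near_forall => ij.
    exact: (near_dist_lt (Cm_continuous oO
      (Cm_derive (delta_mx 0 ij.1) (Cm_derive (delta_mx 0 ij.2) v_C2)) Oe0) r20).
  near=> x; apply: And4; [exact: (near N1 x) | exact: (near N2 x) | |].
    apply: norm_mx_lt => // i j; rewrite !mxE; exact: (near N3 x).
  apply: norm_mx_lt => // i j; rewrite !mxE; exact: (near N4 x _ (i, j)).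
have /nbhs_ballP[r1 /= r10 r1b] := jv.
have r120 : 0 < r1 / 2 by rewrite divr_gt0.
near=> e c.
have er : ball e0 (r1 / 2) e by near: e; exact: nbhsx_ballx.
have c0 : 0 < c by near: c; exact: nbhs_right_gt.
have er2 : ball e0 (r / 2) e by near: e; apply: nbhsx_ballx; rewrite divr_gt0.
have cr1 : c <= r1 / 2 by near: c; exact: nbhs_right_le.
have cr : c < r / 2 by near: c; apply: nbhs_right_lt; rewrite divr_gt0.
have cr' : c < r by near: c; exact: nbhs_right_lt.
have cla : c <= la / 2 by near: c; apply: nbhs_right_le; rewrite divr_gt0.
have cL : L <= c^-1.
  rewrite -[L]invrK lef_pV2 ?posrE ?invr_gt0 //; near: c; apply: nbhs_right_le.
  by rewrite invr_gt0.
move=> /= x xe.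
have xr : ball e0 r1 x.
  rewrite (splitr r1); apply: ball_triangle er _.
  rewrite -ball_normE /= distrC; apply: le_lt_trans (norm_le_enorm _) _.
  exact: lt_le_trans xe cr1.
have [Ox vx gx hx] := r1b _ xr.
split=> // s p N sc pc Nc Ns.
set z : jet R n := (_, _, _, _).
have zs : symmx z.2.
  by rewrite /symmx /= linearD /= (hess_sym oO v_C2 Ox) Ns.
have zr : ball z0 r z.
  have tri (V : normedModType R) (a b q : V) : `|a - b| < r / 2 -> `|q| <= c -> `|a - (b + q)| < r.
    move=> ab qc; rewrite opprD addrA; apply: le_lt_trans (ler_normB _ _) _.
    by rewrite (splitr r); apply: ltrD => //; exact: le_lt_trans qc cr.
  split; [split; [split|]|] => /=.
  - rewrite (splitr r); apply: ball_triangle er2 _.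
    rewrite -ball_normE /= distrC; apply: le_lt_trans (norm_le_enorm _) _.
    exact: lt_trans xe cr.
  - by rewrite -ball_normE /=; exact: tri.
  - by rewrite -ball_normE /=; exact: tri.
  - by rewrite -ball_normE /=; exact: tri.
have [Oz Q1 Q2 Q3] := rb _ zr.
clearbody z z0.
have close (a b : R) : `|a - b| < eta -> `|a| + eta <= L -> `|b| <= c^-1.
  move=> ab aL; apply: le_trans cL; apply: le_trans aL.
  rewrite -[b](subKr a); apply: le_trans (ler_normB _ _) _.
  by rewrite lerD2l ltW.
split.
- move=> w; have -> : - dF_dM F z = - dF_dM F z0 + (dF_dM F z0 - dF_dM F z).
    by rewrite addKr.
  rewrite qformD.
  have := @qform_le R n (dF_dM F z0 - dF_dM F z) w eta.
  have H i j : `|(dF_dM F z0 - dF_dM F z) i j| <= eta.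
    have sub_entry (A B : 'M[R]_n) : (A - B) i j = A i j - B i j by rewrite !mxE.
    rewrite sub_entry (dF_dME i j Oz0 z0s) (dF_dME i j Oz zs); exact: ltW (Q1 i j).
  move=> /(_ H); rewrite ler_norml => /andP[H1 _].
  have H2 := lap w.
  have H3 : n%:R * n%:R * eta <= la / 2.
    have -> : la / 2 = (n%:R * n%:R + 1) * eta.
      by rewrite /eta mulrCA divff ?mulr1 // lt0r_neq0.
    by rewrite ler_wpM2r ?(ltW eta0) // lerDl.
  have H4 : n%:R * n%:R * eta * dot w w <= la / 2 * dot w w by rewrite ler_wpM2r ?dot_ge0.
  have H5 : c * dot w w <= la / 2 * dot w w by rewrite ler_wpM2r ?dot_ge0.
  lra.
- move=> i j; rewrite (dF_dME i j Oz zs); apply: close (Q1 i j) _.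
  rewrite -(dF_dME i j Oz0 z0s).
  rewrite /L (bigD1 i) //= (bigD1 j) //=.
  set S1 := \sum_(_ | _) _; set S2 := \sum_(_ | _) _; set S3 := \sum_i _.
  have : 0 <= S1 by rewrite sumr_ge0.
  have : 0 <= S2 by rewrite sumr_ge0 // => ? _; rewrite sumr_ge0.
  have : 0 <= S3 by rewrite sumr_ge0.
  have := normr_ge0 ('D_(inS 1) (F \o symj) z0).
  by move: (`|_|) (`|_|) S1 S2 S3 => *; lra.
- apply: close Q2 _; rewrite /L.
  set S1 := \sum_i _; set S3 := \sum_i _.
  have : 0 <= S1 by rewrite sumr_ge0 // => ? _; rewrite sumr_ge0.
  have : 0 <= S3 by rewrite sumr_ge0.
  by move: (`|_|) S1 S3 => *; lra.
- move=> i; apply: close (Q3 i) _; rewrite /L [X in _ + X + eta + 1](bigD1 i) //=.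
  set S1 := \sum_i _; set S3 := \sum_(_ | _) _.
  have ar (A B C S : R) : 0 <= B -> 0 <= S -> 0 <= C ->
    A + eta <= S + B + (A + C) + eta + 1 by move=> *; lra.
  apply: ar; rewrite ?sumr_ge0 // => ? _; exact: sumr_ge0.
Unshelve. all: by end_near. Qed.

(* The comparison at a touching point: hess u is only bounded below there, but
   F is decreasing in the Hessian, so hess u can be replaced by hess v + N. *)
Lemma operator_touching c e x (u : 'rV[R]_n -> R) (s : R) p N :
  uniform_at c e -> enorm (x - e) < c -> `|s| <= c -> `|p| <= c -> `|N| <= c ->
  symmx N -> symmx (hess u x) ->
  u x = v x + s -> grad u x = grad v x + p ->
  (forall w, qform (hess v x) w + qform N w <= qform (hess u x) w) ->
  F (x, v x, grad v x, hess v x) <= F (x, u x, grad u x, hess u x) ->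
  exists a : 'M[R]_n, [/\ forall w, c * dot w w <= qform a w,
     forall i j, `|a i j| <= c^-1 &
     \sum_i \sum_j a i j * N i j <= c^-1 * (`|s| + \sum_i `|p 0 i|)].
Proof.
move=> ue xe sc pc Nc Ns us uE gE Nle FF.
have [Ox cz] := ue x xe.
have vs : symmx (hess v x) := hess_sym oO v_C2 Ox.
have vNs : symmx (hess v x + N) by rewrite /symmx /= linearD /= vs Ns.
have step1 : F (x, v x + s, grad v x + p, hess u x) <= F (x, v x + s, grad v x + p, hess v x + N).
  apply: (@le_trans _ _ (F (x, v x + s, grad v x + p, hess v x + N + (hess u x - (hess v x + N))))).
    rewrite le_eqVlt; apply/orP; left; apply/eqP; congr (F (_, _)).
    have aux (A B : 'M[R]_n) : A = B + (A - B) by rewrite addrC subrK.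
    exact: aux.
  apply: operator_decr => //; first by rewrite /symmx /= linearB /= us vNs.
  by move=> w; rewrite qformD qformN qformD subr_ge0.
rewrite uE gE in FF; have {step1}FF := le_trans FF step1.
pose z : jet R n := (x, v x, grad v x, hess v x).
pose d : jet R n := (0, s, p, N).
have zd (t : R) : z + t *: d = (x, v x + t * s, grad v x + t *: p, hess v x + t *: N).
  by rewrite -[LHS]/(x + t *: 0, v x + t * s, grad v x + t *: p, hess v x + t *: N) scaler0 addr0.
(* The segment joins the jet of [v] to its perturbation by [(s, p, N)], so [uniform_at] controls the
   derivatives of [F] at the intermediate point, where [a] is taken to be [- dF_dM F]. *)
have [t /andP[t0 t1]] := @mvt_line R _ (F \o symj) z d
  (fun t _ => Cm_derivable Cm_symj (eq_ind_r (fun y => jets y) (Ox : jets (_, _, _, _)) (zd t))).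
have FE (s' : R) p' K : symmx K -> F (x, s', p', K) = (F \o symj) (x, s', p', K).
  by move=> Ks; rewrite /= /symj /= symm_id.
rewrite FE // FE // in FF.
have := zd 1; rewrite !scale1r mul1r => -> E.
rewrite -subr_ge0 E zd in FF.
have sc' : `|t * s| <= c by rewrite normrM ger0_norm //; apply: le_trans sc; rewrite ler_piMl.
have pc' : `|t *: p| <= c by rewrite normrZ ger0_norm //; apply: le_trans pc; rewrite ler_piMl.
have Nc' : `|t *: N| <= c by rewrite normrZ ger0_norm //; apply: le_trans Nc; rewrite ler_piMl.
have Ns' : symmx (t *: N) by rewrite /symmx /= linearZ /= Ns.
have [a1 a2 a3 a4] := cz _ _ _ sc' pc' Nc' Ns'.
set z' := (_, _, _, _) in FF a1 a2 a3 a4.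
exists (- dF_dM F z'); split => //; first by move=> i j; rewrite mxE normrN.
have z's : symmx z'.2 by rewrite /symmx /= linearD /= vs Ns'.
have Oz' : jets z' := Ox.
rewrite derive_jet // in FF.
have -> : \sum_i \sum_j (- dF_dM F z') i j * N i j = - \sum_i \sum_j N i j * dF_dM F z' i j.
  rewrite -sumrN; apply: eq_bigr => i _; rewrite -sumrN; apply: eq_bigr => j _.
  by rewrite [in LHS]mxE mulNr mulrC.
have H1 : s * 'D_(inS 1) (F \o symj) z' <= c^-1 * `|s|.
  exact: mulr_le_norm a3.
have H2 : \sum_i p 0 i * 'D_(inP (delta_mx 0 i)) (F \o symj) z' <= c^-1 * \sum_i `|p 0 i|.
  rewrite mulr_sumr; apply: ler_sum => i _.
  exact: mulr_le_norm (a4 i).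
rewrite mulrDr; move: H1 H2 FF.
move: (s * _) (\sum_i p 0 i * _) (\sum_i \sum_j _) => A1 A2 A3.
by move: (c^-1 * `|s|) (c^-1 * _) => B1 B2; lra.
Qed.

End Operator.

(** * The operator inequality at a minimum *)

Section OperatorMin.
Context {R : realType} {n : nat}.
Implicit Types (x y e d nu : 'rV[R]_n) (M N : 'M[R]_n).

Lemma Cm_subset (V W : normedModType R) (A B : set V) m (f : V -> W) :
  open A -> open B -> B `<=` A -> Cm m A f -> Cm m B f.
Proof.
move=> oA oB BA; elim: m f => [|m IH] f fm.
  by split=> //; apply/(within_openP oB) => z Bz; exact: (Cm_continuous oA fm (BA z Bz)).
split; first by apply/(within_openP oB) => z Bz; exact: (Cm_continuous oA fm (BA z Bz)).
move=> d _; split=> [z Bz|]; first exact: (Cm_derivable fm (BA z Bz)).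
by apply: IH; exact: Cm_derive.
Qed.

Lemma enormZ (a : R) x : enorm (a *: x) = `|a| * enorm x.
Proof.
rewrite /enorm dotZl dotZr mulrA -expr2 sqrtrM ?sqr_ge0 // sqrtr_sqr.
by [].
Qed.

Lemma dot_delta x i : dot x (delta_mx 0 i) = x 0 i.
Proof.
rewrite dotE (bigD1 i) //= mxE !eqxx mulr1 big1 ?addr0 // => j ji.
by rewrite mxE (negPf ji) andbF mulr0.
Qed.

Lemma qform_outer x w : qform (x^T *m x) w = dot w x ^+ 2.
Proof.
rewrite qformE dotE expr2 mulr_suml; apply: eq_bigr => i _; rewrite mulr_sumr.
by apply: eq_bigr => j _; rewrite mxE big_ord1 !mxE; ring.
Qed.

Lemma qform_sum (I : Type) (r : seq I) (M : I -> 'M[R]_n) w :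
  qform (\sum_(i <- r) M i) w = \sum_(i <- r) qform (M i) w.
Proof.
apply: (big_morph (fun M => qform M w)) => [A B|]; first exact: qformD.
by rewrite /qform mulmx0 mul0mx mxE.
Qed.

(** The trace inner product of matrices. *)
Definition pairing M N : R := \sum_i \sum_j M i j * N i j.

Lemma pairingD M N N' : pairing M (N + N') = pairing M N + pairing M N'.
Proof.
rewrite /pairing -big_split; apply: eq_bigr => i _ /=; rewrite -big_split.
by apply: eq_bigr => j _ /=; rewrite mxE mulrDr.
Qed.

Lemma pairingZ (a : R) M N : pairing M (a *: N) = a * pairing M N.
Proof.
rewrite /pairing mulr_sumr; apply: eq_bigr => i _; rewrite mulr_sumr.
by apply: eq_bigr => j _; rewrite mxE mulrCA.
Qed.

Lemma pairingN M N : pairing M (- N) = - pairing M N.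
Proof. by rewrite -scaleN1r pairingZ mulN1r. Qed.

Lemma pairing_sum (I : Type) (r : seq I) M (N : I -> 'M[R]_n) :
  pairing M (\sum_(i <- r) N i) = \sum_(i <- r) pairing M (N i).
Proof.
apply: (big_morph (pairing M)) => [A B|]; first exact: pairingD.
by rewrite /pairing big1 // => i _; rewrite big1 // => j _; rewrite mxE mulr0.
Qed.

Lemma pairing1 M : pairing M 1%:M = \tr M.
Proof.
rewrite /pairing /mxtrace; apply: eq_bigr => i _.
rewrite (bigD1 i) //= mxE eqxx mulr1 big1 ?addr0 // => j ji.
by rewrite mxE eq_sym (negPf ji) mulr0.
Qed.

Lemma pairing_outer M x : pairing M (x^T *m x) = qform M x.
Proof.
rewrite qformE /pairing; apply: eq_bigr => i _; apply: eq_bigr => j _.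
by rewrite mxE big_ord1 !mxE mulrC.
Qed.

Section frame.
Variables (k : nat) (t : 'I_k -> 'rV[R]_n).
Hypothesis tf : subframe t.

(** Orthogonal projection onto the complement of the span of the [t i]; for a flat [E] with this
    tangent frame it is half the Hessian of d^2. *)
Definition normal_mx : 'M[R]_n := 1%:M - \sum_i (t i)^T *m t i.

Lemma outer_sum_sym : (\sum_i (t i)^T *m t i)^T = \sum_i (t i)^T *m t i.
Proof.
apply/matrixP => i j; rewrite mxE !summxE; apply: eq_bigr => l _.
by rewrite !mxE !big_ord1 !mxE mulrC.
Qed.

Lemma normal_mx_sym : normal_mx^T = normal_mx.
Proof. by rewrite /normal_mx linearB /= trmx1 outer_sum_sym. Qed.

Lemma qform_normal_mx w : qform normal_mx w = dot w w - \sum_i dot w (t i) ^+ 2.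
Proof.
rewrite /normal_mx qformD qform1 qformN qform_sum; congr (_ - _).
by apply: eq_bigr => i _; rewrite qform_outer.
Qed.

Lemma normal_mx_psd w : 0 <= qform normal_mx w.
Proof.
rewrite qform_normal_mx -(dot_proj_sum tf) {1}(dot_proj_decomp tf) addrAC subrr add0r.
exact: dot_ge0.
Qed.

(** Both [a - c%:M] and the projection are positive semidefinite, so the pairing is at least [c]
    times the trace of the projection, which is at least n - k >= 2. *)
Lemma pairing_normal_mx (a : 'M[R]_n) (c : R) : 0 <= c -> (k.+2 <= n)%N ->
  (forall w, c * dot w w <= qform a w) -> 2 * c <= pairing a normal_mx.
Proof.
move=> c0 kn ac.
have := @trace_psd_ge0 R n (a - c%:M) normal_mx normal_mx_sym _ normal_mx_psd.
rewrite -/(pairing _ _).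
have E : pairing (a - c%:M) normal_mx = pairing a normal_mx - c * pairing 1%:M normal_mx.
  rewrite /pairing mulr_sumr -sumrB; apply: eq_bigr => i _.
  rewrite mulr_sumr -sumrB; apply: eq_bigr => j _; rewrite !mxE.
  by case: (i == j); rewrite /= ?mulr1n ?mulr0n; ring.
rewrite E => H.
have {}H : 0 <= pairing a normal_mx - c * pairing 1%:M normal_mx.
  apply: H => w; rewrite qformD qformN -scalemx1 qformZ qform1 subr_ge0; exact: ac.
have tr1 : 2 <= pairing 1%:M normal_mx.
  rewrite /normal_mx pairingD -scaleN1r pairingZ pairing_sum pairing1 mxtrace1.
  under eq_bigr do rewrite pairing_outer qform1.
  have : \sum_i dot (t i) (t i) <= k%:R.
    apply: le_trans (ler_sum _ (fun i _ => subframe_le1 tf i)) _.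
    by rewrite sumr_const card_ord.
  have : k%:R + 2 <= n%:R :> R by rewrite -natrD addn2 ler_nat.
  lra.
have : c * 2 <= c * pairing 1%:M normal_mx by rewrite ler_wpM2l.
lra.
Qed.

End frame.

Lemma is_derive_affine (p c t : R) :
  is_derive t 1 (fun t : R => 2 * p + 2 * c * t) (2 * c).
Proof.
have -> : (fun t : R => 2 * p + 2 * c * t) = cst (2 * p) + (2 * c) \*: (id : R -> R).
  by apply/funext => z.
by apply: is_derive_eq; rewrite -![_ *: _]/(_ * _) add0r mulr1.
Qed.

Section operator_min.
Variables (Omega : set 'rV[R]_n) (F : jet R n -> R).
Hypotheses (oO : open Omega) (F_C1 : C1_operator Omega F).
Hypothesis F_elliptic : forall (x : 'rV[R]_n) (s : R) (p : 'rV[R]_n) (M : 'M[R]_n),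
  Omega x -> symmx M -> posdefmx (- dF_dM F (x, s, p, M)).
Variables (u v : 'rV[R]_n -> R) (E : set 'rV[R]_n) (k : nat) (C c : R).
Hypotheses (v_C2 : Cm 2 Omega v) (cE : compact E) (C0 : 0 < C) (c0 : 0 < c).
Hypothesis u_C2 : Cm 2 (Omega `\` E) u.
Hypothesis kn : (k.+2 <= n)%N.
Hypothesis F_ge : forall x, (Omega `\` E) x ->
  F (x, v x, grad v x, hess v x) <= F (x, u x, grad u x, hess u x).
Hypothesis tanE : forall e, E e -> exists T : 'M[R]_(k, n), tangent_at E C^-1 e T.
Hypothesis uniE : forall e, E e -> uniform_at Omega F v c e.

Lemma open_OE : open (Omega `\` E).
Proof. rewrite setDE; apply: openI => //; apply: closed_openC.
by apply: compact_closed cE; exact: norm_hausdorff. Qed.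

(** [operator_touching] is applied with the gradient [p] of the touching polynomial and its Hessian
    [N]. Ellipticity turns the part of [N] with factor [al] into a gain of about [4 * al * c]; the
    curvature of [E], the concave quadratic term and the lower-order arguments of [F] make up the
    losses. *)
Lemma operator_min_bound x0 eh nu (al dl B0 : R) :
  (Omega `\` E) x0 -> 0 < dE E x0 -> dE E x0 < c -> 16 * C * dE E x0 <= 1 ->
  0 <= al -> 0 <= dl -> enorm nu <= 1 -> enorm (x0 - eh) <= B0 ->
  0 <= u x0 - v x0 -> u x0 - v x0 <= c ->
  2 * al * dE E x0 + 2 * dl * (1 + 2 * C * B0) <= c ->
  2 * al * (1 + 2 * k%:R) + 4 * dl * C <= c ->
  (\forall x \near x0,
     u x0 - v x0 - (al * dE E x0 ^+ 2 +
       2 * dl * (dot (x0 - eh) nu - C * dot (x0 - eh) (x0 - eh))) <=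
     u x - v x - (al * dE E x ^+ 2 +
       2 * dl * (dot (x - eh) nu - C * dot (x - eh) (x - eh)))) ->
  2 * al * (2 * c - 16 * C * dE E x0 * (k%:R * (n%:R * n%:R * c^-1)))
      - 4 * dl * C * (n%:R * c^-1) <=
  c^-1 * (u x0 - v x0 + n%:R * (2 * al * dE E x0 + 2 * dl * (1 + 2 * C * B0))).
Proof.
move=> Ox0 d0 dc c1 al0 dl0 nu1 xB w0 wc pc Nc um.
have E0 : E !=set0.
  apply/set0P/eqP => EE; move: d0; rewrite /dE EE image_set0 inf0 ltxx //.
have [e xe] := nearest_exists cE E0 x0.
have [t [tf xt tle]] := touching_dE cE C0 tanE xe d0 c1.
set D := dE E x0 in d0 dc c1 pc um tle *.
set g := 16 * C * D in c1 tle *.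
have g0 : 0 <= g by rewrite /g !mulr_ge0 // ltW.
have DE : dot (x0 - e) (x0 - e) = D ^+ 2 by rewrite -sqr_enorm -(dE_nearest xe).
have OOE : Omega `\` E `<=` Omega by move=> x [].
have v2 := Cm_subset oO open_OE OOE v_C2.
set X := x0 - e in xt DE; set Y := x0 - eh in xB um.
(* [2 * P d] and [2 * Q d] are the first and second derivatives at [x0], along [d], of the touching
   polynomial. *)
pose P d := al * dot X d + dl * (dot d nu - 2 * C * dot Y d).
pose Q d := al * (dot d d - (1 + g) * (\sum_i dot d (t i) ^+ 2)) - 2 * dl * C * dot d d.
have test d : 'D_d u x0 = 'D_d v x0 + 2 * P d /\
    qform (hess v x0) d + 2 * Q d <= qform (hess u x0) d.
  pose s0 := al * D ^+ 2 + 2 * dl * (dot Y nu - C * dot Y Y).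
  have [|||H1 H2] := @line_test R n (Omega `\` E) u v x0 d
      (fun z => s0 + 2 * P d * z + Q d * z ^+ 2)
    (fun z => 2 * P d + 2 * Q d * z) (2 * Q d) open_OE u_C2 v2 Ox0.
  - by near=> z; exact: is_derive_quadratic.
  - exact: is_derive_affine.
  - have L1 := line_near d um; have L2 := line_near d tle.
    near=> z.
    have H1 := near L1 z.
    have H2 : dot (x0 + z *: d - e) (x0 + z *: d - e) -
       (1 + g) * (\sum_i dot (x0 + z *: d - e) (t i) ^+ 2) <= dE E (x0 + z *: d) ^+ 2.
      exact: (near L2 z).
    rewrite expr0n /= !mulr0 !addr0; apply: le_trans (H1 _) _; first by [].
    rewrite lerD2l lerN2.
    rewrite touching_line // -/X DE in H2.
    have yE : x0 + z *: d - eh = Y + z *: d by rewrite addrAC.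
    have H3 := ler_wpM2l al0 H2.
    have eY1 (y : 'rV[R]_n) : dot (y + z *: d) nu = dot y nu + z * dot d nu.
      by rewrite dotDl dotZl.
    have eY2 (y : 'rV[R]_n) : dot (y + z *: d) (y + z *: d) =
        dot y y + 2 * z * dot y d + z ^+ 2 * dot d d.
      by rewrite !(dotDl, dotDr, dotZl, dotZr) [dot d y]dotC; ring.
    rewrite yE eY1 eY2 /s0 /P /Q.
    set S := \sum_i _ in H3 *.
    move: H3; move: S (dE _ _) (dot d d) (dot X d) (dot Y d) (dot d nu) (dot Y nu) (dot Y Y).
    by move=> a1 a2 a3 a4 a5 a6 a7 a8 H3; lra.
  - by move: H1; rewrite mulr0 addr0.
have XD : enorm X = D by rewrite /X -(dE_nearest xe).
clearbody X Y.
have oOE := open_OE.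
have [u1 v1] := (CmW u_C2, CmW v2).
pose p : 'rV[R]_n := (2 * al) *: X + (2 * dl) *: (nu - (2 * C) *: Y).
have pE d : dot d p = 2 * P d.
  rewrite /p !(dotDl, dotDr, dotNl, dotNr, dotZl, dotZr) /P [dot d X]dotC [dot d Y]dotC; ring.
have gE : grad u x0 = grad v x0 + p.
  apply/rowP => i; have [T1 _] := test (delta_mx 0 i).
  have ai (a b : 'rV[R]_n) : (a + b) 0 i = a 0 i + b 0 i by rewrite mxE.
  have gi (f : 'rV[R]_n -> R) : grad f x0 0 i = 'D_(delta_mx 0 i) f x0 by rewrite mxE.
  by rewrite ai !gi T1 -pE dotC dot_delta.
(* The symmetric matrix of the form [2 * Q], with the tangential error [g] split off from the normal
   projection. *)
pose N : 'M[R]_n := (2 * al) *: (normal_mx t - g *: \sum_i (t i)^T *m t i) - (4 * dl * C) *: 1%:M.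
have NE w : qform N w = 2 * Q w.
  rewrite /N qformD qformN !qformZ qformD qformN qformZ qform1 qform_normal_mx qform_sum.
  have -> : \sum_i qform ((t i)^T *m t i) w = \sum_i dot w (t i) ^+ 2.
    by apply: eq_bigr => i _; exact: qform_outer.
  rewrite /Q; ring.
have D0 : 0 <= D := ltW d0.
have B00 : 0 <= B0 := le_trans (enorm_ge0 _) xB.
have pn : enorm p <= 2 * al * D + 2 * dl * (1 + 2 * C * B0).
  apply: le_trans (enorm_triangle _ _) _; rewrite !enormZ.
  rewrite XD !ger0_norm ?mulr_ge0 //; rewrite lerD2l ler_wpM2l ?mulr_ge0 //.
  apply: le_trans (enorm_triangle _ _) _; rewrite enormN enormZ lerD //.
  by rewrite ger0_norm ?mulr_ge0 ?(ltW C0) // ler_wpM2l ?mulr_ge0 // ltW.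
have Ns : symmx N.
  have symc (A B Z : 'M[R]_n) (a1 a2 a3 : R) : A^T = A -> B^T = B -> Z^T = Z ->
      (a1 *: (A - a2 *: B) - a3 *: Z)^T = a1 *: (A - a2 *: B) - a3 *: Z.
    by move=> As Bs Zs; apply/matrixP => i j; rewrite -{2}As -{2}Bs -{2}Zs !mxE.
  by apply: symc; [exact: normal_mx_sym | exact: outer_sum_sym | exact: trmx1].
have tt i a b : `|((t i)^T *m t i) a b| <= 1.
  rewrite mxE big_ord1 mxE normrM.
  have t1 j : `|t i 0 j| <= 1.
    apply: le_trans (coord_le_enorm _ _) _.
    by rewrite -(@ler_pXn2r _ 2) ?nnegrE ?enorm_ge0 // sqr_enorm expr1n subframe_le1.
  by rewrite -[1]mulr1 ler_pM.
have St a b : `|(\sum_i (t i)^T *m t i) a b| <= k%:R.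
  rewrite summxE; apply: le_trans (ler_norm_sum _ _ _) _.
  apply: le_trans (ler_sum _ (fun i _ => tt i a b)) _.
  by rewrite sumr_const card_ord.
have Nn : `|N| <= c.
  rewrite [leLHS]/Num.Def.normr/= mx_normrE; apply: bigmax_le; first exact: ltW.
  move=> -[a b] _ /=; apply: le_trans Nc.
  have := St a b; rewrite /N /normal_mx; set S := \sum_i _ => Sab.
  have -> : ((2 * al) *: (1%:M - S - g *: S) - (4 * dl * C) *: 1%:M : 'M[R]_n) a b =
     2 * al * ((a == b)%:R - (1 + g) * S a b) - 4 * dl * C * (a == b)%:R.
    by rewrite !mxE; ring.
  have [b0 b1] : 0 <= (a == b)%:R :> R /\ (a == b)%:R <= 1 :> R by case: (a == b).
  move: ((a == b)%:R : R) b0 b1 => be be0 be1.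
  have T1 : `|be - (1 + g) * S a b| <= 1 + 2 * k%:R.
    apply: le_trans (ler_normB _ _) _; rewrite ger0_norm // lerD //.
    have g1 : 0 <= 1 + g by lra.
    rewrite normrM ger0_norm //; apply: ler_pM => //; lra.
  have dC : 0 <= 4 * dl * C by rewrite !mulr_ge0 // ltW.
  have al2 : 0 <= 2 * al by rewrite mulr_ge0.
  apply: le_trans (ler_normB _ _) _; rewrite normrM (ger0_norm al2).
  rewrite (ger0_norm (mulr_ge0 dC be0)) lerD //; first by rewrite ler_wpM2l.
  by rewrite ler_piMr.
have us := hess_sym oOE u_C2 Ox0.
have uE : u x0 = v x0 + (u x0 - v x0) by rewrite addrC subrK.
have [||||a [a1 a2 a3]] := @operator_touching R n Omega F oO F_C1 F_elliptic v v_C2 c e x0 u (u x0 - v x0) p N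
  (uniE xe.1) _ _ _ Nn Ns us uE gE _ (F_ge Ox0).
- by rewrite -(dE_nearest xe).
- by rewrite ger0_norm.
- exact: le_trans (norm_le_enorm _) (le_trans pn pc).
- by move=> w; rewrite NE; exact: (test w).2.
have aN : pairing a N = 2 * al * (pairing a (normal_mx t) -
    g * (\sum_i pairing a ((t i)^T *m t i))) - 4 * dl * C * \tr a.
  by rewrite /N pairingD pairingN !pairingZ pairing1 pairingD pairingN pairingZ pairing_sum.
move: a3; rewrite -/(pairing a N) aN (ger0_norm w0).
have A1 := pairing_normal_mx tf (ltW c0) kn a1.
have ci : 0 <= c^-1 by rewrite invr_ge0 ltW.
have A2 : \sum_i pairing a ((t i)^T *m t i) <= k%:R * (n%:R * n%:R * c^-1).
  apply: (@le_trans _ _ (\sum_(i < k) n%:R * n%:R * c^-1)).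
    apply: ler_sum => i _; rewrite pairing_outer.
    apply: le_trans (ler_norm _) (le_trans (qform_le _ a2) _).
    by rewrite ler_piMr ?subframe_le1 // !mulr_ge0.
  by rewrite sumr_const card_ord -[(_ * c^-1) *+ k]mulr_natl.
have A3 : \tr a <= n%:R * c^-1.
  rewrite /mxtrace; apply: le_trans (ler_sum _ (fun i _ => le_trans (ler_norm _) (a2 i i))) _.
  by rewrite sumr_const card_ord -[c^-1 *+ n]mulr_natl.
have A4 : \sum_i `|p 0 i| <= n%:R * (2 * al * D + 2 * dl * (1 + 2 * C * B0)).
  apply: le_trans (ler_sum _ (fun i _ => le_trans (coord_le_enorm p i) pn)) _.
  by rewrite sumr_const card_ord -[_ *+ n]mulr_natl.
move=> H.
have B1 : g * (\sum_i pairing a ((t i)^T *m t i)) <= g * (k%:R * (n%:R * n%:R * c^-1)) by rewrite ler_wpM2l.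
have B2 : 2 * al * (2 * c - g * (k%:R * (n%:R * n%:R * c^-1))) <=
    2 * al * (pairing a (normal_mx t) - g * (\sum_i pairing a ((t i)^T *m t i))).
  rewrite ler_wpM2l ?mulr_ge0 //; lra.
have B3 : 4 * dl * C * \tr a <= 4 * dl * C * (n%:R * c^-1).
  by rewrite ler_wpM2l // !mulr_ge0 // ltW.
apply: le_trans (le_trans H _).
  lra.
by rewrite ler_wpM2l // lerD2l.
Unshelve. all: by end_near. Qed.

End operator_min.
End OperatorMin.

Section ContinuousAt.
Context {R : realType} {V : normedModType R}.
Implicit Types (f g : V -> R) (x : V).

Lemma near_lt f x (b : R) : {for x, continuous f} -> f x < b -> \forall y \near x, f y < b.
Proof. by move=> fc; exact: (cvgr_lt _ fc). Qed.

Lemma near_gt f x (b : R) : {for x, continuous f} -> b < f x -> \forall y \near x, b < f y.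
Proof. by move=> fc; exact: (cvgr_gt _ fc). Qed.

Lemma continuous_atB f g x : {for x, continuous f} -> {for x, continuous g} ->
  {for x, continuous (fun y => f y - g y)}.
Proof. exact: cvgB. Qed.

Lemma continuous_atD f g x : {for x, continuous f} -> {for x, continuous g} ->
  {for x, continuous (fun y => f y + g y)}.
Proof. exact: cvgD. Qed.

Lemma continuous_atM f g x : {for x, continuous f} -> {for x, continuous g} ->
  {for x, continuous (fun y => f y * g y)}.
Proof. exact: cvgM. Qed.

Lemma continuous_atZ f (a : R) x : {for x, continuous f} ->
  {for x, continuous (fun y => a * f y)}.
Proof. by move=> fc; apply: cvgM fc; exact: cvg_cst. Qed.

Lemma continuous_at_cst (a : R) x : {for x, continuous (fun _ : V => a)}.
Proof. exact: cvg_cst. Qed.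

End ContinuousAt.

(** * The lower bound near E *)

Section Assembly.
Context {R : realType} {n : nat}.
Implicit Types (x y e nu : 'rV[R]_n).

(** The smallness conditions on the parameters are linear, so finitely many of them are met at once
    by intersecting such neighbourhoods. *)
Lemma near0_le (a b : R) : 0 < b -> \forall s \near (0 : R)^'+, a * s <= b.
Proof.
move=> b0; have a0 : 0 < `|a| + 1 by rewrite ltr_wpDl.
near=> s.
have s0 : 0 < s by near: s; exact: nbhs_right_gt.
have sb : s <= b / (`|a| + 1) by near: s; apply: nbhs_right_le; rewrite divr_gt0.
rewrite ler_pdivlMr // in sb; apply: le_trans sb; rewrite mulrC ler_pM2l //.
by apply: le_trans (ler_norm _) _; rewrite lerDl.
Unshelve. all: by end_near. Qed.

Lemma hess_lower_near (Omega : set 'rV[R]_n) (v : 'rV[R]_n -> R) e0 :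
  open Omega -> Cm 2 Omega v -> Omega e0 ->
  \forall e \near e0 & c \near (0 : R)^'+, forall x, enorm (x - e) < c ->
    forall w, - c^-1 * dot w w <= qform (hess v x) w.
Proof.
move=> oO v2 Oe0.
pose L : R := \sum_i \sum_j `|hess v e0 i j| + 1.
have hL i j : `|hess v e0 i j| + 1 <= L.
  rewrite /L lerD2r (bigD1 i) //= (bigD1 j) //= -addrA lerDl.
  by rewrite addr_ge0 ?sumr_ge0 // => ? _; rewrite sumr_ge0.
have L0 : 0 < L by rewrite ltr_wpDl // sumr_ge0 // => ? _; rewrite sumr_ge0.
have /nbhs_ballP[r /= r0 rb] : \forall x \near e0, forall ij : 'I_n * 'I_n, `|hess v x ij.1 ij.2| <= L.
  apply: near_forall => ij.
  have := near_dist_lt (Cm_continuous oO (Cm_derive (delta_mx 0 ij.1)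
    (Cm_derive (delta_mx 0 ij.2) v2)) Oe0) ltr01.
  have hE z : hess v z ij.1 ij.2 = 'D_(delta_mx 0 ij.1) ('D_(delta_mx 0 ij.2) v) z by rewrite mxE.
  have aux (p q : R) : `|p - q| < 1 -> `|q| <= `|p| + 1.
    move=> H; rewrite -[q](subKr p); apply: le_trans (ler_normB _ _) _.
    by rewrite lerD2l ltW.
  apply: filterS => x; rewrite -!hE => /aux H.
  exact: le_trans H (hL ij.1 ij.2).
have K0 : 0 < n%:R * n%:R * L + 1 by rewrite ltr_wpDl // !mulr_ge0 // ltW.
near=> e c; move=> /= x xe w.
have er : ball e0 (r / 2) e by near: e; apply: nbhsx_ballx; rewrite divr_gt0.
have c0 : 0 < c by near: c; exact: nbhs_right_gt.
have cr : c <= r / 2 by near: c; apply: nbhs_right_le; rewrite divr_gt0.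
have cK : n%:R * n%:R * L + 1 <= c^-1.
  rewrite -[leLHS]invrK lef_pV2 ?posrE ?invr_gt0 //; near: c; apply: nbhs_right_le.
  by rewrite invr_gt0.
have xr : ball e0 r x.
  rewrite (splitr r); apply: ball_triangle er _.
  rewrite -ball_normE /= distrC; apply: le_lt_trans (norm_le_enorm _) _.
  exact: lt_le_trans xe cr.
have := @qform_le R n (hess v x) w L (fun i j => rb x xr (i, j)).
rewrite ler_norml => /andP[H _]; apply: le_trans H; rewrite mulNr lerN2.
rewrite ler_wpM2r ?dot_ge0 //; apply: le_trans cK; by rewrite lerDl.
Unshelve. all: by end_near. Qed.

Lemma barrier_continuous (al be ga s : R) : 0 < s -> {for s, continuous (barrier al be ga)}.
Proof.
move=> s0; apply: differentiable_continuous; apply/derivable1_diffP.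
by have [] := @is_derive_barrier R al be ga id s 1 s0 (is_derive_id _ _).
Qed.

(** * Compact bands around E and tilts *)

Section band.
Variable E : set 'rV[R]_n.
Hypotheses (cE : compact E) (E0 : E !=set0).

Lemma band_min (f : 'rV[R]_n -> R) (a b : R) y :
  (forall x, a <= dE E x <= b -> {for x, continuous f}) -> a <= dE E y <= b ->
  exists2 x, a <= dE E x <= b & forall z, a <= dE E z <= b -> f x <= f z.
Proof.
move=> fc yab.
have [||x xab xm] := @EVT_min_rV R n f [set x | a <= dE E x <= b] _ (@dE_band_compact _ _ E cE E0 a b).
- by exists y.
- by apply: continuous_in_subspaceT => z; rewrite inE; exact: fc.
- by rewrite inE in xab; exists x => // z zab; apply: xm; rewrite inE.
Qed.

Lemma dE_between_near x (a b : R) : a < dE E x -> dE E x < b ->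
  \forall y \near x, a < dE E y /\ dE E y < b.
Proof.
move=> xa xb; have dc := dE_continuous cE E0.
exact: filterI (near_gt (dc x) xa) (near_lt (dc x) xb).
Qed.

Lemma dE_bounded : exists2 B : R, 0 <= B & forall x e, dE E x <= 1 -> E e -> enorm (x - e) <= B.
Proof.
have [M [Mr EM]] := compact_bounded cE.
have EB e : E e -> `|e| <= `|M| + 1.
  by move=> Ee; apply: EM => //; apply: le_lt_trans (ler_norm _) _; rewrite ltrDl.
exists (1 + n%:R * (2 * (`|M| + 1))); first by rewrite !addr_ge0 ?mulr_ge0 ?addr_ge0.
move=> x e x1 Ee; have [e' xe'] := nearest_exists cE E0 x.
have -> : x - e = (x - e') + (e' - e) by rewrite addrA subrK.
apply: le_trans (enorm_triangle _ _) _; rewrite lerD -?(dE_nearest xe') //.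
apply: le_trans (enorm_le_norm _) _; rewrite ler_wpM2l //.
apply: le_trans (ler_normB _ _) _.
have := EB _ Ee; have := EB _ xe'.1; lra.
Qed.

(** For unit [nu] and [C > 0] it is positive exactly in the open ball of radius 1/(2C) centred at eh
    + nu/(2C), whose boundary passes through [eh]. The curvature bound keeps [E] out of this ball
    when [nu] is normal to [E] at [eh]. *)
Definition tilt (eh nu : 'rV[R]_n) (C : R) x := dot (x - eh) nu - C * dot (x - eh) (x - eh).

Lemma enorm_sub_continuous e : continuous (fun x => enorm (x - e)).
Proof.
apply: enorm_lipschitz_continuous => x y; rewrite ler_norml; apply/andP; split.
  have := enorm_triangle (y - x) (x - e); rewrite subrKA enormB; lra.
have := enorm_triangle (x - y) (y - e); rewrite subrKA; lra.
Qed.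

Lemma tilt_continuous eh nu (C : R) x : enorm nu <= 1 -> {for x, continuous (tilt eh nu C)}.
Proof.
move=> nu1.
have C1 : {for x, continuous (fun x => dot (x - eh) nu)}.
  apply: enorm_lipschitz_continuous => y z.
  have -> : dot (y - eh) nu - dot (z - eh) nu = dot (y - z) nu.
    by rewrite !(dotDl, dotNl); ring.
  apply: le_trans (dot_le_enorm _ _) _.
  by rewrite ler_piMr ?enorm_ge0.
have C2 : {for x, continuous (fun y => enorm (y - eh))} by exact: enorm_sub_continuous.
have -> : tilt eh nu C = (fun y => dot (y - eh) nu - C * (enorm (y - eh) * enorm (y - eh))).
  by apply/funext => y; rewrite /tilt -expr2 sqr_enorm.
exact: continuous_atB C1 (continuous_atZ (continuous_atM C2 C2)).
Qed.

Lemma tilt_le (eh nu : 'rV[R]_n) (C B : R) x : 0 <= C -> enorm nu <= 1 -> enorm (x - eh) <= B ->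
  tilt eh nu C x <= B.
Proof.
move=> C0 nu1 xB; rewrite /tilt.
have := le_trans (ler_norm _) (dot_le_enorm (x - eh) nu).
have : enorm (x - eh) * enorm nu <= enorm (x - eh) by rewrite ler_piMr ?enorm_ge0.
have : 0 <= C * dot (x - eh) (x - eh) by rewrite mulr_ge0 ?dot_ge0.
lra.
Qed.

(* On E the tilt is nonpositive, since nu is normal to E at eh; hence it is
   small near E. *)
Lemma tilt_le_dE (eh nu : 'rV[R]_n) (C B : R) x :
  0 <= C -> 0 <= B -> enorm nu <= 1 ->
  (forall e, E e -> dot (e - eh) nu <= C * dot (e - eh) (e - eh)) ->
  (forall e, E e -> enorm (e - eh) <= B) -> enorm (x - eh) <= B ->
  tilt eh nu C x <= (1 + 2 * C * B) * dE E x.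
Proof.
move=> C0 B0 nu1 Enu EB xB; have [e xe] := nearest_exists cE E0 x.
rewrite (dE_nearest xe) /tilt.
have D1 : dot (x - eh) nu = dot (x - e) nu + dot (e - eh) nu.
  by rewrite -dotDl addrA subrK.
have D2 : dot (x - e) nu <= enorm (x - e).
  apply: le_trans (ler_norm _) (le_trans (dot_le_enorm _ _) _).
  by rewrite ler_piMr ?enorm_ge0.
have D3 := Enu e xe.1; have D4 := EB e xe.1.
have D5 : enorm (e - eh) <= enorm (x - e) + enorm (x - eh).
  have := enorm_triangle (e - x) (x - eh); rewrite subrKA [enorm (e - x)]enormB; lra.
have d0 := enorm_ge0 (x - e).
have D6 : dot (e - eh) (e - eh) - dot (x - eh) (x - eh) <= 2 * B * enorm (x - e).
  rewrite -!sqr_enorm subr_sqr.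
  have s0 : 0 <= enorm (e - eh) + enorm (x - eh) by rewrite addr_ge0 ?enorm_ge0.
  apply: (@le_trans _ _ (enorm (x - e) * (enorm (e - eh) + enorm (x - eh)))).
    rewrite ler_wpM2r //; lra.
  rewrite mulrC ler_wpM2r //; lra.
have D7 := ler_wpM2l C0 D6.
rewrite mulrDl mul1r; move: D1 D2 D3 D7; lra.
Qed.

End band.

(** * Choice of parameters and contradiction *)

Section core.
Variables (Omega : set 'rV[R]_n) (F : jet R n -> R).
Hypotheses (oO : open Omega) (F_C1 : C1_operator Omega F).
Hypothesis F_elliptic : forall (x : 'rV[R]_n) (s : R) (p : 'rV[R]_n) (M : 'M[R]_n),
  Omega x -> symmx M -> posdefmx (- dF_dM F (x, s, p, M)).
Variables (u v : 'rV[R]_n -> R) (E : set 'rV[R]_n) (k : nat).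
Hypotheses (v_C2 : Cm 2 Omega v) (cE : compact E) (E0 : E !=set0).
Hypothesis u_C2 : Cm 2 (Omega `\` E) u.
Hypothesis kn : (k.+2 <= n)%N.
Hypothesis u_eig : forall x, (Omega `\` E) x -> \sum_(i < k.+2) lambda i (hess u x) <= 0.
Hypothesis u_gt_v : forall x, (Omega `\` E) x -> v x < u x.
Hypothesis F_ge : forall x, (Omega `\` E) x ->
  F (x, v x, grad v x, hess v x) <= F (x, u x, grad u x, hess u x).

Let w x := u x - v x.

Section constants.
Variables (C c B eta : R).
Hypotheses (C0 : 0 < C) (c0 : 0 < c) (B0 : 0 <= B) (eta0 : 0 < eta).
Hypothesis tanE : forall e, E e -> exists T : 'M[R]_(k, n), tangent_at E C^-1 e T.
Hypothesis uniE : forall e, E e -> uniform_at Omega F v c e.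
Hypothesis hessE : forall e, E e -> forall x, enorm (x - e) < c ->
  forall w, - c^-1 * dot w w <= qform (hess v x) w.
Hypothesis EB : forall x e, dE E x <= 1 -> E e -> enorm (x - e) <= B.
Hypothesis etaO : forall x, dE E x <= eta -> Omega x.

(** With this value the gain [2 * (eps * A) * c] from ellipticity equals [c^-1 * (4 * eps)]. In
    [no_tilted_min] the losses are [c^-1] times at most [2 * eps] from the size of [w], [eps] from
    the gradient of eps A d^2, and less than [eps] from the tilt. *)
Let A := 2 * c^-1 ^+ 2.

Hypotheses (eta_c : eta < c) (eta_1 : eta <= 1) (eta_C : 16 * C * eta <= 1).
Hypothesis eta_k : 16 * C * (k%:R * (n%:R * n%:R * c^-1)) * eta <= c.
Hypothesis eta_A : 2 * n%:R * A * eta <= 1.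

Lemma in_OE x : 0 < dE E x -> dE E x <= eta -> (Omega `\` E) x.
Proof.
move=> x0 xe; split; first exact: etaO.
by move/(dE_eq0 cE E0) => xE; rewrite xE ltxx in x0.
Qed.

Lemma w_continuous x : 0 < dE E x -> dE E x <= eta -> {for x, continuous w}.
Proof.
move=> x0 xe; have Ox := in_OE x0 xe.
have uc := Cm_continuous (open_OE oO cE) u_C2 Ox.
have vc := Cm_continuous oO v_C2 Ox.1.
exact: continuous_atB uc vc.
Qed.

Lemma n_gt0 : 1 <= n%:R :> R.
Proof. by rewrite ler1n; apply: leq_trans kn. Qed.

Lemma A_ge0 : 0 <= A.
Proof. by rewrite /A mulr_ge0 ?exprn_ge0 ?invr_ge0 // ltW. Qed.

Lemma A_eta x : 0 <= dE E x -> dE E x <= eta -> 2 * A * dE E x <= 1 /\ A * dE E x ^+ 2 <= 1.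
Proof.
move=> x0 xe.
have Ax : 0 <= A * dE E x by rewrite mulr_ge0 ?A_ge0.
have H : 2 * A * dE E x <= 1.
  have Ae : A * dE E x <= A * eta by rewrite ler_wpM2l ?A_ge0.
  have nA : A * eta <= n%:R * (A * eta) by rewrite ler_peMl ?n_gt0 // mulr_ge0 ?A_ge0 // ltW.
  have := eta_A; rewrite (_ : 2 * n%:R * A * eta = 2 * (n%:R * (A * eta))); last by ring.
  lra.
split=> //; rewrite expr2 mulrA.
have : A * dE E x * dE E x <= A * dE E x * 1 by rewrite ler_wpM2l // (le_trans xe).
lra.
Qed.

(** The losses due to the tilt per unit of [dl], through the bound on [w], the gradient and the
    Hessian respectively. *)
Let M := 2 * B + 2 * n%:R * (1 + 2 * C * B) + 4 * C * n%:R.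

(** Here the gain announced at [A] outweighs the losses. The value [dl = 0] is allowed and covers
    minima without a tilt. *)
Lemma no_tilted_min eps dl x0 eh nu :
  0 < eps -> 0 <= dl -> dl * M < eps -> 4 * eps <= c ->
  dl * (2 * B) <= c / 2 -> dl * (2 * (1 + 2 * C * B)) <= c / 2 ->
  2 * (eps * A) * (1 + 2 * k%:R) <= c / 2 -> dl * (4 * C) <= c / 2 ->
  E eh -> enorm nu <= 1 -> 0 < dE E x0 -> dE E x0 < eta ->
  w x0 <= eps * (1 + A * dE E x0 ^+ 2) + 2 * dl * B ->
  (\forall x \near x0,
    w x0 - (eps * A * dE E x0 ^+ 2 + 2 * dl * tilt eh nu C x0) <=
    w x - (eps * A * dE E x ^+ 2 + 2 * dl * tilt eh nu C x)) -> False.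
Proof.
move=> eps0 dl0 dM e4 d1 d2 e5 d4 Eeh nu1 x00 x0e wle wmin.
have Ox := in_OE x00 (ltW x0e).
have [AD1 AD2] := A_eta (ltW x00) (ltW x0e).
have w0 : 0 <= w x0 by rewrite /w subr_ge0 ltW // u_gt_v.
have eA : eps * (A * dE E x0 ^+ 2) <= eps by rewrite -[leRHS]mulr1 ler_wpM2l // ltW.
have eA1 : eps * (2 * A * dE E x0) <= eps by rewrite -[leRHS]mulr1 ler_wpM2l // ltW.
have xB : enorm (x0 - eh) <= B by apply: EB => //; apply: le_trans eta_1; exact: ltW.
have := @operator_min_bound R n Omega F oO F_C1 F_elliptic u v E k C c v_C2 cE C0 c0 u_C2 kn
  F_ge tanE uniE x0 eh nu (eps * A) dl B Ox x00 (lt_trans x0e eta_c) _ _ dl0 nu1 xB w0.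
set D := dE E x0 in x00 x0e wle wmin AD1 AD2 eA eA1 *.
have C1 : 16 * C * D <= 1.
  by apply: le_trans eta_C; rewrite ler_wpM2l ?mulr_ge0 ?(ltW C0) // ltW.
have al0 : 0 <= eps * A by rewrite mulr_ge0 ?A_ge0 // ltW.
have p1 : w x0 <= c by move: wle; rewrite mulrDr mulr1 => wle; lra.
have p2 : 2 * (eps * A) * D + 2 * dl * (1 + 2 * C * B) <= c by lra.
have p3 : 2 * (eps * A) * (1 + 2 * k%:R) + 4 * dl * C <= c by lra.
move=> /(_ C1 al0 p1 p2 p3 wmin); rewrite -/(w x0) => H.
have ci : 0 < c^-1 by rewrite invr_gt0.
have k1 : 16 * C * D * (k%:R * (n%:R * n%:R * c^-1)) <= c.
  apply: le_trans eta_k; set kk := k%:R * _.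
  have kk0 : 0 <= kk by rewrite /kk !mulr_ge0 // ltW.
  have -> : 16 * C * D * kk = 16 * C * kk * D by ring.
  by rewrite ler_wpM2l ?mulr_ge0 ?(ltW C0) // ltW.
have H1 : 2 * (eps * A) * c <= 2 * (eps * A) * (2 * c - 16 * C * D * (k%:R * (n%:R * n%:R * c^-1))).
  rewrite ler_wpM2l ?mulr_ge0 //; lra.
have E1 : 2 * (eps * A) * c = c^-1 * (4 * eps) by rewrite /A; field; exact: lt0r_neq0.
have H2 : n%:R * (2 * (eps * A) * D) <= eps.
  have -> : n%:R * (2 * (eps * A) * D) = eps * (2 * n%:R * A * D) by ring.
  rewrite -[leRHS]mulr1 ler_wpM2l ?(ltW eps0) //; apply: le_trans eta_A.
  by rewrite ler_wpM2l ?(ltW x0e) // mulr_ge0 ?A_ge0 // mulr_ge0.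
have H3 : c^-1 * (4 * eps) <=
    c^-1 * (w x0 + n%:R * (2 * (eps * A) * D + 2 * dl * (1 + 2 * C * B)) + 4 * dl * C * n%:R).
  rewrite -E1 mulrDr.
  have -> : c^-1 * (4 * dl * C * n%:R) = 4 * dl * C * (n%:R * c^-1) by ring.
  lra.
rewrite ler_pM2l // in H3.
move: wle; rewrite mulrDr mulr1 => wle.
rewrite /M in dM; lra.
Qed.

Lemma no_barrier_min al be ga x0 : 0 <= al -> 0 < be -> 0 <= ga ->
  0 < dE E x0 -> dE E x0 < eta -> 32 * C * k%:R * dE E x0 <= 4 ->
  64 * C * k%:R * ga <= be ->
  (k.+2%:R * c^-1 + 16 * C * k%:R * be) * (2 * dE E x0) < be ->
  (\forall x \near x0, w x0 - barrier al be ga (dE E x0 ^+ 2) <=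
                       w x - barrier al be ga (dE E x ^+ 2)) -> False.
Proof.
move=> al0 be0 ga0 x00 x0e c2 c3 c4 wmin.
have Ox := in_OE x00 (ltW x0e).
have OOE : Omega `\` E `<=` Omega by move=> x [].
have oOE := open_OE oO cE.
have C1 : 16 * C * dE E x0 <= 1.
  by apply: le_trans eta_C; rewrite ler_wpM2l ?mulr_ge0 ?(ltW C0) // ltW.
have Kv d : - c^-1 * dot d d <= qform (hess v x0) d.
  have [e xe] := nearest_exists cE E0 x0.
  by apply: (hessE xe.1); rewrite -(dE_nearest xe); exact: lt_trans x0e eta_c.
exact: (@barrier_no_min R n E k C cE C0 tanE (Omega `\` E) u v x0 c^-1 al be ga kn oOE u_C2
  (Cm_subset oO oOE OOE v_C2) Ox x00 (u_eig Ox) Kv al0 be0 ga0 C1 c2 c3 c4 wmin).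
Qed.

Section excess.
Variables (eps dl : R).
Hypotheses (eps0 : 0 < eps) (dl0 : 0 < dl).

Let W x := w x - eps * (1 + A * dE E x ^+ 2).

Hypotheses (e4 : 4 * eps <= c) (e5 : 2 * (eps * A) * (1 + 2 * k%:R) <= c / 2).
Hypotheses (dM : dl * M < eps) (d1 : dl * (2 * B) <= c / 2)
  (d2 : dl * (2 * (1 + 2 * C * B)) <= c / 2) (d4 : dl * (4 * C) <= c / 2).
Hypothesis at_eta : forall x, dE E x = eta -> 2 * eps + 2 * dl * B < w x.
Variable m0 : R.
Hypotheses (m0_lt0 : m0 < 0) (m0_le : forall x, 0 < dE E x -> dE E x <= eta -> m0 <= W x).

Lemma excess_le x : 0 < dE E x -> dE E x <= eta -> eps * (1 + A * dE E x ^+ 2) <= 2 * eps.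
Proof.
move=> x0 xe; have [_ H] := A_eta (ltW x0) xe.
have : eps * (A * dE E x ^+ 2) <= eps * 1 by rewrite ler_wpM2l // ltW.
rewrite mulrDr; lra.
Qed.

Lemma quad_continuous x : {for x, continuous (fun x => eps * A * (dE E x * dE E x))}.
Proof.
have dc : {for x, continuous (dE E)} by exact: dE_continuous.
exact: continuous_atZ (continuous_atM dc dc).
Qed.

(** The factor [2 * dl] is twice the claimed slope because the tilt at [xh] is d - C d^2, which is
    at least d/2. If the claim fails, the tilted function is below [eps + m0] at [xh]; near [E] it
    is at least [eps + m0] minus O(d), and [at_eta] excludes a minimum on the outer boundary. *)
Lemma linear_growth xh : 0 < dE E xh -> dE E xh <= eta -> 2 * C * dE E xh <= 1 ->
  dl * dE E xh <= W xh - m0.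
Proof.
move=> h0 he hC; rewrite leNgt; apply/negP => hW.
have [eh xeh] := nearest_exists cE E0 xh.
have hE := dE_nearest xeh.
pose nu := (dE E xh)^-1 *: (xh - eh).
have [T [Tx Tnu]] := tanE xeh.1.
have nuT i : dot nu (row i T) = 0 by rewrite /nu dotZl (Tx _ xeh) mulr0.
have nuE : enorm nu = 1.
  by rewrite /nu enormZ -hE ger0_norm ?invr_ge0 ?(ltW h0) // mulVf // lt0r_neq0.
have nu1 : enorm nu <= 1 by rewrite nuE.
have Enu e : E e -> dot (e - eh) nu <= C * dot (e - eh) (e - eh).
  move=> Ee; have := Tnu nu nuT e Ee; rewrite invrK nuE mulr1 dotC.
  by apply: le_trans; exact: ler_norm.
have EeB e : E e -> enorm (e - eh) <= B.
  by move=> Ee; apply: (EB _ xeh.1); rewrite (dE_eq0 cE E0 e).2.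
have xB x : dE E x <= eta -> enorm (x - eh) <= B.
  by move=> xe; apply: (EB _ xeh.1); exact: le_trans xe eta_1.
pose f x := w x - (eps * A * (dE E x * dE E x) + 2 * dl * tilt eh nu C x).
have fW x : f x = W x + eps - 2 * dl * tilt eh nu C x by rewrite /f /W; ring.
have th : tilt eh nu C xh = dE E xh - C * dE E xh ^+ 2.
  rewrite /tilt -sqr_enorm -hE /nu dotZr -sqr_enorm -hE; field; exact: lt0r_neq0.
have fh : f xh < eps + m0.
  rewrite fW th; have : 2 * C * dE E xh * dE E xh <= 1 * dE E xh by rewrite ler_wpM2r // ltW.
  move=> H; have : dl * (2 * C * dE E xh * dE E xh) <= dl * (1 * dE E xh) by rewrite ler_wpM2l // ltW.
  move: hW; rewrite expr2; lra.
(* For d below [gap / M1] the tilt takes less than [gap] from the lower bound [eps + m0], so points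
   that close to [E] do not fall below [f xh]. *)
pose M1 := 2 * dl * (1 + 2 * C * B) + 1.
have CB : 0 <= 1 + 2 * C * B by rewrite addr_ge0 // !mulr_ge0 // ltW.
have M10 : 0 < M1 by rewrite ltr_wpDl // !mulr_ge0 // ltW.
pose gap := eps + m0 - f xh.
have gap0 : 0 < gap by rewrite subr_gt0.
pose a := Num.min (dE E xh) (gap / M1).
have a0 : 0 < a by rewrite lt_min h0 divr_gt0.
have small x : 0 < dE E x -> dE E x <= eta -> dE E x < a -> f xh <= f x.
  move=> x0 xe; rewrite lt_min => /andP[_]; rewrite ltr_pdivlMr // => xg.
  have := tilt_le_dE cE E0 (ltW C0) B0 nu1 Enu EeB (xB x xe).
  move/(ler_wpM2l (ltW dl0)) => H.
  rewrite (fW x); have := m0_le x0 xe; move: xg H; rewrite /gap /M1; lra.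
have fc x : a <= dE E x <= eta -> {for x, continuous f}.
  move=> /andP[ax xe]; have x0 := lt_le_trans a0 ax.
  apply: continuous_atB; first exact: w_continuous.
  apply: continuous_atD; first exact: quad_continuous.
  by apply: continuous_atZ; exact: tilt_continuous.
have hab : a <= dE E xh <= eta by rewrite he andbT ge_min lexx.
have [x1 /andP[ax1 x1e] x1m] := band_min cE E0 fc hab.
have x10 := lt_le_trans a0 ax1.
have fx1 : f x1 < eps + m0 := le_lt_trans (x1m _ hab) fh.
have tB : 2 * dl * tilt eh nu C x1 <= 2 * dl * B.
  by rewrite ler_wpM2l ?mulr_ge0 ?(ltW dl0) // tilt_le ?(ltW C0) // xB.
have wx1 : w x1 <= eps * (1 + A * dE E x1 ^+ 2) + 2 * dl * B.
  have := m0_lt0; move: fx1; rewrite fW /W; lra.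
have x1lt : dE E x1 < eta.
  rewrite lt_def x1e andbT; apply/eqP => /esym x1eta.
  have := at_eta x1eta; have := excess_le x10 x1e; lra.
apply: (no_tilted_min eps0 (ltW dl0) dM e4 d1 d2 e5 d4 xeh.1 nu1 x10 x1lt wx1).
apply: filterS (dE_between_near cE E0 x10 x1lt) => x [x0 xe].
rewrite !expr2 -/(f x1) -/(f x).
have [ax|xa] := leP a (dE E x); first by apply: x1m; rewrite ax ltW.
exact: le_trans (x1m _ hab) (small x x0 (ltW xe) xa).
Qed.

(** [ga] is chosen after the point [y] at which the bound would fail, yet the bound is independent
    of it. At distance [eta1] linear growth leaves [dl / 2 * eta1] after the linear term is
    subtracted; near [E] the logarithm takes over. The coefficient [eps * A] in the barrier accounts
    for passing from [W] to [w]. *)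
Lemma barrier_bound eta1 : 0 < eta1 -> eta1 <= eta -> 32 * C * k%:R * eta1 <= 4 ->
  (k.+2%:R * c^-1 + 16 * C * k%:R * (dl / 2)) * (2 * eta1) < dl / 2 ->
  (forall x, 0 < dE E x -> dE E x <= eta1 -> dl * dE E x <= W x - m0) ->
  forall x, 0 < dE E x -> dE E x <= eta1 -> dl / 2 * eta1 <= W x - m0.
Proof.
move=> eta10 eta1e c2 c4 lin y y0 y1; rewrite leNgt; apply/negP => yW.
set c1 := dl / 2 * eta1 in yW.
have be0 : 0 < dl / 2 by rewrite divr_gt0.
have c10 : 0 < c1 by rewrite mulr_gt0.
(* The logarithm at [y] relative to its value at distance [eta1]; a small [ga] makes its
   contribution at most half of the assumed deficit at [y]. *)
pose Ly := ln (dE E y ^+ 2) - ln (eta1 ^+ 2).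
have [ga ga0 [g1 g2]] : exists2 ga : R, 0 < ga &
    - Ly * ga <= (c1 - (W y - m0)) / 2 /\ 64 * C * k%:R * ga <= dl / 2.
  have gp : 0 < (c1 - (W y - m0)) / 2 by rewrite divr_gt0 // subr_gt0.
  exact: near0_right_ex (filterI (near0_le (- Ly) gp) (near0_le (64 * C * k%:R) be0)).
pose G x := barrier (eps * A) (dl / 2) ga (dE E x ^+ 2).
pose f x := w x - G x.
have sq x : 0 < dE E x -> Num.sqrt (dE E x ^+ 2) = dE E x.
  by move=> x0; rewrite sqrtr_sqr gtr0_norm.
pose cst := eps + m0 - ga * ln (eta1 ^+ 2).
have fE x : 0 < dE E x -> f x = W x - m0 - dl / 2 * dE E x -
    ga * (ln (dE E x ^+ 2) - ln (eta1 ^+ 2)) + cst.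
  by move=> x0; rewrite /f /G /barrier sq // /W /cst; ring.
have fy : f y < c1 + cst.
  rewrite fE // ltrD2r -/Ly; have : 0 <= dl / 2 * dE E y by rewrite mulr_ge0 // ltW.
  move: g1 yW; lra.
(* Below the distance [eta1 * expR (- c1 / ga)] the logarithmic term of [f] is at least [2 * c1],
   which puts [f] above [f y]. *)
pose a := Num.min (dE E y) (eta1 * expR (- c1 / ga)).
have a0 : 0 < a by rewrite lt_min y0 mulr_gt0 // expR_gt0.
have small x : 0 < dE E x -> dE E x <= eta1 -> dE E x < a -> f y <= f x.
  move=> x0 x1; rewrite lt_min => /andP[_ xs]; apply: ltW; apply: lt_le_trans fy _.
  rewrite fE // lerD2r.
  have l1 : ln (dE E x) <= ln eta1 + (- c1 / ga).
    rewrite -[X in _ + X]expRK -lnM ?posrE ?expR_gt0 // ler_ln ?posrE ?mulr_gt0 ?expR_gt0 //.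
    exact: ltW.
  have l2 : ga * (ln (dE E x ^+ 2) - ln (eta1 ^+ 2)) <= - 2 * c1.
    rewrite !lnXn // -mulrnBl -mulr_natl.
    have : ga * (ln (dE E x) - ln eta1) <= ga * (- c1 / ga) by rewrite ler_wpM2l ?(ltW ga0) // lerBlDl.
    have -> : ga * (- c1 / ga) = - c1 by field; exact: lt0r_neq0.
    lra.
  have := lin x x0 x1; have : 0 <= dl * dE E x by rewrite mulr_ge0 // ltW.
  lra.
have fc x : a <= dE E x <= eta1 -> {for x, continuous f}.
  move=> /andP[ax x1]; have x0 := lt_le_trans a0 ax.
  apply: continuous_atB; first exact: w_continuous x0 (le_trans x1 eta1e).
  have dx : {for x, continuous (fun y => dE E y ^+ 2)}.
    apply: continuous_atM; exact: dE_continuous.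
  apply: (continuous_comp dx); apply: barrier_continuous; exact: exprn_gt0.
have yab : a <= dE E y <= eta1 by rewrite y1 andbT ge_min lexx.
have [x1 /andP[ax1 x1e] x1m] := band_min cE E0 fc yab.
have x10 := lt_le_trans a0 ax1.
have fx1 : f x1 < c1 + cst := le_lt_trans (x1m _ yab) fy.
have x1lt : dE E x1 < eta1.
  rewrite lt_def x1e andbT; apply/eqP => x1eta.
  move: fx1; rewrite fE // -x1eta subrr mulr0 subr0 ltrD2r.
  have := lin x1 x10 x1e; rewrite /c1 -x1eta; lra.
have A0 : 0 <= eps * A by rewrite mulr_ge0 ?A_ge0 // ltW.
have c2' : 32 * C * k%:R * dE E x1 <= 4.
  by apply: le_trans c2; rewrite ler_wpM2l // !mulr_ge0 // ltW.
have c4' : (k.+2%:R * c^-1 + 16 * C * k%:R * (dl / 2)) * (2 * dE E x1) < dl / 2.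
  apply: le_lt_trans c4; rewrite ler_wpM2l //; last by rewrite ler_wpM2l.
  by rewrite addr_ge0 // !mulr_ge0 ?invr_ge0 // ltW.
apply: (no_barrier_min A0 be0 (ltW ga0) x10 (lt_le_trans x1lt eta1e) c2' g2 c4').
apply: filterS (dE_between_near cE E0 x10 x1lt) => x [x0 xe].
rewrite -/(G x1) -/(G x) -/(f x1) -/(f x).
have [ax|xa] := leP a (dE E x); first by apply: x1m; rewrite ax ltW.
exact: le_trans (x1m _ yab) (small x x0 (ltW xe) xa).
Qed.

(** Close to [E] the barrier provides the margin. On the remaining compact band, a minimum of at
    most [m0] would lie in the interior, which [no_tilted_min] excludes. *)
Lemma excess_not_inf : exists2 mu : R, 0 < mu &
  forall x, 0 < dE E x -> dE E x <= eta -> m0 + mu <= W x.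
Proof.
have be0 : 0 < dl / 2 by rewrite divr_gt0.
have b2 : 0 < dl / 4 by rewrite divr_gt0.
have b4 : 0 < (4 : R) by [].
have [eta1 eta10 [[h1 h2] [h3 h4]]] : exists2 eta1 : R, 0 < eta1 &
    (1 * eta1 <= eta /\ 2 * C * eta1 <= 1) /\ (32 * C * k%:R * eta1 <= 4 /\
    (k.+2%:R * c^-1 + 16 * C * k%:R * (dl / 2)) * 2 * eta1 <= dl / 4).
  exact: near0_right_ex (filterI (filterI (near0_le 1 eta0) (near0_le (2 * C) ltr01))
    (filterI (near0_le (32 * C * k%:R) b4)
      (near0_le ((k.+2%:R * c^-1 + 16 * C * k%:R * (dl / 2)) * 2) b2))).
rewrite mul1r in h1.
have lin x : 0 < dE E x -> dE E x <= eta1 -> dl * dE E x <= W x - m0.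
  move=> x0 x1; apply: linear_growth => //; first exact: le_trans h1.
  by apply: le_trans h2; rewrite ler_wpM2l // mulr_ge0 // ltW.
have c4 : (k.+2%:R * c^-1 + 16 * C * k%:R * (dl / 2)) * (2 * eta1) < dl / 2.
  apply: (@le_lt_trans _ _ (dl / 4)); first by move: h4; congr (_ <= _); ring.
  lra.
have near := barrier_bound eta10 h1 h3 c4 lin.
set c1 := dl / 2 * eta1 in near.
have c10 : 0 < c1 by rewrite mulr_gt0.
have [[y yab]|none] := pselect (exists y, eta1 <= dE E y <= eta); last first.
  exists c1 => // x x0 xe; have [x1|x1] := leP (dE E x) eta1; first by have := near x x0 x1; lra.
  by case: none; exists x; rewrite xe ltW.
(* The summand 0 is what the tilt term of [no_tilted_min] becomes for [dl = 0]. *)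
have Wc x : eta1 <= dE E x <= eta -> {for x, continuous (fun x => w x - (eps * A * (dE E x * dE E x) + 0))}.
  move=> /andP[x1 xe]; have x0 := lt_le_trans eta10 x1.
  apply: continuous_atB; first exact: w_continuous.
  apply: continuous_atD; first exact: quad_continuous.
  exact: continuous_at_cst.
have [x1 /andP[x11 x1e] x1m] := band_min cE E0 Wc yab.
have x10 := lt_le_trans eta10 x11.
have WE x : W x = w x - (eps * A * (dE E x * dE E x) + 0) - eps by rewrite /W; ring.
have [pos|neg] := ltP m0 (W x1).
  exists (Num.min c1 (W x1 - m0)); first by rewrite lt_min c10 subr_gt0.
  move=> x x0 xe; have [xl|xl] := leP (dE E x) eta1.
    have := near x x0 xl; have : Num.min c1 (W x1 - m0) <= c1 by rewrite ge_min lexx.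
    lra.
  have H : W x1 <= W x by rewrite !WE lerD2r; apply: x1m; rewrite xe ltW.
  have : Num.min c1 (W x1 - m0) <= W x1 - m0 by rewrite ge_min lexx orbT.
  lra.
exfalso.
have BD : 0 <= 2 * dl * B by rewrite !mulr_ge0 // ltW.
have x1lt : dE E x1 < eta.
  rewrite lt_def x1e andbT; apply/eqP => /esym x1eta.
  have := at_eta x1eta; have := excess_le x10 x1e; have := m0_lt0; have := eps0; move: neg; rewrite /W; lra.
have x1gt : eta1 < dE E x1.
  rewrite lt_def x11 andbT; apply/eqP => x1eta.
  have := near x1 x10 _; rewrite x1eta lexx => /(_ isT); lra.
have [e xe] := nearest_exists cE E0 x1.
have wx1 : w x1 <= eps * (1 + A * dE E x1 ^+ 2) + 2 * 0 * B.
  by have := m0_lt0; have := eps0; move: neg; rewrite /W; lra.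
(* Without a tilt, [dl] and [nu] are 0 and any point of [E] may serve as [eh]. *)
apply: (@no_tilted_min eps 0 x1 e 0 eps0 (lexx _) _ e4 _ _ e5 _ xe.1 _ x10 x1lt wx1);
  rewrite ?mul0r ?divr_ge0 ?(ltW c0) ?enorm0 //.
apply: filterS (dE_between_near cE E0 x1gt x1lt) => x [x0 xlt].
by rewrite !mulr0 !mul0r !expr2; apply: x1m; rewrite !ltW.
Qed.

End excess.

Lemma core_bound : exists2 c1 : R, 0 < c1 &
  forall x, 0 < dE E x -> dE E x <= eta -> c1 <= w x.
Proof.
have [c2 c20 c2w] : exists2 c2 : R, 0 < c2 & forall x, dE E x = eta -> c2 <= w x.
  have [[y ye]|none] := pselect (exists y, dE E y = eta); last first.
    by exists 1 => // x xe; case: none; exists x.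
  have wc x : eta <= dE E x <= eta -> {for x, continuous w}.
    by move=> /andP[x1 xe]; apply: w_continuous => //; exact: lt_le_trans x1.
  have yab : eta <= dE E y <= eta by rewrite ye lexx.
  have [x /andP[x1 xe] xm] := band_min cE E0 wc yab.
  exists (w x); last by move=> z ze; apply: xm; rewrite ze lexx.
  by rewrite /w subr_gt0; apply: u_gt_v; apply: in_OE => //; exact: lt_le_trans x1.
(* The order of choice matters: [c2] bounds [w] on the outer boundary, [eps] is small against [c2]
   and [c], and [dl] is later small against all three. *)
have [eps eps0 [e1 [e2 e3]]] : exists2 eps : R, 0 < eps &
    4 * eps <= c2 /\ (4 * eps <= c /\ 2 * A * (1 + 2 * k%:R) * eps <= c / 2).
  have cc : 0 < c / 2 by rewrite divr_gt0.
  exact: near0_right_ex (filterI (near0_le 4 c20) (filterI (near0_le 4 c0)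
    (near0_le (2 * A * (1 + 2 * k%:R)) cc))).
have [eps_le|nle] := pselect (forall x, 0 < dE E x -> dE E x <= eta ->
    eps * (1 + A * dE E x ^+ 2) <= w x).
  exists eps => // x x0 xe; apply: le_trans (eps_le x x0 xe).
  by rewrite mulrDr mulr1 lerDl mulr_ge0 ?(ltW eps0) // mulr_ge0 ?A_ge0 // sqr_ge0.
exfalso.
have [y y0 [ye yw]] : exists2 y, 0 < dE E y & dE E y <= eta /\ w y < eps * (1 + A * dE E y ^+ 2).
  apply: contrapT => no; apply: nle => x x0 xe; rewrite leNgt; apply/negP => xw.
  by apply: no; exists x.
pose W x := w x - eps * (1 + A * dE E x ^+ 2).
pose S := [set x | 0 < dE E x /\ dE E x <= eta].
have Wlow x : S x -> - (2 * eps) <= W x.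
  move=> [x0 xe]; have := excess_le eps0 x0 xe.
  have : 0 <= w x by rewrite /w subr_ge0 ltW // u_gt_v //; exact: in_OE.
  rewrite /W; lra.
have hinf : has_inf (W @` S).
  by split; [exists (W y), y | exists (- (2 * eps)) => _ [x Sx <-]; exact: Wlow].
pose m0 := inf (W @` S).
have m0_le x : 0 < dE E x -> dE E x <= eta -> m0 <= W x.
  by move=> x0 xe; apply: ge_inf; [exact: hinf.2 | exists x].
have m0_lt0 : m0 < 0 by apply: le_lt_trans (m0_le y y0 ye) _; rewrite subr_lt0.
have e5 : 2 * (eps * A) * (1 + 2 * k%:R) <= c / 2 by move: e3; congr (_ <= _); ring.
have ce : 0 < eps / 2 by rewrite divr_gt0.
have cc : 0 < c / 2 by rewrite divr_gt0.
have c24 : 0 < c2 / 4 by rewrite divr_gt0.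
have [dl dl0 [[k1 k2] [[k3 k4] k5]]] : exists2 dl : R, 0 < dl &
   (M * dl <= eps / 2 /\ 2 * B * dl <= c / 2) /\
   ((2 * (1 + 2 * C * B) * dl <= c / 2 /\ 4 * C * dl <= c / 2) /\ 2 * B * dl <= c2 / 4).
  exact: near0_right_ex (filterI (filterI (near0_le M ce) (near0_le (2 * B) cc))
    (filterI (filterI (near0_le (2 * (1 + 2 * C * B)) cc) (near0_le (4 * C) cc)) (near0_le (2 * B) c24))).
have dM : dl * M < eps by rewrite mulrC; apply: le_lt_trans k1 _; lra.
have at_eta x : dE E x = eta -> 2 * eps + 2 * dl * B < w x.
  move=> /c2w; move: k5; have -> : 2 * B * dl = 2 * dl * B by ring.
  lra.
rewrite ![_ * dl]mulrC in k2 k3 k4.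
have [mu mu0 muW] := excess_not_inf eps0 dl0 e2 e5 dM k2 k3 k4 at_eta m0_lt0 m0_le.
have [_ [x [x0 xe] <-]] := inf_adherent mu0 hinf.
by rewrite ltNge muW.
Qed.

End constants.

End core.

Lemma difference_lower_bound (Omega : set 'rV[R]_n) (F : jet R n -> R)
    (u v : 'rV[R]_n -> R) (E : set 'rV[R]_n) (k : nat) :
  open Omega -> C1_operator Omega F ->
  (forall x (s : R) p M, Omega x -> symmx M -> posdefmx (- dF_dM F (x, s, p, M))) ->
  Cm 2 Omega v -> Cm 2 (Omega `\` E) u -> closed_submanifold k E -> E !=set0 ->
  E `<=` Omega -> (k.+2 <= n)%N ->
  (forall x, (Omega `\` E) x -> \sum_(i < k.+2) lambda i (hess u x) <= 0) ->
  (forall x, (Omega `\` E) x -> v x < u x) ->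
  (forall x, (Omega `\` E) x ->
    F (x, v x, grad v x, hess v x) <= F (x, u x, grad u x, hess u x)) ->
  exists2 c1 : R, 0 < c1 & exists2 eta : R, 0 < eta &
    forall x, (Omega `\` E) x -> dE E x < eta -> c1 <= u x - v x.
Proof.
move=> oO F_C1 F_ell v2 u2 sE E0 EO kn u_eig u_gt F_ge.
have cE := sE.1.
have [C C0 tanE] := tangent_uniform (leq_trans (leqnSn k) (ltnW kn)) sE.
have nc := (compact_near_coveringP E).1 cE.
have U1 := nc R (0 : R)^'+ (fun c e => uniform_at Omega F v c e) _
  (fun e Ee => uniform_near oO F_C1 F_ell v2 (EO e Ee)).
have U2 := nc R (0 : R)^'+ (fun c e => forall x, enorm (x - e) < c ->
    forall w, - c^-1 * dot w w <= qform (hess v x) w) _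
  (fun e Ee => hess_lower_near oO v2 (EO e Ee)).
(* Both families of estimates hold for all small [c], hence for a common one. *)
have [c c0 [uniE hessE]] := near0_right_ex (filterI (U1 _) (U2 _)).
have [B B0 EB] := dE_bounded cE E0.
have [r r0 rO] := dE_nbhd cE E0 oO EO.
have r2 : 0 < r / 2 by rewrite divr_gt0.
have c2 : 0 < c / 2 by rewrite divr_gt0.
have [eta eta0 [[h1 h2] [[h3 h4] [h5 h6]]]] : exists2 eta : R, 0 < eta &
  (1 * eta <= r / 2 /\ 1 * eta <= c / 2) /\ ((1 * eta <= 1 /\ 16 * C * eta <= 1) /\
  (16 * C * (k%:R * (n%:R * n%:R * c^-1)) * eta <= c /\
   2 * n%:R * (2 * c^-1 ^+ 2) * eta <= 1)).
  exact: near0_right_ex (filterI (filterI (near0_le 1 r2) (near0_le 1 c2))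
    (filterI (filterI (near0_le 1 ltr01) (near0_le (16 * C) ltr01))
    (filterI (near0_le (16 * C * (k%:R * (n%:R * n%:R * c^-1))) c0)
      (near0_le (2 * n%:R * (2 * c^-1 ^+ 2)) ltr01)))).
rewrite !mul1r in h1 h2 h3.
have etaO x : dE E x <= eta -> Omega x by move=> xe; apply: rO; lra.
have eta_c : eta < c by lra.
have [c1 c10 H] := @core_bound Omega F oO F_C1 F_ell u v E k v2 cE E0 u2 kn u_eig u_gt F_ge
  C c B eta C0 c0 B0 eta0 tanE uniE hessE EB etaO eta_c h3 h4 h5 h6.
exists c1 => //; exists eta => // x [_ nEx] xe; apply: H; last exact: ltW.
exact: dE_gt0.
Qed.

End Assembly.

Theorem theorem1p2 (R : realType) (n : nat) (n_ge2 : (2 <= n)%N)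
    (Omega : set 'rV[R]_n) (Omega_domain : domain Omega)
    (F : jet R n -> R) (F_C1 : C1_operator Omega F)
    (F_elliptic : forall (x : 'rV[R]_n) (s : R) (p : 'rV[R]_n) (M : 'M[R]_n),
      Omega x -> symmx M -> posdefmx (- dF_dM F (x, s, p, M)))
    (k : nat) (k_le : (k <= n - 2)%N)
    (E : set 'rV[R]_n) (E_sub : E `<=` Omega) (E_subm : closed_submanifold k E)
    (u v : 'rV[R]_n -> R)
    (u_C2 : Cm 2 (Omega `\` E) u) (v_C2 : Cm 2 Omega v)
    (u_eig : forall x, (Omega `\` E) x ->
      \sum_(i < k.+2) lambda i (hess u x) <= 0)
    (u_gt_v : forall x, (Omega `\` E) x -> v x < u x)
    (F_ge : forall x, (Omega `\` E) x ->
      F (x, v x, grad v x, hess v x) <= F (x, u x, grad u x, hess u x)) :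
  (0 < limf_einf (fun x => (u x - v x)%:E) (dist_to0 (Omega `\` E) E))%E.
Proof.
case: Omega_domain => _ _ oO.
have kn : (k.+2 <= n)%N by rewrite -addn2 -(subnK n_ge2) leq_add2r.
(* The lower limit is a supremum of infima over the sets of the filter, so a positive lower bound on
   one of these sets is enough. *)
have wit (d c : R) : 0 < d -> 0 < c ->
    (forall x, (Omega `\` E) x -> (eucl_dist x E < d%:E)%E -> c <= u x - v x) ->
    (0 < limf_einf (fun x => (u x - v x)%:E) (dist_to0 (Omega `\` E) E))%E.
  move=> d0 c0 H; apply: (@lt_le_trans _ _ c%:E); first by rewrite lte_fin.
  rewrite limf_einfE; apply: le_ereal_sup_tmp.
  exists (ereal_inf [set (u x - v x)%:E | x in
    [set x | (Omega `\` E) x /\ (eucl_dist x E < d%:E)%E]]); last first.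
    by apply: le_ereal_inf_tmp => _ [x [Ox xd] <-]; rewrite lee_fin; exact: H.
  by exists [set x | (Omega `\` E) x /\ (eucl_dist x E < d%:E)%E] => //; exists d.
(* For empty [E] every distance is +oo, so the set of points at distance below 1 is empty and any
   bound holds on it. *)
have [E0|/set0P E0] := eqVneq E set0.
  apply: (wit 1 1) => // x _; rewrite E0 /eucl_dist image_set0 ereal_inf0.
  by rewrite ltNge leey.
have [c c0 [d d0 H]] := difference_lower_bound oO F_C1 F_elliptic v_C2 u_C2 E_subm E0
  E_sub kn u_eig u_gt_v F_ge.
apply: (wit d c) => // x Ox; rewrite (eucl_dist_dE E_subm.1 E0) lte_fin.
exact: H.
Qed.
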